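(* Let $u$ be a solution of the obstacle problem in $B_1$ and let $0$ be a regular point. For $0<r<1$ let $c_r(x):=|x|^3u_r\!\left(\frac{x}{|x|}\right)$. Let $\kappa\in(0,1)$ and $r_0\in(0,1)$, and assume that the epiperimetric inequality holds with $\kappa$ for every $c_r$ with $0<r\le r_0$; that is, for every $r\in(0,r_0]$ there is $v\in W^{1,2}(B_1)$ with $v=c_r$ on $\partial B_1$ and $$M(v)\le(1-\kappa)M(c_r)+\kappa M(h_{\theta_1})\quad\text{for some } h_{\theta_1}\in\mathbb{H}.$$ Let $u_0$ be an arbitrary blowup limit of $u$ at $0$. Then $$|\Phi(r)-\Phi(0)|\le|\Phi(r_0)-\Phi(0)|\left(\frac{r}{r_0}\right)^{\frac{6\kappa}{1-\kappa}}\quad\text{for } r\in(0,r_0),$$ and there is a constant $C(\kappa)>0$ such that $$\int_{\partial B_1}\left|\frac{u(rx)}{r^3}-u_0(x)\right|d\mathcal{H}^1\le C(\kappa)\,r^{\frac{3\kappa}{1-\kappa}}\quad\text{for } r\in(0,r_0/2);$$ hence $u_0$ is the unique blowup limit of $u$ at $0$.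
   Context: $B_r\subset\mathbb{R}^2$ is the open ball of radius $r$ centered at $0$. A solution of the obstacle problem is a function $u\ge0$ on $B_1$ with $\Delta u=|x|\chi_{\{u>0\}}$ in $B_1$ in the sense of distributions (such functions are of class $C^{1,1}_{loc}$). Weiss energy at the origin: $$\Phi(r)=\Phi(r,u)=\frac1{r^6}\int_{B_r}\left(|\nabla u|^2+2|x|u^+\right)dx-\frac{3}{r^7}\int_{\partial B_r}u^2\,d\mathcal{H}^1,\qquad \Phi(0)=\Phi(0+,u)=\lim_{r\to0+}\Phi(r,u).$$ The origin is a regular point if $0\in\partial\{u=0\}$ and $\Phi(0+,u)=\frac{\pi}{81}$. Rescalings: $u_r(x)=u(rx)/r^3$. A blowup limit of $u$ at $0$ is a limit $u_0$ of $u_{r_j}$ (in $C^1_{loc}(\mathbb{R}^2)$) along some sequence $r_j\to0$. For $v\in W^{1,2}(B_1)$, $M(v):=\int_{B_1}(|\nabla v|^2+2|x|v^+)dx-3\int_{\partial B_1}v^2d\mathcal{H}^1$. $\mathbb{H}$ is the set of functions $h_{\theta_1}$, $\theta_1\in[0,2\pi)$, equal in polar coordinates to $\frac{r^3}{9}(1-\cos3(\theta-\theta_1))$ in the sector $\theta_1<\theta<\theta_1+\frac{2\pi}{3}$ and to $0$ elsewhere; $M$ takes the same value on all elements of $\mathbb{H}$.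
   Formalization: The constant C(κ) is allowed to depend on r_0 as well as on κ (it is uniform over u and u_0); a constant depending on κ alone is impossible, as solutions h_0 + w_s with w_s vanishing only in a tiny ball show. *)

(* Defs.v *)
From mathcomp Require Export all_boot all_order all_algebra.
From mathcomp Require Export all_classical all_reals all_analysis.

Set Implicit Arguments.
Unset Strict Implicit.
Unset Printing Implicit Defensive.

Export Order.TTheory GRing.Theory Num.Theory.
Export numFieldNormedType.Exports.

Local Open Scope classical_set_scope.
Local Open Scope ring_scope.

Section plane.
Context {R : realType}.

Local Notation mR := (measurableTypeR R).

(* The library's norm on R * R is the max norm; analysis in the plane uses the
   Euclidean one.  The two induce the same topology, so that differentiability,
   closure and interior can be taken from the library. *)
Definition enorm (x : R * R) : R := Num.sqrt (x.1 ^+ 2 + x.2 ^+ 2).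

Definition eball (r : R) : set (R * R) := [set x | enorm x < r].

Definition lebesgue2 : {measure set (mR * mR) -> \bar R} :=
  (@lebesgue_measure R \x @lebesgue_measure R)%E.

Definition ball_int (r : R) (f : R * R -> R) : R :=
  \int[lebesgue2]_(x in eball r) f x.

(* Integral over the circle of radius r about 0 with respect to the
   one-dimensional Hausdorff measure, through the arc length parametrization. *)
Definition circ_int (r : R) (f : R * R -> R) : R :=
  r * \int[@lebesgue_measure R]_(t in `[0, 2 * pi]) f (r * cos t, r * sin t).

Definition partial (i : bool) (f : R * R -> R) (x : R * R) : R :=
  'D_(if i then (0, 1) else (1, 0)) f x.

Definition grad (f : R * R -> R) (x : R * R) : R * R :=
  (partial false f x, partial true f x).

Definition laplacian (f : R * R -> R) (x : R * R) : R :=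
  partial false (partial false f) x + partial true (partial true f) x.

Definition C1_on (A : set (R * R)) (f : R * R -> R) : Prop :=
  forall x, A x -> differentiable f x /\ {for x, continuous (grad f)}.

Definition C11loc_ball (f : R * R -> R) : Prop :=
  C1_on (eball 1) f /\
  forall r : R, 0 < r < 1 -> exists L : R, forall x y,
    eball r x -> eball r y ->
    enorm (grad f x - grad f y) <= L * enorm (x - y).

Definition smooth (f : R * R -> R) : Prop :=
  forall (s : seq bool) x, differentiable (foldr partial f s) x.

Definition test_fun (phi : R * R -> R) : Prop :=
  smooth phi /\
  exists2 r : R, 0 < r < 1 & forall x, r <= enorm x -> phi x = 0.

(* Solutions are functions on the unit ball: the values of u outside of it are
   irrelevant.  The distributional equation determines u only up to a null set;
   the pointwise notions below (gradient, restriction to circles, {u = 0}) refer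
   to the representative of class C^{1,1}_loc. *)
Definition obstacle_solution (u : R * R -> R) : Prop :=
  [/\ C11loc_ball u,
      forall x, eball 1 x -> 0 <= u x &
      forall phi, test_fun phi ->
        ball_int 1 (fun x => u x * laplacian phi x) =
        ball_int 1 (fun x => enorm x * \1_[set y | 0 < u y] x * phi x)].

Definition Phi (u : R * R -> R) (r : R) : R :=
  r ^- 6 * ball_int r (fun x =>
    enorm (grad u x) ^+ 2 + 2 * enorm x * Num.max (u x) 0) -
  3 * r ^- 7 * circ_int r (fun x => u x ^+ 2).

Definition Phi0 (u : R * R -> R) : R := lim (Phi u r @[r --> 0^'+]).

Definition zero_set (u : R * R -> R) : set (R * R) :=
  [set x | eball 1 x /\ u x = 0].

Definition regular_point0 (u : R * R -> R) : Prop :=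
  (closure (zero_set u) `\` interior (zero_set u)) (0, 0) /\
  Phi u r @[r --> 0^'+] --> (pi / 81 : R).

Definition rescale (u : R * R -> R) (r : R) (x : R * R) : R :=
  u (r * x.1, r * x.2) / r ^+ 3.

(* rescale u (rj j) is only meaningful on the ball of radius 1 / rj j, which
   contains any given ball for j large. *)
Definition blowup_limits (u : R * R -> R) : set (R * R -> R) :=
  [set u0 | C1_on setT u0 /\
    exists rj : nat -> R,
    [/\ forall j, 0 < rj j,
        rj j @[j --> \oo] --> 0 &
        forall rho eps : R, 0 < rho -> 0 < eps ->
        \forall j \near \oo, forall x, eball rho x ->
          `|rescale u (rj j) x - u0 x| < eps /\
          enorm (grad (rescale u (rj j)) x - grad u0 x) < eps]].

(* v is in W^{1,2}(B_1), with weak gradient dv. *)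
Definition W12 (v : R * R -> R) (dv : R * R -> R * R) : Prop :=
  [/\ measurable_fun (eball 1 : set (mR * mR)) (v : mR * mR -> mR) /\
      measurable_fun (eball 1 : set (mR * mR)) (dv : mR * mR -> mR * mR),
      lebesgue2.-integrable (eball 1) (fun x => (v x ^+ 2)%:E),
      lebesgue2.-integrable (eball 1) (fun x => (enorm (dv x) ^+ 2)%:E) &
      forall phi, test_fun phi ->
        ball_int 1 (fun x => v x * partial false phi x) =
          - ball_int 1 (fun x => (dv x).1 * phi x) /\
        ball_int 1 (fun x => v x * partial true phi x) =
          - ball_int 1 (fun x => (dv x).2 * phi x)].

(* The trace on the unit circle of v in W^{1,2}(B_1), with weak gradient dv, is
   g: the L^2 limit of the restrictions to the circle of functions of class C^1
   up to the boundary converging to v in W^{1,2}(B_1). *)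
Definition has_trace (v : R * R -> R) (dv : R * R -> R * R) (g : R * R -> R)
    : Prop :=
  [/\ measurable_fun (`[0, 2 * pi] : set mR)
        (fun t => g (cos t, sin t)),
      (@lebesgue_measure R).-integrable `[0, 2 * pi]
        (fun t => (g (cos t, sin t) ^+ 2)%:E) &
      exists phi : nat -> R * R -> R,
      [/\ forall k, C1_on setT (phi k),
          ball_int 1 (fun x => (phi k x - v x) ^+ 2 +
            enorm (grad (phi k) x - dv x) ^+ 2) @[k --> \oo] --> 0 &
          circ_int 1 (fun x => (phi k x - g x) ^+ 2) @[k --> \oo] --> 0]].

(* M(v), for v in W^{1,2}(B_1) with weak gradient dv and trace g. *)
Definition weissM (v : R * R -> R) (dv : R * R -> R * R) (g : R * R -> R) : R :=
  ball_int 1 (fun x => enorm (dv x) ^+ 2 + 2 * enorm x * Num.max (v x) 0) -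
  3 * circ_int 1 (fun x => g x ^+ 2).

(* M(v), for v of class C^1 in B_1 and continuous up to the boundary. *)
Definition weissM_C1 (v : R * R -> R) : R := weissM v (grad v) v.

(* The functions h_{t1}; the angle ranges over [t1, t1 + 2 pi[, so that a
   sector crossing the half-line t = 2 pi is not truncated. *)
Definition sector_solutions : set (R * R -> R) :=
  [set h | exists2 t1 : R, 0 <= t1 < 2 * pi &
    forall r t : R, 0 <= r -> t1 <= t < t1 + 2 * pi ->
    h (r * cos t, r * sin t) =
      if t1 < t < t1 + 2 * pi / 3
      then r ^+ 3 / 9 * (1 - cos (3 * (t - t1))) else 0].

(* At x = 0 this is 0. *)
Definition hom_ext (u : R * R -> R) (r : R) (x : R * R) : R :=
  enorm x ^+ 3 * rescale u r (x.1 / enorm x, x.2 / enorm x).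

Definition epiperimetric (kappa : R) (c : R * R -> R) : Prop :=
  exists (v : R * R -> R) (dv : R * R -> R * R),
  [/\ W12 v dv, has_trace v dv c &
      exists2 h, sector_solutions h &
        weissM v dv c <=
          (1 - kappa) * weissM_C1 c + kappa * weissM_C1 h].

End plane.

(* Main.v *)
(* The derivative of the Weiss energy [Phi] is [6 / r * (M c_r - Phi r)] plus a
   nonnegative term measuring how far [u] is from homogeneous. Since [u_r] minimizes
   the energy with its own boundary values, the epiperimetric inequality bounds
   [Phi r] by [(1 - kappa) M c_r + kappa pi / 81], and the excess
   [e = Phi - pi / 81] satisfies [e' >= 6 kappa / (1 - kappa) * e / r]. Integrating
   this gives the decay of [e]. The nonnegative term controls the radial derivative
   of [u_r] in L^2 of the circle, so that [u_r] is Cauchy there at rate [sqrt e].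

   For the constant not to depend on [u], [e (r0 / 2)] is bounded in terms of [r0]:
   the mean of [u] over circles is bounded because its Laplacian is, hence the
   Dirichlet integral [G] over discs satisfies [G^4 <= C (G')^3], and such a
   function cannot be large at [r0 / 2] and finite up to [r0]. *)

Require Import Defs.
From mathcomp Require Import ring lra measurable_realfun.
Set Implicit Arguments.
Unset Strict Implicit.
Unset Printing Implicit Defensive.
Local Open Scope classical_set_scope.
Local Open Scope ring_scope.

(** * One-variable calculus *)

(** The equation holds in the sense of distributions and [u] is arbitrary outside of the unit ball,
    whereas all the estimates live on circles and balls inside it. So [u] is replaced by a C^1
    function [v] on the plane that coincides with it on a ball larger than that of radius [r0]; from
    then on the equation is used only as Green's formula for [v] on smaller balls, tested with
    arbitrary C^1 functions. Two passages to the limit lead there, both by polynomials: from smooth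
    test functions of compact support to C^1 ones, and from integrals over discs to integrals in
    polar coordinates. Bernstein polynomials serve because they approximate in the C^1 norm; cut off
    by a smooth radial function they are admissible test functions. The competitor of the
    epiperimetric inequality is only in W^{1,2}, too rough for Green's formula. Minimality is
    therefore first proved against C^1 functions with arbitrary boundary values, keeping the
    boundary error as an explicit term, which disappears in the limit along an approximation of the
    competitor. *)

Section interval_integrals.
Context {R : realType}.
Notation mu := (@lebesgue_measure R).
Implicit Types (f g F : R -> R) (a b x y : R).

(* [is_derive] as a plain proposition: type class resolution must not pick
   derivatives behind the back of the rules below. *)
Definition deriv_at f x (df : R) : Prop := is_derive x 1 f df.

Lemma continuous_integrable f a b : continuous f ->
  mu.-integrable `[a, b] (EFin \o f).
Proof.
move=> cf; apply: continuous_compact_integrable; first exact: segment_compact.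
exact: continuous_subspaceT.
Qed.

Lemma deriv_at_continuous f (df : R) x : deriv_at f x df -> continuous_at x f.
Proof.
by move=> [dfx _]; apply: differentiable_continuous; exact/derivable1_diffP.
Qed.

Lemma deriv_at_derive1 f (df : R) x : deriv_at f x df -> derive1 f x = df.
Proof. by move=> [_ <-]; rewrite derive1E. Qed.

Lemma integral_derive F f a b : a <= b -> continuous f ->
  (forall x, deriv_at F x (f x)) ->
  \int[mu]_(t in `[a, b]) f t = F b - F a.
Proof.
rewrite le_eqVlt => /predU1P[<- _ _|ab cf dF].
  by rewrite set_itv1 Rintegral_set1 subrr.
rewrite /Rintegral (@continuous_FTC2 _ f F a b) //=.
- exact: continuous_subspaceT.
- have cF : continuous F by move=> x; exact: deriv_at_continuous (dF x).
  split.
  + by move=> x _; have [] := dF x.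
  + exact/cvg_at_right_filter/cF.
  + exact/cvg_at_left_filter/cF.
- by move=> x _; exact: deriv_at_derive1.
Qed.

Lemma deriv_at_mvt (F f : R -> R) a b : a < b ->
  (forall x, a <= x <= b -> deriv_at F x (f x)) ->
  exists2 c, a < c < b & F b - F a = f c * (b - a).
Proof.
move=> ab dF.
have d1 x : x \in `]a, b[ -> is_derive x 1 F (f x).
  by rewrite in_itv/= => /andP[ax xb]; apply: dF; rewrite !ltW.
have cF : {within `[a, b], continuous F}.
  apply: derivable_within_continuous => y; rewrite in_itv/= => yab.
  by have [] := dF y yab.
by have [c] := MVT ab d1 cF; rewrite in_itv/=; exists c.
Qed.

Lemma deriv_at_0_eq F a b x y : a < x < b -> a < y < b ->
  (forall z, a < z < b -> deriv_at F z 0) -> F x = F y.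
Proof.
move=> xab yab dF.
wlog xy : x y xab yab / x < y.
  by move=> H; have [?|?|->//] := ltgtP x y; [exact: H|symmetry; exact: H].
have [|c _] := @deriv_at_mvt F (cst 0) x y xy; first by move=> z ?; apply: dF; lra.
by rewrite mul0r => /eqP; rewrite subr_eq0 => /eqP.
Qed.

(** The integral from -n is a primitive on a bounded interval only. These primitives, normalised to
    vanish at 0, agree where two of them are defined and are glued along the index [idx]. A global
    primitive turns substitutions and shifts of the integration interval into identities between its
    values. *)
Lemma primitive_exists f : continuous f ->
  exists F, forall x, deriv_at F x (f x).
Proof.
move=> cf.
have /choice[F HF] : forall n : nat, exists F : R -> R, F 0 = 0 /\
    forall x, - n%:R < x -> x < n%:R -> deriv_at F x (f x).
  move=> n.
  pose H (x : R) := \int[mu]_(t in `[- n%:R, x]) f t.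
  exists (fun x => H x - H 0); split; first by rewrite subrr.
  move=> x nx xn.
  have [dH H'] := @continuous_FTC1_closed _ f (- n%:R) x n%:R xn
    (continuous_integrable _ _ cf) nx (cf x).
  have HD : is_derive x 1 H (f x).
    by split; [exact: dH|rewrite -H' derive1E].
  have := @is_deriveB _ _ _ H (cst (H 0)) x 1 _ _ HD (is_derive_cst _ _ _).
  by rewrite subr0.
have eqF (m n : nat) x : (m <= n)%N -> - m%:R < x -> x < m%:R -> F m x = F n x.
  move=> mn mx xm.
  have mnR : m%:R <= n%:R :> R by rewrite ler_nat.
  have [F0 dF] := HF m; have [G0 dG] := HF n.
  apply/eqP; rewrite -subr_eq0; apply/eqP.
  pose D y := F m y - F n y.
  have dD y : - m%:R < y -> y < m%:R -> deriv_at D y 0.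
    move=> my ym.
    have dFy := dF y my ym.
    have dGy : is_derive y 1 (F n) (f y) by apply: dG; lra.
    by have := is_deriveB dFy dGy; rewrite subrr.
  suff : D x = D 0 by rewrite /D F0 G0 subrr.
  apply: (@deriv_at_0_eq _ (- m%:R) m%:R); [lra|lra|].
  by move=> z /andP[? ?]; exact: dD.
pose idx (x : R) := (Num.truncn `|x|).+1.
exists (fun x => F (idx x) x) => x.
pose n := (idx x).+1.
have xn : `|x| < n%:R.
  by rewrite (lt_trans (Num.Theory.truncnS_gt _))// ltr_nat.
have [xn1 xn2] : - n%:R < x /\ x < n%:R by move: xn; rewrite ltr_norml => /andP.
have dFn := (HF n).2 x xn1 xn2.
(* [idx] jumps, so around [x] the glued function is compared with the single primitive [F n]. *)
apply: (@near_eq_is_derive _ _ _ (F n)) => //.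
near=> y.
have y1 : `|y| < (idx x).+1%:R.
  near: y; apply: (cvgr_lt `|x|); first exact: norm_continuous.
  exact: xn.
have y2 : `|y| < (idx y)%:R by exact: Num.Theory.truncnS_gt.
have [le_|/ltnW le_] := leqP (idx y) n.
- by move: y2; rewrite ltr_norml => /andP[? ?]; rewrite (eqF (idx y) n).
- by move: y1; rewrite ltr_norml => /andP[? ?]; rewrite (eqF n (idx y)).
Unshelve. all: end_near. Qed.

End interval_integrals.

(** * Rules for continuity and differentiation *)

Section pointwise_continuity.
Context {R : realType} {T : topologicalType}.
Implicit Types (f g : T -> R) (x : T).

Lemma contD f g x : continuous_at x f -> continuous_at x g ->
  continuous_at x (fun y => f y + g y).
Proof. by move=> cf cg; exact: (cvgD cf cg). Qed.

Lemma contB f g x : continuous_at x f -> continuous_at x g ->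
  continuous_at x (fun y => f y - g y).
Proof. by move=> cf cg; exact: (cvgB cf cg). Qed.

Lemma contM f g x : continuous_at x f -> continuous_at x g ->
  continuous_at x (fun y => f y * g y).
Proof. by move=> cf cg; exact: (cvgM cf cg). Qed.

Lemma contN f x : continuous_at x f -> continuous_at x (fun y => - f y).
Proof. by move=> cf; exact: (cvgN cf). Qed.

Lemma contX f x n : continuous_at x f -> continuous_at x (fun y => f y ^+ n).
Proof.
move=> cf; elim: n => [|n IH]; first exact: cvg_cst.
have -> : (fun y => f y ^+ n.+1) = (fun y => f y * f y ^+ n).
  by apply/funext => y; rewrite exprS.
exact: contM.
Qed.

Lemma cont_cst (c : R) x : continuous_at x (fun _ : T => c).
Proof. exact: cvg_cst. Qed.

Lemma cont_abs f x : continuous_at x f -> continuous_at x (fun y => `|f y|).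
Proof. by move=> cf; exact: (cvg_norm cf). Qed.

Lemma cont_max f g x : continuous_at x f -> continuous_at x g ->
  continuous_at x (fun y => Num.max (f y) (g y)).
Proof. by move=> cf cg; exact: (continuous_max cf cg). Qed.

Lemma cont_comp {U V : topologicalType} (h : U -> V) (k : T -> U) x :
  continuous_at (k x) h -> continuous_at x k ->
  continuous_at x (fun y => h (k y)).
Proof. by move=> ch ck; exact: (continuous_comp ck ch). Qed.

Lemma cont_pair {U V : topologicalType} (h : T -> U) (k : T -> V) x :
  continuous_at x h -> continuous_at x k ->
  continuous_at x (fun y => (h y, k y)).
Proof. by move=> ch ck; exact: cvg_pair. Qed.

Lemma cont_fst {U V : topologicalType} (h : T -> U * V) x :
  continuous_at x h -> continuous_at x (fun y => (h y).1).
Proof. by move=> ch; exact: (@continuous_comp _ _ _ h fst x ch (@cvg_fst _ _ _ _ _)). Qed.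

Lemma cont_snd {U V : topologicalType} (h : T -> U * V) x :
  continuous_at x h -> continuous_at x (fun y => (h y).2).
Proof. by move=> ch; exact: (@continuous_comp _ _ _ h snd x ch (@cvg_snd _ _ _ _ _)). Qed.

Lemma cont_id x : continuous_at x (fun y : T => y).
Proof. exact: cvg_id. Qed.

End pointwise_continuity.

Lemma cont_sqrt {R : realType} {T : topologicalType} (f : T -> R) x :
  continuous_at x f -> continuous_at x (fun y => Num.sqrt (f y)).
Proof. by move=> cf; apply: (cont_comp _ cf); exact: sqrt_continuous. Qed.

Lemma cont_cos {R : realType} {T : topologicalType} (f : T -> R) x :
  continuous_at x f -> continuous_at x (fun y => cos (f y)).
Proof. by move=> cf; apply: (cont_comp _ cf); exact: continuous_cos. Qed.

Lemma cont_sin {R : realType} {T : topologicalType} (f : T -> R) x :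
  continuous_at x f -> continuous_at x (fun y => sin (f y)).
Proof. by move=> cf; apply: (cont_comp _ cf); exact: continuous_sin. Qed.

Lemma cont_enorm {R : realType} {T : topologicalType} (f : T -> R * R) x :
  continuous_at x f -> continuous_at x (fun y => enorm (f y)).
Proof.
move=> cf; apply: cont_sqrt; apply: contD; apply: contX.
- exact: cont_fst.
- exact: cont_snd.
Qed.

Ltac cont0 :=
  match goal with
  | |- continuous_at _ (fun _ => ?c) => exact: cont_cst
  | |- continuous_at _ (fun y => y) => exact: cont_id
  | H : continuous ?f |- continuous_at _ ?f => exact: H
  | H : continuous ?f |- continuous_at _ (fun y => ?f y) => exact: H
  | |- continuous_at _ (fun y => @?f y - @?g y) => apply: contB
  | |- continuous_at _ (fun y => @?f y + @?g y) => apply: contD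
  | |- continuous_at _ (fun y => @?f y * @?g y) => apply: contM
  | |- continuous_at _ (fun y => - @?f y) => apply: contN
  | |- continuous_at _ (fun y => @?f y ^+ _) => apply: contX
  | |- continuous_at _ (fun y => `|@?f y|) => apply: cont_abs
  | |- continuous_at _ (fun y => Num.max (@?f y) (@?g y)) => apply: cont_max
  | |- continuous_at _ (fun y => Num.sqrt (@?f y)) => apply: cont_sqrt
  | |- continuous_at _ (fun y => cos (@?f y)) => apply: cont_cos
  | |- continuous_at _ (fun y => sin (@?f y)) => apply: cont_sin
  | |- continuous_at _ (fun y => enorm (@?f y)) => apply: cont_enorm
  | |- continuous_at _ (fun y => (@?f y, @?g y)) => apply: cont_pair
  | |- continuous_at _ (fun y => (@?f y).1) => apply: cont_fst
  | |- continuous_at _ (fun y => (@?f y).2) => apply: cont_snd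
  | H : continuous ?f |- continuous_at _ (fun y => ?f _) =>
      apply: (@cont_comp _ _ _ f); first exact: H
  | _ => assumption
  end.
Ltac cont1 := first
  [ cont0
  | match goal with |- continuous_at ?x ?f => change (continuous_at x (fun y => f y)) end;
    cont0 ].
Ltac cont := move=> *; rewrite /prop_for; repeat cont1.

Section derivation_rules.
Context {R : realType}.
Implicit Types (f g : R -> R) (x a b : R).

Lemma deriv_at_eq f x a b : deriv_at f x a -> a = b -> deriv_at f x b.
Proof. by move=> ? <-. Qed.

Lemma derD f g x a b : deriv_at f x a -> deriv_at g x b ->
  deriv_at (fun y => f y + g y) x (a + b).
Proof. by move=> df dg; exact: (is_deriveD df dg). Qed.

Lemma derB f g x a b : deriv_at f x a -> deriv_at g x b ->
  deriv_at (fun y => f y - g y) x (a - b).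
Proof. by move=> df dg; exact: (is_deriveB df dg). Qed.

Lemma derN f x a : deriv_at f x a -> deriv_at (fun y => - f y) x (- a).
Proof. by move=> df; exact: (is_deriveN df). Qed.

Lemma derM f g x a b : deriv_at f x a -> deriv_at g x b ->
  deriv_at (fun y => f y * g y) x (a * g x + f x * b).
Proof.
move=> df dg; apply: (is_derive_eq (is_deriveM df dg)).
by rewrite /GRing.scale/=; ring.
Qed.

Lemma der_cst x (c : R) : deriv_at (fun _ : R => c) x 0.
Proof. exact: is_derive_cst. Qed.

Lemma der_id x : deriv_at (fun y : R => y) x 1.
Proof. exact: is_derive_id. Qed.

Lemma derX f x a n : deriv_at f x a ->
  deriv_at (fun y => f y ^+ n.+1) x (n.+1%:R * f x ^+ n * a).
Proof.
move=> df; elim: n => [|n IH].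
  by rewrite expr0 !mul1r; under eq_fun do rewrite expr1.
have -> : (fun y => f y ^+ n.+2) = (fun y => f y * f y ^+ n.+1).
  by apply/funext => y; rewrite exprS.
apply: (is_derive_eq (derM df IH)).
by rewrite -[in RHS]natr1 !exprS; ring.
Qed.

Lemma derV f x a : f x != 0 -> deriv_at f x a ->
  deriv_at (fun y => (f y)^-1) x (- a / f x ^+ 2).
Proof.
move=> f0 df; apply: (is_derive_eq (is_deriveV f0 df)).
by rewrite /GRing.scale/= -exprVn; ring.
Qed.

Lemma der_comp f g x a b : deriv_at f (g x) a -> deriv_at g x b ->
  deriv_at (fun y => f (g y)) x (a * b).
Proof.
move=> df dg; apply: (is_derive_eq (is_derive1_comp df dg)).
by [].
Qed.

Lemma der_sin f x a : deriv_at f x a ->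
  deriv_at (fun y => sin (f y)) x (cos (f x) * a).
Proof. by move=> df; apply: der_comp df; exact: is_derive_sin. Qed.

Lemma der_cos f x a : deriv_at f x a ->
  deriv_at (fun y => cos (f y)) x (- sin (f x) * a).
Proof. by move=> df; apply: der_comp df; exact: is_derive_cos. Qed.

Lemma der_sqrt f x a : 0 < f x -> deriv_at f x a ->
  deriv_at (fun y => Num.sqrt (f y)) x (a / (2 * Num.sqrt (f x))).
Proof.
move=> f0 df; apply: (is_derive_eq (der_comp (is_derive1_sqrt f0) df)).
by rewrite mulrC.
Qed.

Lemma der_exp f x a : deriv_at f x a ->
  deriv_at (fun y => expR (f y)) x (expR (f x) * a).
Proof. by move=> df; apply: der_comp df; exact: is_derive_expR. Qed.

Lemma der_ln f x a : 0 < f x -> deriv_at f x a ->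
  deriv_at (fun y => ln (f y)) x (a / f x).
Proof.
move=> f0 df; apply: (is_derive_eq (der_comp (is_derive1_ln f0) df)).
by rewrite mulrC.
Qed.

End derivation_rules.

Ltac der0 :=
  match goal with
  | |- deriv_at (fun _ => ?c) _ _ => exact: der_cst
  | |- deriv_at (fun y => y) _ _ => exact: der_id
  | H : forall x, deriv_at ?f x _ |- deriv_at ?f _ _ => apply: H
  | H : forall x, deriv_at ?f x _ |- deriv_at (fun y => ?f y) _ _ => apply: H
  | |- deriv_at (fun y => @?f y - @?g y) _ _ => apply: derB
  | |- deriv_at (fun y => @?f y + @?g y) _ _ => apply: derD
  | |- deriv_at (fun y => @?f y ^+ _) _ _ => apply: derX
  | |- deriv_at (fun y => @?f y * @?g y) _ _ => apply: derM
  | |- deriv_at (fun y => - @?f y) _ _ => apply: derN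
  | |- deriv_at (fun y => cos (@?f y)) _ _ => apply: der_cos
  | |- deriv_at (fun y => sin (@?f y)) _ _ => apply: der_sin
  | |- deriv_at (fun y => expR (@?f y)) _ _ => apply: der_exp
  | H : forall x, deriv_at ?f x _ |- deriv_at (fun y => ?f _) _ _ =>
      apply: der_comp; first exact: H
  | _ => assumption
  end.
Ltac der1 := first
  [ der0
  | match goal with |- deriv_at ?f ?x ?a => change (deriv_at (fun y => f y) x a) end;
    der0 ].
Ltac der := eapply deriv_at_eq; [repeat der1 | cbv beta].

(** * C^1 functions on the plane *)

Section plane_calculus.
Context {R : realType}.
Implicit Types (f g : R * R -> R) (x : R * R).

Definition C1 f := [/\ forall x, differentiable f x,
  continuous (partial false f) & continuous (partial true f)].

Lemma C1P f : C1 f <-> C1_on setT f.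
Proof.
split=> [[df c1 c2] x _|H]; first by split => //; exact: cont_pair.
split=> x; have [// df cg] := H x I.
- exact: (cont_fst cg).
- exact: (cont_snd cg).
Qed.

Lemma C1_continuous f : C1 f -> continuous f.
Proof. by move=> [df _ _] x; exact: differentiable_continuous. Qed.

Lemma diffE_partial f x (v : R * R) : differentiable f x ->
  'd f x v = v.1 * partial false f x + v.2 * partial true f x.
Proof.
move=> df; rewrite /partial /= !deriveE//.
have {1}-> : v = v.1 *: ((1, 0) : R * R) + v.2 *: ((0, 1) : R * R).
  by apply: injective_projections; rewrite /= /GRing.scale/= ?mulr1 ?mulr0 ?addr0 ?add0r.
by rewrite linearD !linearZ.
Qed.

Lemma der_path f (g1 g2 : R -> R) (t a b : R) :
  differentiable f (g1 t, g2 t) -> deriv_at g1 t a -> deriv_at g2 t b ->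
  deriv_at (fun s => f (g1 s, g2 s)) t
    (a * partial false f (g1 t, g2 t) + b * partial true f (g1 t, g2 t)).
Proof.
move=> df [d1 e1] [d2 e2].
have D1 : differentiable g1 t by exact/derivable1_diffP.
have D2 : differentiable g2 t by exact/derivable1_diffP.
have Dp : differentiable (fun s => (g1 s, g2 s)) t by exact: differentiable_pair.
have Dc : differentiable (f \o (fun s => (g1 s, g2 s))) t by exact: differentiable_comp.
split; first exact/derivable1_diffP.
rewrite deriveE// diff_comp//= diff_pair//= diffE_partial//=.
by rewrite -!deriveE// e1 e2.
Qed.

End plane_calculus.

Section differentiable_rules.
Context {R : realType}.
Implicit Types (f g : R * R -> R) (x : R * R).

Lemma dfD f g x : differentiable f x -> differentiable g x ->
  differentiable (fun y => f y + g y) x.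
Proof. by move=> df dg; exact: (differentiableD df dg). Qed.

Lemma dfB f g x : differentiable f x -> differentiable g x ->
  differentiable (fun y => f y - g y) x.
Proof. by move=> df dg; exact: (differentiableB df dg). Qed.

Lemma dfM f g x : differentiable f x -> differentiable g x ->
  differentiable (fun y => f y * g y) x.
Proof. by move=> df dg; exact: (differentiableM df dg). Qed.

Lemma df_cst (c : R) x : differentiable (fun _ : R * R => c) x.
Proof. exact: differentiable_cst. Qed.

Lemma dfX f x n : differentiable f x -> differentiable (fun y => f y ^+ n) x.
Proof.
move=> df; elim: n => [|n IH]; first exact: df_cst.
have -> : (fun y => f y ^+ n.+1) = (fun y => f y * f y ^+ n).
  by apply/funext => y; rewrite exprS.
exact: dfM.
Qed.

Lemma df_fst x : differentiable (fun y : R * R => y.1) x.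
Proof.
apply: (linear_differentiable (f := (fst : {linear (R * R)%type -> R}))).
by move=> z; exact: cvg_fst.
Qed.

Lemma df_snd x : differentiable (fun y : R * R => y.2) x.
Proof.
apply: (linear_differentiable (f := (snd : {linear (R * R)%type -> R}))).
by move=> z; exact: cvg_snd.
Qed.

Lemma df_comp (h : R -> R) f x (a : R) : deriv_at h (f x) a -> differentiable f x ->
  differentiable (fun y => h (f y)) x.
Proof.
move=> [dh _] df; apply: (differentiable_comp df).
exact/derivable1_diffP.
Qed.

Lemma partial_deriv (i : bool) f x a :
  (if i then deriv_at (fun s => f (x.1, s)) x.2 a
        else deriv_at (fun s => f (s, x.2)) x.1 a) -> partial i f x = a.
Proof.
case: i => -[_ <-]; rewrite /partial /derive; f_equal; f_equal;
  apply/funext => h /=; rewrite ?scaler1 -?surjective_pairing; congr (_ *: (f _ - _));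
  by apply: injective_projections => /=; rewrite /GRing.scale/= ?mulr0 ?mulr1 ?add0r.
Qed.

Lemma partial_near (i : bool) f g x : (\forall y \near x, f y = g y) ->
  partial i f x = partial i g x.
Proof.
move=> fg; rewrite /partial; apply: near_eq_derive => //.
Qed.

End differentiable_rules.

Ltac df0 :=
  match goal with
  | H : forall x, differentiable ?f _ |- differentiable ?f _ => exact: H
  | H : forall x, differentiable ?f _ |- differentiable (fun y => ?f y) _ => exact: H
  | |- differentiable (fun _ => ?c) _ => exact: df_cst
  | |- differentiable (fun y => @?f y - @?g y) _ => apply: dfB
  | |- differentiable (fun y => @?f y + @?g y) _ => apply: dfD
  | |- differentiable (fun y => @?f y ^+ _) _ => apply: dfX
  | |- differentiable (fun y => @?f y * @?g y) _ => apply: dfM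
  | |- differentiable (fun y => y.1) _ => exact: df_fst
  | |- differentiable (fun y => y.2) _ => exact: df_snd
  | _ => assumption
  end.
Ltac df1 := first
  [ df0
  | match goal with |- differentiable ?f ?x => change (differentiable (fun y => f y) x) end;
    df0 ].

Section C1_rules.
Context {R : realType}.
Implicit Types (f g : R * R -> R) (x : R * R).

Lemma partialD (i : bool) f g x : differentiable f x -> differentiable g x ->
  partial i (fun y => f y + g y) x = partial i f x + partial i g x.
Proof. by move=> df dg; apply: deriveD; exact: diff_derivable. Qed.

Lemma partialB (i : bool) f g x : differentiable f x -> differentiable g x ->
  partial i (fun y => f y - g y) x = partial i f x - partial i g x.
Proof. by move=> df dg; apply: deriveB; exact: diff_derivable. Qed.

Lemma partialM (i : bool) f g x : differentiable f x -> differentiable g x ->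
  partial i (fun y => f y * g y) x = partial i f x * g x + f x * partial i g x.
Proof.
move=> df dg; rewrite /partial (@deriveM _ _ f g)//; try exact: diff_derivable.
by rewrite /GRing.scale/= addrC; congr (_ + _); rewrite mulrC.
Qed.

Lemma partial_cst (i : bool) (c : R) x : partial i (fun _ => c) x = 0.
Proof. exact: derive_cst. Qed.

Lemma partial_comp (i : bool) (h : R -> R) f x a : deriv_at h (f x) a ->
  differentiable f x -> partial i (fun y => h (f y)) x = a * partial i f x.
Proof.
move=> dh df; apply: partial_deriv.
by case: i; case: x dh df => x1 x2 /= dh df; apply: der_comp dh _;
  (eapply deriv_at_eq; first exact: (der_path df (der_cst _ _) (der_id _)) ||
     exact: (der_path df (der_id _) (der_cst _ _))); ring.
Qed.

Lemma partial_fst (i : bool) x : partial i (fun y : R * R => y.1) x = (~~ i)%:R.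
Proof. by apply: partial_deriv; case: i => /=; [exact: der_cst|exact: der_id]. Qed.

Lemma partial_snd (i : bool) x : partial i (fun y : R * R => y.2) x = i%:R.
Proof. by apply: partial_deriv; case: i => /=; [exact: der_id|exact: der_cst]. Qed.

Lemma C1_intro f f1 f2 : (forall x, differentiable f x) ->
  (forall x, partial false f x = f1 x) -> (forall x, partial true f x = f2 x) ->
  continuous f1 -> continuous f2 -> C1 f.
Proof. by move=> df /funext e1 /funext e2 c1 c2; split => //; rewrite ?e1 ?e2. Qed.

Lemma C1_cst (c : R) : C1 (fun _ : R * R => c).
Proof.
by apply: (@C1_intro _ (fun=> 0) (fun=> 0)) => [x|x|x||]; rewrite ?partial_cst;
  [repeat df1| | |cont|cont].
Qed.

Lemma C1D f g : C1 f -> C1 g -> C1 (fun y => f y + g y).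
Proof.
move=> [df f1 f2] [dg g1 g2].
apply: (@C1_intro _ (fun x => partial false f x + partial false g x)
  (fun x => partial true f x + partial true g x)) => [x|x|x||];
  rewrite ?partialD//; [repeat df1|cont|cont].
Qed.

Lemma C1B f g : C1 f -> C1 g -> C1 (fun y => f y - g y).
Proof.
move=> [df f1 f2] [dg g1 g2].
apply: (@C1_intro _ (fun x => partial false f x - partial false g x)
  (fun x => partial true f x - partial true g x)) => [x|x|x||];
  rewrite ?partialB//; [repeat df1|cont|cont].
Qed.

Lemma C1M f g : C1 f -> C1 g -> C1 (fun y => f y * g y).
Proof.
move=> Cf Cg; have cf := C1_continuous Cf; have cg := C1_continuous Cg.
move: Cf Cg => [df f1 f2] [dg g1 g2].
apply: (@C1_intro _ (fun x => partial false f x * g x + f x * partial false g x)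
  (fun x => partial true f x * g x + f x * partial true g x)) => [x|x|x||];
  rewrite ?partialM//; [repeat df1|cont|cont].
Qed.

Lemma C1_fst : C1 (fun y : R * R => y.1).
Proof.
by apply: (@C1_intro _ (fun=> 1) (fun=> 0)) => [x|x|x||];
  rewrite ?partial_fst//; [repeat df1|cont|cont].
Qed.

Lemma C1_snd : C1 (fun y : R * R => y.2).
Proof.
by apply: (@C1_intro _ (fun=> 0) (fun=> 1)) => [x|x|x||];
  rewrite ?partial_snd//; [repeat df1|cont|cont].
Qed.

Lemma C1_comp (h h' : R -> R) f : (forall y, deriv_at h y (h' y)) -> continuous h' ->
  C1 f -> C1 (fun y => h (f y)).
Proof.
move=> dh ch' Cf; have cf := C1_continuous Cf; move: Cf => [df f1 f2].
apply: (@C1_intro _ (fun x => h' (f x) * partial false f x)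
  (fun x => h' (f x) * partial true f x)) => [x|x|x||];
  rewrite ?(partial_comp _ (dh _))//; [exact: df_comp|cont|cont].
Qed.

End C1_rules.

(** * Integrals of continuous functions over intervals, with and without a parameter *)

Notation cint a b f := (\int[@lebesgue_measure _]_(t in `[a, b]) f t).

Section continuous_integrals.
Context {R : realType}.
Implicit Types (f g : R -> R) (a b c : R).

Lemma cint_eq a b f g : (forall t, a <= t <= b -> f t = g t) -> cint a b f = cint a b g.
Proof.
by move=> fg; apply: eq_Rintegral => t /set_mem /=; rewrite in_itv/= => /fg.
Qed.

Lemma cintD a b f g : continuous f -> continuous g ->
  cint a b (fun t => f t + g t) = cint a b f + cint a b g.
Proof. by move=> cf cg; rewrite RintegralD//; exact: continuous_integrable. Qed.

Lemma cintB a b f g : continuous f -> continuous g ->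
  cint a b (fun t => f t - g t) = cint a b f - cint a b g.
Proof. by move=> cf cg; rewrite RintegralB//; exact: continuous_integrable. Qed.

Lemma cintZ a b c f : continuous f -> cint a b (fun t => c * f t) = c * cint a b f.
Proof. by move=> cf; rewrite RintegralZl//; exact: continuous_integrable. Qed.

Lemma cint_le a b f g : continuous f -> continuous g ->
  (forall t, a <= t <= b -> f t <= g t) -> cint a b f <= cint a b g.
Proof.
by move=> cf cg fg; apply: le_Rintegral => //; exact: continuous_integrable.
Qed.

Lemma cint_ge0 a b f : (forall t, a <= t <= b -> 0 <= f t) -> 0 <= cint a b f.
Proof. by move=> f0; apply: Rintegral_ge0 => t /=; rewrite in_itv/= => /f0. Qed.

Lemma cint_norm a b f : continuous f -> `|cint a b f| <= cint a b (fun t => `|f t|).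
Proof. by move=> cf; apply: le_normr_Rintegral => //; exact: continuous_integrable. Qed.

Lemma cint_cst a b c : a <= b -> cint a b (fun=> c) = c * (b - a).
Proof.
move=> ab; rewrite (@integral_derive _ (fun t => c * t)) ?mulrBr//; first by cont.
by move=> x; der; ring.
Qed.

(** The integral of the square of [f - l g] is a nonnegative quadratic polynomial in [l]; its value
    at the minimum gives the inequality. *)
Lemma cint_CS a b f g : continuous f -> continuous g ->
  (cint a b (fun t => f t * g t)) ^+ 2 <=
  cint a b (fun t => f t ^+ 2) * cint a b (fun t => g t ^+ 2).
Proof.
move=> cf cg.
set A := cint a b (fun t => f t ^+ 2); set C := cint a b (fun t => g t ^+ 2).
set B := cint a b (fun t => f t * g t).
have H l : 0 <= A - 2 * l * B + l ^+ 2 * C.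
  have -> : A - 2 * l * B + l ^+ 2 * C = cint a b (fun t => (f t - l * g t) ^+ 2).
    rewrite -!cintZ -?cintB -?cintD; try by cont.
    by apply: cint_eq => t _; ring.
  by apply: cint_ge0 => t _; exact: sqr_ge0.
have A0 : 0 <= A by apply: cint_ge0 => t _; exact: sqr_ge0.
have : 0 <= C by apply: cint_ge0 => t _; exact: sqr_ge0.
rewrite le_eqVlt => /predU1P[C0|C0]; last first.
  have := H (B / C).
  have -> : A - 2 * (B / C) * B + (B / C) ^+ 2 * C = (A * C - B ^+ 2) / C.
    by field; rewrite gt_eqF.
  by rewrite pmulr_lge0 ?invr_gt0// subr_ge0.
rewrite -C0 mulr0; have [->|B0] := eqVneq B 0; first by rewrite expr0n.
(* With [C] zero the polynomial is affine in [l], and this [l] would bring it down to -1. *)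
have := H ((A + 1) / (2 * B)); rewrite -C0.
have -> : A - 2 * ((A + 1) / (2 * B)) * B + ((A + 1) / (2 * B)) ^+ 2 * 0 = -1.
  by field.
lra.
Qed.

(* Compactness of the set of pairs at which [F] varies by at least [e], on which
   the distance is therefore bounded below. *)
Lemma rect_modulus (F : R * R -> R) a b c d (e : R) : continuous F -> 0 < e ->
  exists2 C, 0 <= C & forall p q : R * R,
    a <= p.1 <= b -> c <= p.2 <= d -> a <= q.1 <= b -> c <= q.2 <= d ->
    `|F p - F q| <= e + C * ((p.1 - q.1) ^+ 2 + (p.2 - q.2) ^+ 2).
Proof.
move=> cF e0.
pose K : set (R * R) := `[a, b] `*` `[c, d].
have cK : compact K by apply: compact_setX; exact: segment_compact.
pose D (z : (R * R) * (R * R)) := `|F z.1 - F z.2|.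
have cD : continuous D.
  by rewrite /D; cont.
pose d2 (z : (R * R) * (R * R)) := (z.1.1 - z.2.1) ^+ 2 + (z.1.2 - z.2.2) ^+ 2.
have cd2 : continuous d2 by rewrite /d2; cont.
pose A := (K `*` K) `&` [set z | e <= D z].
have cA : compact A.
  apply: (subclosed_compact _ (compact_setX cK cK)); last by move=> z [].
  apply: closedI; last exact: (closed_comp _ (@closed_ge _ e)).
  by apply: compact_closed; [exact: Rhausdorff || exact: norm_hausdorff|exact: compact_setX].
have [A0|/set0P A0] := eqVneq A set0.
  exists 0 => // p q p1 p2 q1 q2; rewrite mul0r addr0.
  rewrite leNgt; apply/negP => /ltW eD.
  suff : A (p, q) by rewrite A0.
  by split => //; split; split; rewrite /= in_itv.
have [z /set_mem Az zmin] := compact_EVT_min A0 cA (continuous_subspaceT cd2).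
have [w /set_mem Kw wmax] : exists2 w, w \in A & forall t, t \in A -> D t <= D w.
  exact: compact_EVT_max A0 cA (continuous_subspaceT cD).
have dz0 : 0 < d2 z.
  rewrite lt_neqAle addr_ge0 ?sqr_ge0// andbT; apply/eqP => d0.
  case: Az => _ /=; apply/negP; rewrite -ltNge /D.
  have -> : z.1 = z.2.
    move/esym/eqP: d0; rewrite /d2 paddr_eq0 ?sqr_ge0// !sqrf_eq0 !subr_eq0.
    by move=> /andP[/eqP ? /eqP ?]; exact: injective_projections.
  by rewrite subrr normr0.
exists (D w / d2 z) => [|p q p1 p2 q1 q2].
  by apply: divr_ge0; [exact: normr_ge0|exact: ltW].
have [De|De] := ltP (D (p, q)) e.
  rewrite (le_trans (ltW De))// lerDl mulr_ge0// ?addr_ge0 ?sqr_ge0//.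
  by apply: divr_ge0; [exact: normr_ge0|exact: ltW].
have Apq : (p, q) \in A.
  by apply/mem_set; split => //; split; split; rewrite /= in_itv.
apply: (le_trans (wmax _ Apq)).
apply: (@le_trans _ _ (D w / d2 z * d2 (p, q))); last by rewrite lerDr ltW.
rewrite mulrAC ler_pdivlMr// ler_wpM2l//; first exact: normr_ge0.
exact: zmin.
Qed.

Lemma rect_bounded (F : R * R -> R) a b c d : continuous F ->
  exists2 M, 0 <= M & forall x y, a <= x <= b -> c <= y <= d -> `|F (x, y)| <= M.
Proof.
move=> cF; have [C C0 H] := rect_modulus a b c d cF ltr01.
exists (`|F (a, c)| + (1 + C * ((b - a) ^+ 2 + (d - c) ^+ 2))).
  by rewrite addr_ge0// addr_ge0// mulr_ge0// addr_ge0// sqr_ge0.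
move=> x y xab ycd.
have := H (x, y) (a, c) xab ycd; rewrite /= !lexx => /(_ _ _)H'.
have {}H' := H' ltac:(lra) ltac:(lra).
have -> : F (x, y) = F (a, c) + (F (x, y) - F (a, c)) by ring.
apply: (le_trans (ler_normD _ _)); rewrite lerD2l (le_trans H')// lerD2l ler_wpM2l//.
by apply: lerD; rewrite ler_sqr ?nnegrE; lra.
Qed.

(** Continuity in the parameter is local, so a bound of [K] for parameters within distance 1 is a
    constant majorant for dominated convergence. *)
Lemma cont_param (K : R * R -> R) a b : continuous K ->
  continuous (fun r => cint a b (fun t => K (r, t))).
Proof.
move=> cK x.
have [M M0 HM] := rect_bounded (x - 1) (x + 1) a b cK.
have mab : measurable (`[a, b] : set (measurableTypeR R)) by [].
have := @continuity_under_integral R _ _ (@lebesgue_measure R) (fun r t => K (r, t))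
  `[a, b] mab (x - 1) (x + 1).
apply => //.
- by move=> r _; apply: (@continuous_integrable _ (fun t => K (r, t))); cont.
- by apply: aeW => t _ r _; move: r; rewrite -/(continuous (fun r => K (r, t))); cont.
- by apply: (@continuous_integrable _ (fun=> M)); cont.
- move=> r; rewrite /= in_itv/= => rx; apply: aeW => t /=; rewrite in_itv/= => tab.
  by apply: HM => //; lra.
- by rewrite inE/= in_itv/=; lra.
Qed.

Lemma der_param (K K' : R * R -> R) a b : continuous K -> continuous K' ->
  (forall r t, deriv_at (fun s => K (s, t)) r (K' (r, t))) ->
  forall r, deriv_at (fun s => cint a b (fun t => K (s, t))) r
    (cint a b (fun t => K' (r, t))).
Proof.
move=> cK cK' dK x.
have [M M0 HM] := rect_bounded (x - 1) (x + 1) a b cK'.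
have mab : measurable (`[a, b] : set (measurableTypeR R)) by [].
have pE r t : partial1of2 (fun r t => K (r, t)) r t = K' (r, t).
  by rewrite /partial1of2; exact: deriv_at_derive1 (dK r t).
have Ix : `](x - 1), (x + 1)[%classic x by rewrite /= in_itv/=; lra.
have H1 : forall r : R, `](x - 1), (x + 1)[%classic r ->
    (@lebesgue_measure R).-integrable `[a, b] (EFin \o (fun t => K (r, t))).
  by move=> r _; apply: (@continuous_integrable _ (fun t => K (r, t))); cont.
have H2 : forall r t : R, `](x - 1), (x + 1)[%classic r -> `[a, b]%classic t ->
    derivable ((fun r t => K (r, t)) ^~ t) r 1.
  by move=> r t _ _; have [] := dK r t.
have H3 : (@lebesgue_measure R).-integrable `[a, b] (EFin \o (fun=> M)).
  by apply: (@continuous_integrable _ (fun=> M)); cont.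
have H4 : forall r t : R, `](x - 1), (x + 1)[%classic r -> `[a, b]%classic t ->
    `|partial1of2 (fun r t => K (r, t)) r t| <= M.
  move=> r t; rewrite pE /= !in_itv/= => rx tab.
  by apply: HM => //; lra.
split.
  exact: (derivable_under_integral mab Ix H1 H2 (fun=> M0) H3 H4).
rewrite -derive1E.
rewrite (differentiation_under_integral mab Ix H1 H2 (fun=> M0) H3 H4).
by apply: eq_Rintegral => t _; rewrite pE.
Qed.

End continuous_integrals.

(** * C^1 density of polynomials *)

Section bernstein.
Context {R : realType}.
Implicit Types (g h : nat -> R) (x y : R).

(* The Bernstein polynomial [\sum_i g i * 'C(n, i) * x ^ i * (1 - x) ^ (n - i)],
   as the expectation of [g] at a binomial variable, by conditioning on the first
   trial. *)
Fixpoint bern n g x : R :=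
  if n is m.+1 then x * bern m (fun i => g i.+1) x + (1 - x) * bern m g x else g 0%N.

Lemma bern_eq n g h x : (forall i, (i <= n)%N -> g i = h i) -> bern n g x = bern n h x.
Proof.
elim: n g h => [|n IH] g h gh /=; first exact: gh.
by rewrite (IH _ (fun i => h i.+1)) ?(IH g h)// => i ni; apply: gh; rewrite ?ltnS// ltnW.
Qed.

Lemma bern_cst n (c : R) x : bern n (fun=> c) x = c.
Proof. by elim: n => //= n ->; ring. Qed.

Lemma bernD n g h x : bern n (fun i => g i + h i) x = bern n g x + bern n h x.
Proof. by elim: n g h => //= n IH g h; rewrite !IH; ring. Qed.

Lemma bernZ n (c : R) g x : bern n (fun i => c * g i) x = c * bern n g x.
Proof. by elim: n g => //= n IH g; rewrite !IH; ring. Qed.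

Lemma bernB n g h x : bern n (fun i => g i - h i) x = bern n g x - bern n h x.
Proof. by elim: n g h => //= n IH g h; rewrite !IH; ring. Qed.

Lemma bern_le n g h x : 0 <= x <= 1 -> (forall i, (i <= n)%N -> g i <= h i) ->
  bern n g x <= bern n h x.
Proof.
move=> x01; elim: n g h => [|n IH] g h gh /=; first exact: gh.
by apply: lerD; apply: ler_wpM2l; try lra; apply: IH => i ni; apply: gh; rewrite ?ltnS// ltnW.
Qed.

Lemma bern_norm n g x : 0 <= x <= 1 -> `|bern n g x| <= bern n (fun i => `|g i|) x.
Proof.
move=> x01; rewrite ler_norml; apply/andP; split.
  rewrite -mulN1r -bernZ; apply: bern_le => // i _.
  by rewrite mulN1r lerNl ler_normr lexx orbT.
by apply: bern_le => // i _; rewrite ler_norm.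
Qed.

Lemma bern_mean n x : bern n (fun i => i%:R - n%:R * x) x = 0.
Proof.
elim: n => [|n IH] /=; first by ring.
pose d i : R := i%:R - n%:R * x; have {}IH : bern n d x = 0 := IH.
have -> : (fun i => i.+1%:R - n.+1%:R * x) = (fun i => d i + (1 - x)).
  by apply/funext => i; rewrite /d -!natr1; ring.
have -> : (fun i => i%:R - n.+1%:R * x) = (fun i => d i + - x).
  by apply/funext => i; rewrite /d -!natr1; ring.
by rewrite !(bernD _ d) IH !bern_cst; ring.
Qed.

(** The variance of a binomial variable, by conditioning on the first trial. As it grows only
    linearly in [n], the frequencies [i / n] concentrate at [x]. *)
Lemma bern_variance n x :
  bern n (fun i => (i%:R - n%:R * x) ^+ 2) x = n%:R * (x * (1 - x)).
Proof.
elim: n => [|n IH] /=; first by ring.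
pose d i : R := i%:R - n%:R * x; have d0 : bern n d x = 0 := bern_mean n x.
pose d2 i := d i ^+ 2; have {}IH : bern n d2 x = n%:R * (x * (1 - x)) := IH.
have -> : (fun i => (i.+1%:R - n.+1%:R * x) ^+ 2) =
    (fun i => d2 i + (2 * (1 - x) * d i + (1 - x) ^+ 2)).
  by apply/funext => i; rewrite /d2 /d -!natr1; ring.
have -> : (fun i => (i%:R - n.+1%:R * x) ^+ 2) =
    (fun i => d2 i + ((- 2 * x) * d i + x ^+ 2)).
  by apply/funext => i; rewrite /d2 /d -!natr1; ring.
by rewrite !bernD !bernZ d0 IH !bern_cst -natr1; ring.
Qed.

Lemma bern_quadratic n (c d : R) x : (0 < n)%N ->
  bern n (fun i => c + d * (i%:R / n%:R - x) ^+ 2) x = c + d * (x * (1 - x)) / n%:R.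
Proof.
move=> n0; have n0' : n%:R != 0 :> R by rewrite pnatr_eq0 -lt0n.
have -> : (fun i => c + d * (i%:R / n%:R - x) ^+ 2) =
    (fun i => c + (d / n%:R ^+ 2) * (i%:R - n%:R * x) ^+ 2).
  by apply/funext => i; field.
by rewrite bernD bernZ bern_variance bern_cst; field.
Qed.

(** A derivative is again a Bernstein sum, with difference quotients as coefficients; this is why
    the approximation carries over to first derivatives. *)
Lemma der_bern n g x : deriv_at (bern n.+1 g) x
  (n.+1%:R * bern n (fun i => g i.+1 - g i) x).
Proof.
elim: n g => [|n IH] g.
  by rewrite /=; der; ring.
have H1 := IH (fun i => g i.+1); have H2 := IH g.
have := derD (derM (der_id x) H1) (derM (derB (der_cst x 1) (der_id x)) H2).
move=> /deriv_at_eq; apply.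
rewrite [bern n.+1 (fun i => g i.+1 - g i) x]/= [in LHS]/=.
rewrite !bernB -[in RHS]natr1 /=; ring.
Qed.

(** The sampling points [P i j] need not be the grid points: they may be off by an amount of order
    n^(-1/2). This room lets the same lemma treat derivatives, whose coefficients are values at
    mean-value points. The modulus of [rect_modulus] is quadratic in the distance, so that its
    average is [e / 2] plus variances of order 1/n. *)
Lemma bern_approx (F : R * R -> R) (e : R) : continuous F -> 0 < e ->
  exists2 N, (0 < N)%N & forall n m (P : nat -> nat -> R * R), (N <= n)%N -> (N <= m)%N ->
    (forall i j, (i <= n)%N -> (j <= m)%N ->
      [/\ 0 <= (P i j).1 <= 1, 0 <= (P i j).2 <= 1,
          ((P i j).1 - i%:R / n%:R) ^+ 2 <= 4 / n%:R &
          ((P i j).2 - j%:R / m%:R) ^+ 2 <= 4 / m%:R]) ->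
    forall x y, 0 <= x <= 1 -> 0 <= y <= 1 ->
      `|bern n (fun i => bern m (fun j => F (P i j)) y) x - F (x, y)| <= e.
Proof.
move=> cF e0; have e20 : 0 < e / 2 by rewrite divr_gt0.
have [C C0 HC] := rect_modulus 0 1 0 1 cF e20.
(* Moving a sampling point costs at most [8 C / n] and the variance at most [2 C / n]; from [N] on,
   their sum is at most [e / 4] in each variable. *)
pose N := (Num.truncn (40 * C / e)).+1.
exists N => // n m P Nn Nm HP x y x01 y01.
have n0 : (0 < n)%N by exact: leq_trans Nn.
have m0 : (0 < m)%N by exact: leq_trans Nm.
have bnd k : (N <= k)%N -> 0 < k%:R^-1 :> R /\ 10 * C * k%:R^-1 <= e / 4.
  move=> Nk; have k0 : 0 < k%:R :> R by rewrite ltr0n; exact: leq_trans Nk.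
  rewrite invr_gt0; split => //; rewrite ler_pdivrMr//.
  have : 40 * C / e < k%:R.
    by rewrite (lt_le_trans (Num.Theory.truncnS_gt _))// ler_nat.
  by rewrite ltr_pdivrMr//; lra.
have [n1 n2] := bnd n Nn; have [m1 m2] := bnd m Nm.
rewrite -[F (x, y)](bern_cst n _ x) -bernB.
under bern_eq do rewrite -[F (x, y)](bern_cst m _ y) -bernB.
apply: (le_trans (bern_norm _ _ _)) => //.
set c0 := e / 2 + 8 * C * n%:R^-1 + 8 * C * m%:R^-1.
apply: (@le_trans _ _ (bern n (fun i => bern m (fun j =>
    (c0 + 2 * C * (i%:R / n%:R - x) ^+ 2) + 2 * C * (j%:R / m%:R - y) ^+ 2) y) x)).
  apply: bern_le => // i ni; apply: (le_trans (bern_norm _ _ _)) => //.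
  apply: bern_le => // j jm.
  have [P1 P2 P3 P4] := HP i j ni jm.
  apply: (le_trans (HC _ (x, y) _ _ _ _)) => //=.
  have sq (a b d : R) : (a - b) ^+ 2 <= 2 * (a - d) ^+ 2 + 2 * (d - b) ^+ 2.
    by have := sqr_ge0 (a - 2 * d + b); nra.
  have := sq (P i j).1 x (i%:R / n%:R); have := sq (P i j).2 y (j%:R / m%:R).
  rewrite /c0; set u := ((P i j).1 - x) ^+ 2; set v := ((P i j).2 - y) ^+ 2.
  set u' := (_ / _ - x) ^+ 2; set v' := (_ / _ - y) ^+ 2 => Hv Hu.
  have Hu' : u <= 8 * n%:R^-1 + 2 * u' by lra.
  have Hv' : v <= 8 * m%:R^-1 + 2 * v' by lra.
  have := ler_wpM2l C0 (lerD Hu' Hv'); lra.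
under bern_eq => i _ do rewrite bern_quadratic// addrAC.
rewrite bern_quadratic//.
have xx (z : R) : 0 <= z <= 1 -> 0 <= z * (1 - z) <= 1.
  by move=> z01; apply/andP; split; nra.
have Hb (z k : R) : 0 <= z <= 1 -> 0 < k -> 2 * C * (z * (1 - z)) * k <= 2 * C * k.
  move=> z01 k0; apply: ler_wpM2r; first exact: ltW.
  rewrite -[leRHS]mulr1; apply: ler_wpM2l; first by rewrite mulr_ge0.
  by case/andP: (xx z z01).
have := Hb x n%:R^-1 x01 n1; have := Hb y m%:R^-1 y01 m1.
by rewrite /c0; lra.
Qed.

End bernstein.

Section polynomial_density.
Context {R : realType}.
Implicit Types (F f : R * R -> R) (p q : {poly R}).

(** Polynomials in two variables as sums of separated products. An additive property needs checking
    on one product only, and such a product is the first partial derivative of another separated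
    function. *)
Inductive poly2 : (R * R -> R) -> Prop :=
| poly2_mon p q : poly2 (fun z => p.[z.1] * q.[z.2])
| poly2_add F f : poly2 F -> poly2 f -> poly2 (fun z => F z + f z).

Lemma poly2_fstM p F : poly2 F -> poly2 (fun z => p.[z.1] * F z).
Proof.
elim=> [p1 q1|F1 F2 _ H1 _ H2].
  have -> : (fun z => p.[z.1] * (p1.[z.1] * q1.[z.2])) =
    (fun z : R * R => (p * p1).[z.1] * q1.[z.2]).
    by apply/funext => z; rewrite hornerM mulrA.
  exact: poly2_mon.
have -> : (fun z => p.[z.1] * (F1 z + F2 z)) =
  (fun z => p.[z.1] * F1 z + p.[z.1] * F2 z).
  by apply/funext => z; rewrite mulrDr.
exact: poly2_add.
Qed.

Lemma poly2_sndM q F : poly2 F -> poly2 (fun z => q.[z.2] * F z).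
Proof.
elim=> [p1 q1|F1 F2 _ H1 _ H2].
  have -> : (fun z => q.[z.2] * (p1.[z.1] * q1.[z.2])) =
    (fun z : R * R => p1.[z.1] * (q * q1).[z.2]).
    by apply/funext => z; rewrite hornerM mulrCA.
  exact: poly2_mon.
have -> : (fun z => q.[z.2] * (F1 z + F2 z)) =
  (fun z => q.[z.2] * F1 z + q.[z.2] * F2 z).
  by apply/funext => z; rewrite mulrDr.
exact: poly2_add.
Qed.

Lemma poly2_cst (c : R) : poly2 (fun=> c).
Proof.
have -> : (fun=> c) = (fun z : R * R => c%:P.[z.1] * 1%:P.[z.2]).
  by apply/funext => z; rewrite !hornerC mulr1.
exact: poly2_mon.
Qed.

(** Maps [-1, 1] onto [0, 1], where Bernstein polynomials approximate. *)
Let half : {poly R} := (2^-1)%:P * ('X + 1%:P).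
Let halfE x : half.[x] = (x + 1) / 2.
Proof. by rewrite /half !hornerE mulrC. Qed.

Lemma poly2_bern_fst n (G : nat -> R * R -> R) : (forall i, poly2 (G i)) ->
  poly2 (fun z => bern n (fun i => G i z) ((z.1 + 1) / 2)).
Proof.
elim: n G => [|n IH] G HG; first exact: HG.
have -> : (fun z => bern n.+1 (fun i => G i z) ((z.1 + 1) / 2)) = (fun z =>
  half.[z.1] * bern n (fun i => G i.+1 z) ((z.1 + 1) / 2) +
  (1%:P - half).[z.1] * bern n (fun i => G i z) ((z.1 + 1) / 2)).
  by apply/funext => z /=; rewrite hornerD hornerN hornerC halfE.
by apply: poly2_add; apply: poly2_fstM; [apply: (IH (fun i => G i.+1))|exact: IH].
Qed.

Lemma poly2_bern_snd n (G : nat -> R * R -> R) : (forall i, poly2 (G i)) ->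
  poly2 (fun z => bern n (fun i => G i z) ((z.2 + 1) / 2)).
Proof.
elim: n G => [|n IH] G HG; first exact: HG.
have -> : (fun z => bern n.+1 (fun i => G i z) ((z.2 + 1) / 2)) = (fun z =>
  half.[z.2] * bern n (fun i => G i.+1 z) ((z.2 + 1) / 2) +
  (1%:P - half).[z.2] * bern n (fun i => G i z) ((z.2 + 1) / 2)).
  by apply/funext => z /=; rewrite hornerD hornerN hornerC halfE.
by apply: poly2_add; apply: poly2_sndM; [apply: (IH (fun i => G i.+1))|exact: IH].
Qed.

Lemma der_horner p x : deriv_at (fun y => p.[y]) x (p^`()).[x].
Proof.
split; first exact: derivable_horner.
by have := congr1 (fun h => h x) (derivE p); rewrite derive1E => ->.
Qed.

Lemma poly2_C1 F : poly2 F -> C1 F.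
Proof.
elim=> [p q|F1 F2 _ H1 _ H2]; last exact: C1D.
apply: C1M.
- apply: (C1_comp (der_horner p)); last exact: C1_fst.
  exact: continuous_horner.
- apply: (C1_comp (der_horner q)); last exact: C1_snd.
  exact: continuous_horner.
Qed.

Lemma der_bern_inner n m (G : nat -> nat -> R) (y x : R) :
  deriv_at (fun s => bern n (fun i => bern m.+1 (G i) s) x) y
    (bern n (fun i => m.+1%:R * bern m (fun j => G i j.+1 - G i j) y) x).
Proof.
elim: n G => [|n IH] G; first exact: der_bern.
have H1 := IH (fun i => G i.+1); have H2 := IH G.
have := derD (derM (der_cst y x) H1) (derM (der_cst y (1 - x)) H2).
by move=> /deriv_at_eq; apply; rewrite /= !mul0r !add0r.
Qed.

(** After rescaling to the unit square, the partial derivatives of the Bernstein polynomial of [F]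
    are Bernstein sums of difference quotients. By the mean value theorem these are values of the
    partial derivatives in the corresponding grid cells, so that [bern_approx] applies to them as
    well. *)
Lemma C1_poly2_dense F (e : R) : C1 F -> 0 < e ->
  exists2 Q, poly2 Q & forall x : R * R, -1 <= x.1 <= 1 -> -1 <= x.2 <= 1 ->
    `|Q x - F x| <= e /\ forall i, `|partial i Q x - partial i F x| <= e.
Proof.
move=> CF e0.
have cF := C1_continuous CF; case: (CF) => dF c1 c2.
pose sc (z : R * R) : R * R := (2 * z.1 - 1, 2 * z.2 - 1).
pose G z := F (sc z).
pose G1 z := 2 * partial false F (sc z).
pose G2 z := 2 * partial true F (sc z).
have csc : continuous sc by rewrite /sc; cont.
have cG : continuous G by rewrite /G; cont.
have cG1 : continuous G1.
  by rewrite /G1; cont.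
have cG2 : continuous G2.
  by rewrite /G2; cont.
have dG1 z : deriv_at (fun s => G (s, z.2)) z.1 (G1 z).
  have := @der_path _ F (fun s => 2 * s - 1) (fun=> 2 * z.2 - 1) z.1 2 0 (dF _).
  move=> /(_ _ _)H; apply: (deriv_at_eq (H _ _)).
  - by der; ring.
  - exact: der_cst.
  - by rewrite mul0r addr0.
have dG2 z : deriv_at (fun s => G (z.1, s)) z.2 (G2 z).
  have := @der_path _ F (fun=> 2 * z.1 - 1) (fun s => 2 * s - 1) z.2 0 2 (dF _).
  move=> /(_ _ _)H; apply: (deriv_at_eq (H _ _)).
  - exact: der_cst.
  - by der; ring.
  - by rewrite mul0r add0r.
have [N N0 HN] := bern_approx cG e0.
have [N1 N10 HN1] := bern_approx cG1 e0.
have [N2 N20 HN2] := bern_approx cG2 e0.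
pose n := (N + N1 + N2)%N.
have nN : (N <= n)%N by rewrite /n -addnA leq_addr.
have nN1 : (N1 <= n)%N by rewrite /n addnAC leq_addl.
have nN2 : (N2 <= n)%N by rewrite /n leq_addl.
have n0 : 0 < n%:R :> R by rewrite ltr0n (leq_trans N0).
have n10 : 0 < n.+1%:R :> R by rewrite ltr0n.
pose g i j : R := G (i%:R / n.+1%:R, j%:R / n.+1%:R).
pose B (z : R * R) := bern n.+1 (fun i => bern n.+1 (g i) z.2) z.1.
have dB1 z : deriv_at (fun s => B (s, z.2)) z.1
    (n.+1%:R * bern n (fun i => bern n.+1 (g i.+1) z.2 - bern n.+1 (g i) z.2) z.1).
  exact: (der_bern n (fun i => bern n.+1 (g i) z.2) z.1).
have dB2 z : deriv_at (fun s => B (z.1, s)) z.2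
    (bern n.+1 (fun i => n.+1%:R * bern n (fun j => g i j.+1 - g i j) z.2) z.1).
  exact: (der_bern_inner n.+1 n g z.2 z.1).
have frac i k : (i <= k)%N -> (0 < k)%N -> 0 <= (i%:R / k%:R : R) <= 1.
  move=> ik k0; apply/andP; split; first by rewrite divr_ge0// ler0n.
  by rewrite ler_pdivrMr ?ltr0n// mul1r ler_nat.
have inv4 k (a : R) : (0 < k)%N -> `|a| <= 2 / k%:R -> a ^+ 2 <= 4 / k%:R.
  move=> k0 ak; rewrite -real_normK ?num_real//.
  apply: (@le_trans _ _ ((2 / k%:R) ^+ 2)); first by rewrite ler_sqr ?nnegrE// divr_ge0.
  rewrite expr_div_n -natrX ler_pM2l ?ltr0n//.
  rewrite lef_pV2 ?posrE ?exprn_gt0 ?ltr0n//.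
  by rewrite -natrX ler_nat expnS leq_pmulr// expn1.
have approx0 z : 0 <= z.1 <= 1 -> 0 <= z.2 <= 1 -> `|B z - G z| <= e.
  case: z => x y /= x01 y01.
  apply: (HN n.+1 n.+1 (fun i j => (i%:R / n.+1%:R, j%:R / n.+1%:R))) => //; try exact: leqW.
  by move=> i j ik jk; split; rewrite /= ?frac// subrr expr0n/= divr_ge0.
(* Differentiating lowers the degree from [n.+1] to [n] in one variable, so that the point [c] of a
   cell of mesh [1 / n.+1] also has to be compared with the node [i / n]. *)
have mvt (h h' : R -> R) i : (i <= n)%N -> (forall s, deriv_at h s (h' s)) ->
    exists2 c, [/\ 0 <= c <= 1, (c - i%:R / n%:R) ^+ 2 <= 4 / n%:R &
                   (c - i%:R / n.+1%:R) ^+ 2 <= 4 / n.+1%:R] &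
      n.+1%:R * (h (i.+1%:R / n.+1%:R) - h (i%:R / n.+1%:R)) = h' c.
  move=> ik dh.
  have lt1 : i%:R / n.+1%:R < i.+1%:R / n.+1%:R :> R.
    by rewrite ltr_pM2r ?invr_gt0// ltr_nat.
  have [c /andP[lc rc] ->] := @deriv_at_mvt _ h h' _ _ lt1 (fun s _ => dh s).
  have i1 : i.+1%:R / n.+1%:R = i%:R / n.+1%:R + n.+1%:R^-1 :> R.
    by rewrite -[i.+1%:R]natr1 mulrDl mul1r.
  exists c; last first.
    by rewrite i1 addrAC subrr add0r mulrCA divff ?gt_eqF// mulr1.
  have F1 := frac i n.+1 (leqW ik) isT; have F2 := frac i.+1 n.+1 ik isT.
  have nn : (0 < n)%N by rewrite -(ltr0n R).
  have F3 := frac i n ik nn.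
  rewrite i1 in rc F2.
  have nV : n.+1%:R^-1 <= n%:R^-1 :> R by rewrite lef_pV2 ?posrE// ler_nat.
  have nV0 : 0 < n.+1%:R^-1 :> R by rewrite invr_gt0.
  have E : i%:R / n%:R - i%:R / n.+1%:R = (i%:R / n%:R) * n.+1%:R^-1 :> R.
    by rewrite -[n.+1%:R]natr1; field; rewrite natr1 ?gt_eqF//.
  have E2 : 0 <= ((i%:R / n%:R) * n.+1%:R^-1 : R) <= n.+1%:R^-1.
    case/andP: F3 => F3 F4.
    by rewrite mulr_ge0 ?(ltW nV0)//= -[leRHS]mul1r ler_wpM2r// ltW.
  have D1 : `|c - i%:R / n%:R| <= 2 * n.+1%:R^-1 /\ `|c - i%:R / n.+1%:R| <= 2 * n.+1%:R^-1.
    move: lc rc F1 F2 F3 nV nV0 E E2 => {dh lt1 i1}.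
    move: (i%:R / n%:R * _) => k; move: (i%:R / n.+1%:R) => a; move: (i%:R / n%:R) => b.
    by move: (n.+1%:R^-1) => w *; split; rewrite ler_norml; lra.
  split.
  - move: lc rc F1 F2; move: (i%:R / n.+1%:R) => a; move: (n.+1%:R^-1) => w *; lra.
  - by apply: inv4 => //; rewrite (le_trans D1.1)// ler_pM2l.
  - by apply: inv4 => //; exact: D1.2.
have approx1 z d : 0 <= z.1 <= 1 -> 0 <= z.2 <= 1 ->
    deriv_at (fun s => B (s, z.2)) z.1 d -> `|d - G1 z| <= e.
  case: z => x y /= x01 y01 dd.
  have -> : d = n.+1%:R * bern n (fun i => bern n.+1 (g i.+1) y - bern n.+1 (g i) y) x.
    by case: dd => _ <-; case: (dB1 (x, y)) => _ /= <-.
  have /choice[c Hc] : forall i, exists c : nat -> R, (i <= n)%N -> forall j,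
      [/\ 0 <= c j <= 1, (c j - i%:R / n%:R) ^+ 2 <= 4 / n%:R &
      n.+1%:R * (g i.+1 j - g i j) = G1 (c j, j%:R / n.+1%:R)].
    (* A sum of degree [n] never looks past the index [n], where any value will do. *)
    move=> i; have [ik|_] := leqP i n; last by exists (fun=> 0).
    have /choice[c Hc] : forall j : nat, exists c : R, [/\ 0 <= c <= 1,
      (c - i%:R / n%:R) ^+ 2 <= 4 / n%:R &
      n.+1%:R * (g i.+1 j - g i j) = G1 (c, j%:R / n.+1%:R)].
      move=> j; have [c [? ? _] ?] := mvt (fun s => G (s, j%:R / n.+1%:R)) (fun s => G1 (s, j%:R / n.+1%:R))
        i ik (fun s => dG1 (s, j%:R / n.+1%:R)).
      by exists c.
    by exists c => _.
  rewrite -bernZ.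
  under bern_eq => i ik.
    rewrite -bernB -bernZ.
    under bern_eq => j jk do rewrite (let: And3 _ _ E := Hc i ik j in E).
    over.
  apply: (HN1 n n.+1 (fun i j => (c i j, j%:R / n.+1%:R))) => //; first exact: leqW.
  move=> i j ik jk; have [? ? _] := Hc i ik j; split => //=; first exact: frac.
  by rewrite subrr expr0n/= divr_ge0.
have approx2 z d : 0 <= z.1 <= 1 -> 0 <= z.2 <= 1 ->
    deriv_at (fun s => B (z.1, s)) z.2 d -> `|d - G2 z| <= e.
  case: z => x y /= x01 y01 dd.
  have -> : d = bern n.+1 (fun i => n.+1%:R * bern n (fun j => g i j.+1 - g i j) y) x.
    by case: dd => _ <-; case: (dB2 (x, y)) => _ /= <-.
  have /choice[c Hc] : forall j, exists c : nat -> R, (j <= n)%N -> forall i,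
      [/\ 0 <= c i <= 1, (c i - j%:R / n%:R) ^+ 2 <= 4 / n%:R &
      n.+1%:R * (g i j.+1 - g i j) = G2 (i%:R / n.+1%:R, c i)].
    move=> j; have [jk|_] := leqP j n; last by exists (fun=> 0).
    have /choice[c Hc] : forall i : nat, exists c : R, [/\ 0 <= c <= 1,
      (c - j%:R / n%:R) ^+ 2 <= 4 / n%:R &
      n.+1%:R * (g i j.+1 - g i j) = G2 (i%:R / n.+1%:R, c)].
      move=> i; have [c [? ? _] ?] := mvt (fun s => G (i%:R / n.+1%:R, s)) (fun s => G2 (i%:R / n.+1%:R, s))
        j jk (fun s => dG2 (i%:R / n.+1%:R, s)).
      by exists c.
    by exists c => _.
  under bern_eq => i ik.
    rewrite -bernZ.
    under bern_eq => j jk do rewrite (let: And3 _ _ E := Hc j jk i in E).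
    over.
  apply: (HN2 n.+1 n (fun i j => (i%:R / n.+1%:R, c j i))) => //; first exact: leqW.
  move=> i j ik jk; have [? ? _] := Hc j jk i; split => //=; first exact: frac.
  by rewrite subrr expr0n/= divr_ge0.
pose Q (z : R * R) := B ((z.1 + 1) / 2, (z.2 + 1) / 2).
have PQ : poly2 Q.
  rewrite /Q /B; apply: (@poly2_bern_fst n.+1 (fun i z => bern n.+1 (g i) ((z.2 + 1) / 2))) => i.
  by apply: (@poly2_bern_snd n.+1 (fun j z => g i j)) => j; exact: poly2_cst.
exists Q => // x x1 x2.
have [h1 h2] : 0 <= (x.1 + 1) / 2 <= 1 /\ 0 <= (x.2 + 1) / 2 <= 1 by lra.
pose z : R * R := ((x.1 + 1) / 2, (x.2 + 1) / 2).
have scz : sc z = x.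
  by apply: injective_projections; rewrite /sc /=; field.
split.
  by have := approx0 z h1 h2; rewrite /G scz.
have half1 (w : R) : deriv_at (fun s : R => (s + 1) / 2) w 2^-1.
  by der; ring.
case.
- have D := dB2 z; move: D; set d := bern _ _ _ => D.
  have -> : partial true Q x = d * 2^-1.
    apply: (@partial_deriv _ true); apply: (@der_comp _ (fun s => B (z.1, s))).
      exact: D.
    exact: half1.
  have := approx2 z _ h1 h2 D; rewrite /G2 scz !ler_norml => ?; lra.
- have D := dB1 z; move: D; set d := _ * _ => D.
  have -> : partial false Q x = d * 2^-1.
    apply: (@partial_deriv _ false); apply: (@der_comp _ (fun s => B (s, z.2))).
      exact: D.
    exact: half1.
  have := approx1 z _ h1 h2 D; rewrite /G1 scz !ler_norml => ?; lra.
Qed.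

Lemma poly2_dense F (e : R) : continuous F -> 0 < e ->
  exists2 Q, poly2 Q & forall x : R * R, -1 <= x.1 <= 1 -> -1 <= x.2 <= 1 ->
    `|Q x - F x| <= e.
Proof.
move=> cF e0.
pose sc (z : R * R) : R * R := (2 * z.1 - 1, 2 * z.2 - 1).
have cG : continuous (fun z => F (sc z)) by rewrite /sc; cont.
have [n n0 Hn] := bern_approx cG e0.
pose P i j : R * R := (i%:R / n%:R, j%:R / n%:R).
exists (fun z => bern n (fun i => bern n (fun j => F (sc (P i j))) ((z.2 + 1) / 2))
  ((z.1 + 1) / 2)).
  apply: (@poly2_bern_fst n
    (fun i z => bern n (fun j => F (sc (P i j))) ((z.2 + 1) / 2))) => i.
  by apply: (@poly2_bern_snd n (fun j z => F (sc (P i j)))) => j; exact: poly2_cst.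
move=> x x1 x2.
have E : sc ((x.1 + 1) / 2, (x.2 + 1) / 2) = x.
  by apply: injective_projections; rewrite /sc /=; field.
have frac i : (i <= n)%N -> 0 <= (i%:R / n%:R : R) <= 1.
  move=> ik; apply/andP; split; first by rewrite divr_ge0// ler0n.
  by rewrite ler_pdivrMr ?ltr0n// mul1r ler_nat.
have HP i j : (i <= n)%N -> (j <= n)%N ->
    [/\ 0 <= (P i j).1 <= 1, 0 <= (P i j).2 <= 1,
       ((P i j).1 - i%:R / n%:R) ^+ 2 <= 4 / n%:R &
       ((P i j).2 - j%:R / n%:R) ^+ 2 <= 4 / n%:R].
  by move=> ik jk; split; rewrite /= ?frac// subrr expr0n/= divr_ge0.
have := Hn n n P (leqnn _) (leqnn _) HP ((x.1 + 1) / 2) ((x.2 + 1) / 2).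
by rewrite E; apply; lra.
Qed.

End polynomial_density.

(** * Divergence theorem and polar coordinates on discs *)

Section disc_integrals.
Context {R : realType}.
Notation mR := (measurableTypeR R).
Implicit Types (F f g : R * R -> R) (r : R).

Lemma enorm_ge0 (x : R * R) : 0 <= enorm x. Proof. exact: sqrtr_ge0. Qed.

Lemma sqr_enorm (x : R * R) : enorm x ^+ 2 = x.1 ^+ 2 + x.2 ^+ 2.
Proof. by rewrite sqr_sqrtr// addr_ge0// sqr_ge0. Qed.

Lemma enorm_lt (x : R * R) r : 0 <= r -> (enorm x < r) = (x.1 ^+ 2 + x.2 ^+ 2 < r ^+ 2).
Proof. by move=> r0; rewrite -sqr_enorm ltr_sqr ?nnegrE ?enorm_ge0. Qed.

Lemma enorm_le (x : R * R) r : 0 <= r -> (enorm x <= r) = (x.1 ^+ 2 + x.2 ^+ 2 <= r ^+ 2).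
Proof. by move=> r0; rewrite -sqr_enorm ler_sqr ?nnegrE ?enorm_ge0. Qed.

Lemma eball_coord r (x : R * R) : eball r x -> - r < x.1 < r /\ - r < x.2 < r.
Proof.
move=> xr; have r0 : 0 <= r by rewrite ltW// (le_lt_trans (enorm_ge0 x)).
move: xr; rewrite /eball /= enorm_lt// => xr.
rewrite -!ltr_norml -![`|_| < r](ltr_sqr) ?nnegrE// !real_normK ?num_real//.
by have := sqr_ge0 x.1; have := sqr_ge0 x.2; split; lra.
Qed.

Lemma poly2_measurable F : poly2 F ->
  measurable_fun setT (F : mR * mR -> mR).
Proof.
elim=> [p q|F1 F2 _ H1 _ H2]; last exact: measurable_funD.
apply: measurable_funM.
- apply: (measurableT_comp (f := horner p : mR -> mR)); last exact: measurable_fst.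
  by apply: continuous_measurable_fun; exact: continuous_horner.
- apply: (measurableT_comp (f := horner q : mR -> mR)); last exact: measurable_snd.
  by apply: continuous_measurable_fun; exact: continuous_horner.
Qed.

Lemma measurable_eball r : measurable (eball r : set (mR * mR)).
Proof.
have [r0|r0] := ltP 0 r; last first.
  have -> : eball r = set0 :> set (R * R); last exact: measurable0.
  by rewrite -subset0 => x /=; rewrite /eball /= ltNge (le_trans r0)// enorm_ge0.
pose N (z : mR * mR) : mR := z.1 ^+ 2 + z.2 ^+ 2.
have mN : measurable_fun setT N.
  by apply: measurable_funD; apply: measurable_funX.
have -> : (eball r : set (mR * mR)) = setT `&` N @^-1` `]-oo, r ^+ 2[.
  by rewrite setTI; apply/seteqP; split => z /=;
    rewrite /eball/= in_itv/= enorm_lt ?ltW.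
exact: mN.
Qed.

(** Measurability refers to the product sigma-algebra. Polynomials are measurable for it coordinate
    by coordinate, and [F] is a pointwise limit of polynomials on the disc. *)
Lemma continuous_measurable F : continuous F ->
  measurable_fun (eball 1 : set (mR * mR)) (F : mR * mR -> mR).
Proof.
move=> cF.
have /choice[Q HQ] : forall n : nat, exists Q, poly2 Q /\
    forall x : R * R, -1 <= x.1 <= 1 -> -1 <= x.2 <= 1 -> `|Q x - F x| <= n.+1%:R^-1.
  by move=> n; have [|Q ? ?] := poly2_dense (e := n.+1%:R^-1) cF; [rewrite invr_gt0|exists Q].
apply: (measurable_realfun.measurable_fun_cvg (h := Q)).
  by move=> n; apply: measurable_funTS; exact: (poly2_measurable (HQ n).1).
move=> x /eball_coord[x1 x2]; apply/cvgrPdist_le => e e0.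
near=> n; rewrite distrC.
apply: (le_trans ((HQ n).2 x _ _)); [lra|lra|].
by apply: ltW; near: n; exact: (near_infty_natSinv_lt (PosNum e0)).
Unshelve. all: end_near. Qed.

Lemma lebesgue2_eball_fin : (lebesgue2 (eball 1 : set (mR * mR)) < +oo)%E.
Proof.
pose S : set (mR * mR) := `[(-1 : R), 1] `*` `[(-1 : R), 1].
apply: (@le_lt_trans _ _ (lebesgue2 S)).
  apply: le_measure; rewrite ?inE.
  - exact: measurable_eball.
  - by apply: measurableX.
  - by move=> x /eball_coord[x1 x2]; split; rewrite /= in_itv/=; lra.
have -> : lebesgue2 S = (@lebesgue_measure R `[(-1)%R, 1%R] * @lebesgue_measure R `[(-1)%R, 1%R])%E.
  exact: product_measure1E.
rewrite !lebesgue_measure_itv/=.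
by case: ifP => _; rewrite ?mul0e// -?EFinD -?EFinM ltry.
Qed.

Lemma eballS r s : r <= s -> eball r `<=` (eball s : set (R * R)).
Proof. by move=> rs x; rewrite /eball/= => /lt_le_trans; apply. Qed.

Lemma bounded_integrable2 F (M : R) r : r <= 1 ->
  measurable_fun (eball 1 : set (mR * mR)) (F : mR * mR -> mR) ->
  (forall x, eball 1 x -> `|F x| <= M) ->
  (lebesgue2.-integrable (eball r) (EFin \o F))%E.
Proof.
move=> r1 mF FM.
apply: (integrableS (measurable_eball 1) (measurable_eball r)).
  exact: eballS.
apply: measurable_bounded_integrable => //.
- exact: measurable_eball.
- exact: lebesgue2_eball_fin.
- by exists M; split; [exact: num_real|move=> N MN x /FM FxM; exact: (le_trans FxM (ltW MN))].
Qed.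

Lemma continuous_bounded_eball F : continuous F ->
  exists2 M, 0 <= M & forall x, eball 1 x -> `|F x| <= M.
Proof.
move=> cF; have [M M0 HM] := rect_bounded (-1) 1 (-1) 1 cF.
by exists M => // -[x y] /eball_coord[/= ? ?]; apply: HM; lra.
Qed.

Lemma continuous_integrable2 F r : r <= 1 -> continuous F ->
  (lebesgue2.-integrable (eball r) (EFin \o F))%E.
Proof.
move=> r1 cF; have [M _ HM] := continuous_bounded_eball cF.
by apply: (bounded_integrable2 (M := M)) => //; exact: continuous_measurable.
Qed.

End disc_integrals.

Section divergence.
Context {R : realType}.
Notation mR := (measurableTypeR R).
Notation mu := (@lebesgue_measure R).
Implicit Types (F f g P : R * R -> R) (r : R).

(** Half the length of the chord at [x]. The square root of a negative number being 0, it vanishes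
    for [r <= |x|], and so do the chord integrals. *)
Let h r x : R := Num.sqrt (r ^+ 2 - x ^+ 2).

Lemma eball_section r x y : 0 < r -> eball r (x, y) = (`](- h r x), (h r x)[%classic y) :> Prop.
Proof.
move=> r0; apply/propext; rewrite /eball /= in_itv/= enorm_lt ?ltW//= -ltr_norml /h.
have [s0|s0] := ltP 0 (r ^+ 2 - x ^+ 2).
  rewrite -[`|y| < _]ltr_sqr ?nnegrE ?sqrtr_ge0// real_normK ?num_real// sqr_sqrtr ?ltW//.
  by split; lra.
rewrite ler0_sqrtr//; split; last by rewrite ltNge normr_ge0.
by have := sqr_ge0 y; lra.
Qed.

Lemma eball_section_sym r x y : eball r (x, y) = eball r (y, x) :> Prop.
Proof. by rewrite /eball /enorm /= addrC. Qed.

Let integral_section (G : R -> R) r x : continuous G ->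
  let S := `](- h r x)%R, (h r x)%R[%classic in
  (\int[mu]_y ((G \_ S) y)%:E = (cint (- h r x) (h r x) G)%:E)%E.
Proof.
move=> cG S.
rewrite -[LHS]/(\int[mu]_y (EFin \o (G \_ S)) y)%E.
rewrite -restrict_EFin -integral_mkcond integral_itv_obnd_cbnd; last first.
  by apply/measurable_EFinP; apply: measurable_funTS; exact: continuous_measurable_fun.
rewrite integral_itv_bndo_bndc; last first.
  by apply/measurable_EFinP; apply: measurable_funTS; exact: continuous_measurable_fun.
rewrite /Rintegral fineK//; apply: integrable_fin_num => //.
exact: continuous_integrable.
Qed.

Let outer_section (g : R -> R) r : 0 < r -> (forall x, r <= `|x| -> g x = 0) ->
  fine (\int[mu]_x (g x)%:E)%E = cint (- r) r g.
Proof.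
move=> r0 g0; rewrite -[RHS]/(fine _); congr fine.
rewrite [RHS]integral_mkcond; apply: eq_integral => x _.
rewrite patchE; case: ifPn => //; rewrite notin_setE /= in_itv/= => /negP xr.
rewrite g0//; move: xr; rewrite negb_and -!ltNge => /orP[?|?].
  by rewrite ler_normr; apply/orP; right; lra.
by rewrite ler_normr; apply/orP; left; lra.
Qed.

Let h0 r x : 0 < r -> r <= `|x| -> h r x = 0.
Proof.
move=> r0 rx; rewrite /h ler0_sqrtr// subr_le0 -[x ^+ 2]real_normK ?num_real//.
by rewrite ler_sqr ?nnegrE// ltW.
Qed.

Lemma ball_int_fubini1 F r : 0 < r <= 1 -> continuous F ->
  ball_int r F = cint (- r) r (fun x => cint (- h r x) (h r x) (fun y => F (x, y))).
Proof.
move=> /andP[r0 r1] cF.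
have iF : ((@lebesgue2 R).-integrable setT (EFin \o (F \_ (eball r : set (mR * mR)))))%E.
  rewrite -restrict_EFin; apply: (integrable_mkcond _ (measurable_eball r)).1.
  exact: continuous_integrable2.
rewrite -outer_section//; last first.
  by move=> x rx; rewrite h0// oppr0 set_itv1 Rintegral_set1.
rewrite /ball_int /Rintegral integral_mkcond /= restrict_EFin; congr fine.
rewrite /lebesgue2 -(integral12_prod_meas1 iF); apply: eq_integral => x _.
rewrite /fubini_F -integral_section; last by cont.
apply: eq_integral => y _ /=; congr EFin; rewrite !patchE.
congr (if _ then _ else _).
by apply/idP/idP => /set_mem H; apply/mem_set; rewrite ?eball_section// -eball_section.
Qed.

Lemma ball_int_fubini2 F r : 0 < r <= 1 -> continuous F ->
  ball_int r F = cint (- r) r (fun y => cint (- h r y) (h r y) (fun x => F (x, y))).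
Proof.
move=> /andP[r0 r1] cF.
have iF : ((@lebesgue2 R).-integrable setT (EFin \o (F \_ (eball r : set (mR * mR)))))%E.
  rewrite -restrict_EFin; apply: (integrable_mkcond _ (measurable_eball r)).1.
  exact: continuous_integrable2.
rewrite -outer_section//; last first.
  by move=> x rx; rewrite h0// oppr0 set_itv1 Rintegral_set1.
rewrite /ball_int /Rintegral integral_mkcond /= restrict_EFin; congr fine.
rewrite /lebesgue2 -(integral21_prod_meas1 iF); apply: eq_integral => x _.
rewrite /fubini_G -integral_section; last by cont.
apply: eq_integral => y _ /=; congr EFin; rewrite !patchE.
congr (if _ then _ else _).
by apply/idP/idP => /set_mem H; apply/mem_set; move: H;
  rewrite -eball_section// eball_section_sym.
Qed.

(** Both sides are the increment from -r to r of a primitive of [G]. Applied to chord integrals, it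
    turns the abscissa into an angle and the half-chord into [r cos t]. *)
Lemma cint_sin_subst (G : R -> R) r : 0 <= r -> continuous G ->
  cint (- r) r G = cint (- (pi / 2)) (pi / 2) (fun t => G (r * sin t) * (r * cos t)).
Proof.
move=> r0 cG; have [K dK] := primitive_exists cG.
rewrite (integral_derive _ cG dK); last by lra.
rewrite (@integral_derive _ (fun t => K (r * sin t))).
- by rewrite sinN sin_pihalf mulr1 mulrN1.
- by have := @pi_ge0 R; lra.
- by cont.
- by move=> t; der; ring.
Qed.

(** The increment of [K] over a period has derivative 0 in the starting point; an integral over a
    full turn may thus start at any angle. *)
Lemma primitive_periodic (k K : R -> R) a : (forall t, deriv_at K t (k t)) ->
  (forall t, k (t + 2 * pi) = k t) -> K (a + 2 * pi) - K a = K (2 * pi) - K 0.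
Proof.
move=> dK pk.
pose D t := K (t + 2 * pi) - K t.
have dD t : deriv_at D t 0.
  rewrite /D; der; rewrite pk; ring.
have := @deriv_at_0_eq _ D (- (`|a| + 1)) (`|a| + 1) a 0.
rewrite /D add0r; apply => //; first by rewrite -ltr_norml ltrDl.
by have := normr_ge0 a; lra.
Qed.

(** The divergence theorem for a field along a coordinate axis: integrating the derivative along
    chords leaves the values at their two ends, and these sweep the two halves of the circle. *)
Lemma ball_int_partial (i : bool) P r : 0 < r <= 1 -> C1 P ->
  ball_int r (partial i P) = r * cint 0 (2 * pi)
    (fun t => P (r * cos t, r * sin t) * (if i then sin t else cos t)).
Proof.
move=> r01 CP; have [dP c1 c2] := CP; have cP := C1_continuous CP.
have r0 : 0 < r by case/andP: r01.
pose k t := r * (P (r * cos t, r * sin t) * (if i then sin t else cos t)).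
have ck : continuous k by rewrite /k; case: (i); cont.
have [K dK] := primitive_exists ck.
have pk t : k (t + 2 * pi) = k t.
  by rewrite /k [2 * pi]mulr_natl cosD2pi sinD2pi.
have per := primitive_periodic _ dK pk.
rewrite -cintZ; last by case: (i); cont.
rewrite (integral_derive _ _ dK)//; last by rewrite mulr_ge0// pi_ge0.
have pi2 : pi / 2 + pi / 2 = pi :> R by rewrite -splitr.
have hE t : - (pi / 2) <= t <= pi / 2 -> h r (r * sin t) = r * cos t.
  move=> /cos_ge0_pihalf c0; rewrite /h exprMn.
  have -> : r ^+ 2 - r ^+ 2 * sin t ^+ 2 = (r * cos t) ^+ 2.
    by rewrite exprMn cos2sin2; ring.
  by rewrite sqrtr_sqr ger0_norm// mulr_ge0// ltW.
have ch : continuous (h r) by rewrite /h; cont.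
have hge x : 0 <= h r x by exact: sqrtr_ge0.
case: i @k ck dK pk per => k ck dK pk per.
- rewrite ball_int_fubini1//.
  have -> : (fun x => cint (- h r x) (h r x) (fun y => partial true P (x, y))) =
      (fun x => P (x, h r x) - P (x, - h r x)).
    apply/funext => x.
    rewrite (@integral_derive _ (fun y => P (x, y)) (fun y => partial true P (x, y)))//.
    + by have := hge x; lra.
    + by cont.
    + by move=> y; apply: (deriv_at_eq (der_path (dP _) (der_cst _ _) (der_id _))); ring.
  rewrite cint_sin_subst; [|exact: ltW|by cont].
  (* The upper and lower ends of the chord lie at the angles [pi / 2 - t] and [t - pi / 2]. *)
  rewrite (@cint_eq _ _ _ _ (fun t => k (pi / 2 - t) + k (t - pi / 2))); last first.
    move=> t /hE ht; rewrite /k ht !sinB !cosB cos_pihalf sin_pihalf.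
    have e1 : r * (0 * cos t + 1 * sin t) = r * sin t by ring.
    have e2 : r * (1 * cos t - 0 * sin t) = r * cos t by ring.
    have e3 : r * (cos t * 0 + sin t * 1) = r * sin t by ring.
    have e4 : r * (sin t * 0 - cos t * 1) = - (r * cos t) by ring.
    by rewrite e1 e2 e3 e4; ring.
  rewrite (@integral_derive _ (fun t => - K (pi / 2 - t) + K (t - pi / 2))).
  + have := per (- pi); have -> : - pi + 2 * pi = pi :> R by ring.
    have -> : pi / 2 - pi / 2 = 0 :> R by ring.
    have -> : pi / 2 - - (pi / 2) = pi :> R by rewrite opprK.
    have -> : - (pi / 2) - pi / 2 = - pi :> R by rewrite -opprD pi2.
    by move=> E; rewrite -E; ring.
  + by have := @pi_ge0 R; lra.
  + by cont.
  + by move=> t; der; ring.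
- rewrite ball_int_fubini2//.
  have -> : (fun y => cint (- h r y) (h r y) (fun x => partial false P (x, y))) =
      (fun y => P (h r y, y) - P (- h r y, y)).
    apply/funext => y.
    rewrite (@integral_derive _ (fun x => P (x, y)) (fun x => partial false P (x, y)))//.
    + by have := hge y; lra.
    + by cont.
    + by move=> x; apply: (deriv_at_eq (der_path (dP _) (der_id _) (der_cst _ _))); ring.
  rewrite cint_sin_subst; [|exact: ltW|by cont].
  (* The right and left ends of the chord lie at the angles [t] and [pi - t]. *)
  rewrite (@cint_eq _ _ _ _ (fun t => k t + k (pi - t))); last first.
    move=> t /hE ht; rewrite /k ht !sinB !cosB cospi sinpi.
    have e1 : r * (-1 * cos t + 0 * sin t) = - (r * cos t) by ring.
    have e2 : r * (0 * cos t - -1 * sin t) = r * sin t by ring.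
    by rewrite e1 e2; ring.
  rewrite (@integral_derive _ (fun t => K t - K (pi - t))).
  + have := per (- (pi / 2)).
    have -> : - (pi / 2) + 2 * pi = pi + pi / 2 :> R by lra.
    have -> : pi - pi / 2 = pi / 2 :> R by lra.
    have -> : pi - - (pi / 2) = pi + pi / 2 :> R by rewrite opprK.
    by move=> E; rewrite -E; ring.
  + by have := @pi_ge0 R; lra.
  + by cont.
  + by move=> t; der; ring.
Qed.

End divergence.

Section bounded_measurable.
Context {R : realType}.
Notation mR := (measurableTypeR R).
Implicit Types (F f g P : R * R -> R) (r : R).

(** The class covers the continuous functions and the discontinuous source term [ssupp] of the
    equation, is stable under algebraic operations, and guarantees integrability on every ball of
    radius at most 1. *)
Definition bmeas F :=
  measurable_fun (eball 1 : set (mR * mR)) (F : mR * mR -> mR) /\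
  exists M, forall x, eball 1 x -> `|F x| <= M.

Lemma bmeas_cont F : continuous F -> bmeas F.
Proof.
move=> cF; split; first exact: continuous_measurable.
by have [M _ HM] := continuous_bounded_eball cF; exists M.
Qed.

Lemma bmeasD f g : bmeas f -> bmeas g -> bmeas (fun x => f x + g x).
Proof.
move=> [mf [M HM]] [mg [N HN]]; split; first exact: measurable_funD.
exists (M + N) => x x1; apply: (le_trans (ler_normD _ _)).
by apply: lerD; [exact: HM|exact: HN].
Qed.

Lemma bmeasM f g : bmeas f -> bmeas g -> bmeas (fun x => f x * g x).
Proof.
move=> [mf [M HM]] [mg [N HN]]; split; first exact: measurable_funM.
exists (M * N) => x x1; rewrite normrM.
by apply: ler_pM => //; [exact: HM|exact: HN].
Qed.

Lemma bmeas_cst (c : R) : bmeas (fun=> c).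
Proof. by apply: bmeas_cont; cont. Qed.

Lemma bmeasB f g : bmeas f -> bmeas g -> bmeas (fun x => f x - g x).
Proof.
move=> bf bg; have := bmeasD bf (bmeasM (bmeas_cst (-1)) bg).
by congr bmeas; apply/funext => x; rewrite mulN1r.
Qed.

Lemma bmeas_norm f : bmeas f -> bmeas (fun x => `|f x|).
Proof.
move=> [mf [M HM]]; split; last by exists M => x /HM; rewrite normr_id.
exact: measurableT_comp mf.
Qed.

Lemma bmeas_integrable F r : r <= 1 -> bmeas F ->
  ((@lebesgue2 R).-integrable (eball r) (EFin \o F))%E.
Proof. by move=> r1 [mF [M HM]]; apply: (bounded_integrable2 r1 mF HM). Qed.

Lemma ball_int_eq f g r : (forall x, eball r x -> f x = g x) -> ball_int r f = ball_int r g.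
Proof. by move=> fg; apply: eq_Rintegral => x /set_mem; exact: fg. Qed.

Lemma ball_intD f g r : r <= 1 -> bmeas f -> bmeas g ->
  ball_int r (fun x => f x + g x) = ball_int r f + ball_int r g.
Proof.
by move=> r1 bf bg; apply: RintegralD; [exact: measurable_eball|exact: bmeas_integrable..].
Qed.

Lemma ball_intB f g r : r <= 1 -> bmeas f -> bmeas g ->
  ball_int r (fun x => f x - g x) = ball_int r f - ball_int r g.
Proof.
by move=> r1 bf bg; apply: RintegralB; [exact: measurable_eball|exact: bmeas_integrable..].
Qed.

Lemma ball_intZ (c : R) f r : r <= 1 -> bmeas f ->
  ball_int r (fun x => c * f x) = c * ball_int r f.
Proof.
by move=> r1 bf; apply: RintegralZl; [exact: measurable_eball|exact: bmeas_integrable].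
Qed.

Lemma ball_int_le f g r : r <= 1 -> bmeas f -> bmeas g ->
  (forall x, eball r x -> f x <= g x) -> ball_int r f <= ball_int r g.
Proof.
by move=> r1 bf bg fg; apply: le_Rintegral => //;
  [exact: measurable_eball|exact: bmeas_integrable..].
Qed.

Lemma ball_int_norm f g r : r <= 1 -> bmeas f -> bmeas g ->
  (forall x, eball r x -> `|f x| <= g x) -> `|ball_int r f| <= ball_int r g.
Proof.
move=> r1 bf bg fg; apply: (@le_trans _ _ (ball_int r (fun x => `|f x|))).
  by apply: le_normr_Rintegral; [exact: measurable_eball|exact: bmeas_integrable].
by apply: ball_int_le => //; exact: bmeas_norm.
Qed.

Lemma bmeas_ball r : bmeas (\1_(eball r) : R * R -> R).
Proof.
split; first by apply: measurable_indic; exact: measurable_eball.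
by exists 1 => x _; rewrite indicE; case: (_ \in _); rewrite ?normr0 ?normr1 ?ler01.
Qed.

Lemma ball_int_indic f r s : r <= s ->
  ball_int r f = ball_int s (fun x => f x * \1_(eball r) x).
Proof.
move=> rs; rewrite /ball_int [RHS]Rintegral_mkcond [LHS]Rintegral_mkcond.
congr Rintegral; apply/funext => x; rewrite !patchE indicE.
case: ifPn => xr; first by rewrite mem_set ?mulr1//; apply: (eballS rs); exact/set_mem.
by case: ifP; rewrite ?mulr0.
Qed.

End bounded_measurable.

Section polar_coordinates.
Context {R : realType}.
Implicit Types (F f g P : R * R -> R) (r : R).

Lemma circ_cont F : continuous F -> continuous (fun s => circ_int s F).
Proof.
move=> cF; rewrite /circ_int => s; apply: contM; first exact: cont_id.
apply: (@cont_param _ (fun z => F (z.1 * cos z.2, z.1 * sin z.2))) => //.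
by cont.
Qed.

Lemma circ_intD F G s : continuous F -> continuous G ->
  circ_int s (fun x => F x + G x) = circ_int s F + circ_int s G.
Proof. by move=> cF cG; rewrite /circ_int cintD ?mulrDr//; cont. Qed.

Lemma circ_intB F G s : continuous F -> continuous G ->
  circ_int s (fun x => F x - G x) = circ_int s F - circ_int s G.
Proof. by move=> cF cG; rewrite /circ_int cintB ?mulrBr//; cont. Qed.

Lemma circ_intZ (c : R) F s : continuous F ->
  circ_int s (fun x => c * F x) = c * circ_int s F.
Proof. by move=> cF; rewrite /circ_int cintZ 1?mulrCA//; cont. Qed.

Lemma enorm_circ (s t : R) : 0 <= s -> enorm (s * cos t, s * sin t) = s.
Proof.
move=> s0; rewrite /enorm /= !exprMn -mulrDr cos2Dsin2 mulr1 sqrtr_sqr.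
exact: ger0_norm.
Qed.

Lemma circ_le F G s : 0 <= s -> continuous F -> continuous G ->
  (forall x, enorm x = s -> F x <= G x) -> circ_int s F <= circ_int s G.
Proof.
move=> s0 cF cG FG; apply: ler_wpM2l => //; apply: cint_le; [by cont|by cont|].
by move=> t _; apply: FG; exact: enorm_circ.
Qed.

(** By the divergence theorem the left side is an integral over the circle of radius [r]. It
    vanishes at [r = 0], and its derivative in [r], computed under the integral sign, is the
    integrand on the right. *)
Lemma polar_partial P r : 0 < r <= 1 -> C1 P ->
  ball_int r (partial false P) = cint 0 r (fun s => circ_int s (partial false P)).
Proof.
move=> r01 CP; have [dP c1 c2] := CP; have cP := C1_continuous CP.
rewrite ball_int_partial//.
pose E s := cint 0 (2 * pi) (fun t => s * (P (s * cos t, s * sin t) * cos t)).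
have eE s : s * cint 0 (2 * pi) (fun t => P (s * cos t, s * sin t) * cos t) = E s.
  by rewrite /E cintZ//; cont.
rewrite eE (@integral_derive _ E).
- by rewrite -(eE 0) mul0r subr0.
- by case/andP: r01 => /ltW.
- exact: circ_cont.
move=> s.
pose pt (z : R * R) : R * R := (z.1 * cos z.2, z.1 * sin z.2).
have cpt : continuous pt by rewrite /pt; cont.
pose K (z : R * R) := z.1 * (P (pt z) * cos z.2).
pose K' (z : R * R) := P (pt z) * cos z.2 +
  z.1 * (cos z.2 * partial false P (pt z) + sin z.2 * partial true P (pt z)) * cos z.2.
have cK : continuous K by rewrite /K; cont.
have cp1 : continuous (fun z => partial false P (pt z)).
  by cont.
have cp2 : continuous (fun z => partial true P (pt z)).
  by cont.
have cK' : continuous K'.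
  by rewrite /K'; cont.
have dK r1 t : deriv_at (fun s => K (s, t)) r1 (K' (r1, t)).
  rewrite /K /pt /=; apply: deriv_at_eq.
    apply: derM; first exact: der_id.
    apply: derM; last exact: der_cst.
    apply: der_path; [exact: dP|apply: derM; [exact: der_id|exact: der_cst]|
      apply: derM; [exact: der_id|exact: der_cst]].
  by rewrite /K' /pt /=; ring.
apply: (deriv_at_eq (der_param 0 (2 * pi) cK cK' dK s)).
(* The surplus of [K'] over the wanted integrand is the angular derivative of the periodic function
   [Q] and integrates to 0. *)
pose Q t := P (pt (s, t)) * sin t.
pose Q' t := P (pt (s, t)) * cos t + s * sin t *
  (- sin t * partial false P (pt (s, t)) + cos t * partial true P (pt (s, t))).
have cp1' : continuous (fun t => partial false P (pt (s, t))).
  by cont.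
have cp2' : continuous (fun t => partial true P (pt (s, t))).
  by cont.
have cQ' : continuous Q'.
  by rewrite /Q'; cont.
have dQ t : deriv_at Q t (Q' t).
  rewrite /Q /pt /=; apply: deriv_at_eq.
    apply: derM; last exact: is_derive_sin.
    apply: der_path; [exact: dP|apply: derM; [exact: der_cst|exact: is_derive_cos]|
      apply: derM; [exact: der_cst|exact: is_derive_sin]].
  by rewrite /Q' /pt /=; ring.
have -> : (fun t => K' (s, t)) = (fun t => Q' t + s * partial false P (pt (s, t))).
  apply/funext => t; rewrite /K' /Q' /pt /=.
  set p1 := partial false P _; set p2 := partial true P _.
  have := cos2Dsin2 t; move: (cos t) (sin t) => c d E1.
  have -> : s * p1 = s * p1 * (c ^+ 2 + d ^+ 2) by rewrite E1 mulr1.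
  ring.
have csp : continuous (fun t => s * partial false P (pt (s, t))) by cont.
rewrite (cintD 0 (2 * pi) cQ' csp) (cintZ 0 (2 * pi) s cp1').
rewrite (integral_derive _ cQ' dQ); last by have := @pi_ge0 R; lra.
suff -> : Q (2 * pi) - Q 0 = 0 by rewrite add0r.
by rewrite /Q [2 * pi]mulr_natl sin2pi sin0 !mulr0 subrr.
Qed.

Lemma polar_poly2 F r : 0 < r <= 1 -> poly2 F ->
  ball_int r F = cint 0 r (fun s => circ_int s F).
Proof.
move=> r01; have r1 : r <= 1 by case/andP: r01.
elim=> [p q|F1 F2 PF1 H1 PF2 H2].
  have [S dS] := primitive_exists (@continuous_horner R p).
  pose P z := S z.1 * q.[z.2].
  have CS : C1 (fun z : R * R => S z.1).
    by apply: (C1_comp dS); [exact: continuous_horner|exact: C1_fst].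
  have Cq : C1 (fun z : R * R => q.[z.2]).
    by apply: (C1_comp (der_horner q)); [exact: continuous_horner|exact: C1_snd].
  have CP : C1 P by exact: C1M.
  have -> : (fun z => p.[z.1] * q.[z.2]) = partial false P.
    apply/funext => z; rewrite /P partialM; [|by case: CS|by case: Cq].
    rewrite (partial_comp _ (dS _)); last exact: df_fst.
    rewrite (partial_comp _ (der_horner q _)); last exact: df_snd.
    by rewrite partial_fst partial_snd /= mulr1 !mulr0 addr0.
  exact: polar_partial.
have c1 := C1_continuous (poly2_C1 PF1); have c2 := C1_continuous (poly2_C1 PF2).
rewrite (ball_intD r1 (bmeas_cont c1) (bmeas_cont c2)).
rewrite H1 H2 -cintD; [|exact: circ_cont..].
by apply: cint_eq => s _; rewrite circ_intD.
Qed.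

(** Both sides are continuous for uniform convergence and agree on polynomials. *)
Lemma polar F r : 0 < r <= 1 -> continuous F ->
  ball_int r F = cint 0 r (fun s => circ_int s F).
Proof.
move=> r01 cF; have /andP[r0 r1] := r01.
apply/eqP; rewrite -subr_eq0 -normr_le0; apply/ler_addgt0Pr => e e0; rewrite add0r.
(* The sum of both sides for the constant 1: a uniform error [d] in the approximation changes the
   difference by at most [d * A]. *)
pose A := ball_int r (fun=> 1) + cint 0 r (fun s => circ_int s (fun=> 1)).
have A0 : 0 <= A.
  apply: addr_ge0; first by apply: Rintegral_ge0.
  apply: cint_ge0 => s /andP[s0 _]; apply: mulr_ge0 => //.
  by apply: cint_ge0.
have d0 : 0 < e / (A + 1) by apply: divr_gt0; lra.
have [Q PQ HQ] := poly2_dense cF d0.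
have cQ := C1_continuous (poly2_C1 PQ).
set d := e / (A + 1) in d0 HQ.
have HQ' x : enorm x <= 1 -> `|Q x - F x| <= d.
  move=> x1; have := sqr_enorm x; have := enorm_ge0 x; have := sqr_ge0 x.1; have := sqr_ge0 x.2.
  by move=> *; apply: HQ; nra.
have c1 : continuous (fun _ : R * R => 1 : R) by cont.
have -> : ball_int r F - cint 0 r (fun s => circ_int s F) =
    (ball_int r F - ball_int r Q) + (cint 0 r (fun s => circ_int s Q) -
      cint 0 r (fun s => circ_int s F)).
  by rewrite (polar_poly2 r01 PQ); ring.
apply: (@le_trans _ _ (d * A)); last first.
  by rewrite /d mulrAC ler_pdivrMr; [apply: ler_wpM2l; lra|lra].
apply: (le_trans (ler_normD _ _)); rewrite /A mulrDr; apply: lerD.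
  rewrite -ball_intB -?ball_intZ; try exact: bmeas_cont; try exact: r1.
  apply: ball_int_norm => //; [by apply: bmeas_cont; cont|by apply: bmeas_cont; cont|].
  by move=> x xr; rewrite mulr1 distrC; apply: HQ'; rewrite ltW// (lt_le_trans xr).
have cc G : continuous G -> continuous (fun s => circ_int s G) := @circ_cont G.
have := cc _ c1; have := cc _ cF; have := cc _ cQ => cc1 cc2 cc3.
rewrite -cintB// -cintZ//.
apply: (le_trans (cint_norm _ _ _)); first by cont.
apply: cint_le; [by cont|by cont|move=> s /andP[s0 sr]].
rewrite -circ_intB// -circ_intZ// ler_norml; apply/andP; split.
  rewrite -mulN1r -circ_intZ; last by cont.
  apply: circ_le => //; [by cont|by cont|move=> x xs].
  have : `|Q x - F x| <= d by apply: HQ'; lra.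
  by rewrite ler_norml mulr1; lra.
apply: circ_le => //; [by cont|by cont|move=> x xs].
have : `|Q x - F x| <= d by apply: HQ'; lra.
by rewrite ler_norml mulr1; lra.
Qed.

Lemma disc_area r : 0 < r <= 1 -> ball_int r (fun=> 1) = pi * r ^+ 2.
Proof.
move=> r01; rewrite polar//; last by cont.
have -> : (fun s => circ_int s (fun=> 1)) = (fun s => s * (2 * pi)) :> (R -> R).
  apply/funext => s; rewrite /circ_int cint_cst ?subr0 ?mul1r//.
  by have := @pi_ge0 R; lra.
rewrite (@integral_derive _ (fun s => pi * s ^+ 2)).
- by rewrite expr0n/=; ring.
- by case/andP: r01 => /ltW.
- by cont.
- by move=> s; der; ring.
Qed.

End polar_coordinates.

(** * The weak equation up to the boundary *)

Section cutoff.
Context {R : realType}.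
Implicit Types (f g : R -> R) (a b x y : R).

(** The witness is the sequence of all derivatives: a product or a primitive is shown to be smooth
    by exhibiting its sequence. *)
Definition smooth1 f :=
  exists2 d : nat -> R -> R, d 0%N = f & forall n x, deriv_at (d n) x (d n.+1 x).

Lemma smooth1_cst (c : R) : smooth1 (fun=> c).
Proof.
exists (fun n => if n is 0%N then fun=> c else fun=> 0) => // -[|n] x; exact: der_cst.
Qed.

Lemma smooth1_der f : smooth1 f -> exists2 g, smooth1 g & forall x, deriv_at f x (g x).
Proof.
by move=> [d <- dd]; exists (d 1%N) => [|x]; [exists (fun n => d n.+1)|exact: dd].
Qed.

Lemma smooth1_continuous f : smooth1 f -> continuous f.
Proof. by move=> /smooth1_der[g _ dg] x; exact: deriv_at_continuous (dg x). Qed.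

Lemma smooth1_prim f g : smooth1 g -> (forall x, deriv_at f x (g x)) -> smooth1 f.
Proof.
move=> [d <- dd] df.
by exists (fun n => if n is m.+1 then d m else f) => // -[|n] x; [exact: df|exact: dd].
Qed.

Lemma smooth1M f g : smooth1 f -> smooth1 g -> smooth1 (fun x => f x * g x).
Proof.
move=> [d <- dd] [e <- de].
(* [L n i j] is the n-th derivative of [d i * e j], by iterating the product rule without binomial
   coefficients. *)
pose L := fix L n : nat -> nat -> R -> R := if n is m.+1
  then fun i j x => L m i.+1 j x + L m i j.+1 x else fun i j x => d i x * e j x.
suff dL n i j x : deriv_at (L n i j) x (L n.+1 i j x).
  by exists (fun n => L n 0%N 0%N).
elim: n i j => [|n IH] i j /=; first by apply: derM; [exact: dd|exact: de].
by apply: derD; exact: IH.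
Qed.

Lemma smooth1_affine f a b : smooth1 f -> smooth1 (fun x => f (a * x + b)).
Proof.
move=> [d <- dd]; exists (fun n x => a ^+ n * d n (a * x + b)) => [|n x].
  by apply/funext => x; rewrite expr0 mul1r.
apply: deriv_at_eq.
  apply: derM; first exact: der_cst.
  apply: der_comp; first exact: dd.
  by apply: derD; [apply: derM; [exact: der_cst|exact: der_id]|exact: der_cst].
by rewrite exprS; ring.
Qed.

(** The flat function exp(-1/x) with a polynomial factor in 1/x. The factor makes the family closed
    under differentiation, which sends [p] to [X^2 (p - p')]. *)
Definition flat (p : {poly R}) x := if 0 < x then p.[x^-1] * expR (- x^-1) else 0.

(** The exponential dominates each single term of its series. The factor [y ^+ 2], for y = 1/x, is
    what makes [flat p] quadratically small at 0, so that its derivative there is 0. *)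
Lemma horner_le_exp (p : {poly R}) : exists2 C : R, 0 <= C &
  forall y, 1 <= y -> `|p.[y]| * y ^+ 2 <= C * expR y.
Proof.
pose n := (size p).+1; pose S := \sum_(i < size p) `|p`_i|.
have S0 : 0 <= S by apply: sumr_ge0.
exists (S * n.+1`!%:R) => [|y y1]; first by rewrite mulr_ge0.
have y0 : 0 <= y by lra.
have pS : `|p.[y]| <= S * y ^+ size p.
  rewrite horner_coef (le_trans (ler_norm_sum _ _ _))// /S mulr_suml ler_sum// => i _.
  rewrite normrM ler_wpM2l// ger0_norm ?exprn_ge0// ler_weXn2l//.
  exact: ltnW.
have yn : y ^+ n.+1 <= n.+1`!%:R * expR y.
  have := expR_ge1Dxn n y0; have f0 : 0 < n.+1`!%:R :> R by rewrite ltr0n fact_gt0.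
  move=> H; have {H} : y ^+ n.+1 / n.+1`!%:R <= expR y by lra.
  by rewrite ler_pdivrMr// mulrC.
apply: (@le_trans _ _ (S * y ^+ size p * y ^+ 2)); first by rewrite ler_wpM2r// exprn_ge0.
by rewrite -mulrA -exprD addn2 -mulrA ler_wpM2l.
Qed.

Lemma flat_small (p : {poly R}) : exists2 C : R, 0 <= C &
  forall x, `|x| <= 1 -> `|flat p x| <= C * x ^+ 2.
Proof.
have [C C0 HC] := horner_le_exp p; exists C => // x x1; rewrite /flat.
case: ifPn => [x0|_]; last by rewrite normr0 mulr_ge0// sqr_ge0.
have := HC x^-1; rewrite invf_ge1// => /(_ (le_trans (ler_norm _) x1)).
rewrite normrM (gtr0_norm (expR_gt0 _)) expRN exprVn ler_pdivrMr ?exprn_gt0//.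
rewrite ler_pdivrMr ?expR_gt0// mulrAC//.
Qed.

Lemma der_flat p x : deriv_at (flat p) x (flat ('X^2 * (p - p^`())) x).
Proof.
have [x0|x0|->] := ltgtP x 0.
- have -> : flat ('X^2 * (p - p^`())) x = 0 by rewrite /flat ltNge (ltW x0).
  apply: (near_eq_is_derive _ (der_cst x 0)).
  near=> y; rewrite /flat ltNge (ltW _)//=.
  by near: y; exact: lt_nbhsl.
- have -> : flat ('X^2 * (p - p^`())) x = ('X^2 * (p - p^`())).[x^-1] * expR (- x^-1).
    by rewrite /flat x0.
  have near_flat : \near x, p.[x^-1] * expR (- x^-1) = flat p x.
    near=> y; rewrite /flat (_ : 0 < y)//.
    by near: y; exact: lt_nbhsr.
  apply: (near_eq_is_derive near_flat).
  have xn0 : x != 0 by rewrite gt_eqF.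
  have dV : deriv_at (fun y : R => y^-1) x (- x ^- 2).
    by apply: (deriv_at_eq (derV xn0 (der_id x))); rewrite mulNr mul1r.
  have d1 := derM (der_comp (der_horner p x^-1) dV) (der_exp (derN dV)).
  apply: (deriv_at_eq d1).
  by rewrite hornerM hornerXn hornerD hornerN exprVn; ring.
have -> : flat ('X^2 * (p - p^`())) 0 = 0 by rewrite /flat ltxx.
have [C C0 HC] := flat_small p.
have f0 : flat p 0 = 0 by rewrite /flat ltxx.
have cv : h^-1 *: (flat p (h + 0) - flat p 0) @[h --> 0^'] --> (0 : R).
  rewrite f0; apply/cvgrPdist_le => e e0.
  near=> h; rewrite sub0r normrN addr0 subr0 /GRing.scale/= normrM normfV.
  have h0 : h != 0 by near: h; exact: nbhs_dnbhs_neq.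
  rewrite ler_pdivrMl ?normr_gt0//.
  have h1 : `|h| <= Num.min 1 (e / (C + 1)).
    near: h; apply: dnbhs0_le; rewrite lt_min ltr01 divr_gt0//; lra.
  move: h1; rewrite le_min => /andP[h1 h2].
  apply: (le_trans (HC _ h1)).
  rewrite -real_normK ?num_real// expr2 mulrA mulrC ler_wpM2l//.
  move: h2; rewrite ler_pdivlMr; last lra.
  by have := normr_ge0 h; nra.
split.
  by apply/cvg_ex; exists 0; move: cv; under eq_fun do rewrite -[X in X + 0]scaler1.
by apply/cvg_lim => //; move: cv; under eq_fun do rewrite -[X in X + 0]scaler1.
Unshelve. all: end_near. Qed.

Lemma smooth1_flat p : smooth1 (flat p).
Proof.
exists (fun n => flat (iter n (fun q => 'X^2 * (q - q^`())) p)) => // n x.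
exact: der_flat.
Qed.

(** [E] is 1 minus the normalised primitive of the bump [flat 1 (x - a) * flat 1 (b - x)]. The sign
    of [E'] is recorded because the derivative of the cutoff serves in [green] as a weight of
    constant sign. *)
Lemma cutoff_exists a b : a < b -> exists2 E, smooth1 E &
  [/\ forall x, 0 <= E x <= 1, forall x, x <= a -> E x = 1, forall x, b <= x -> E x = 0 &
  exists E', [/\ forall x, deriv_at E x (E' x), continuous E',
    forall x, E' x <= 0, forall x, x <= a -> E' x = 0 & forall x, b <= x -> E' x = 0]].
Proof.
move=> ab.
pose B x := flat 1 (x - a) * flat 1 (b - x).
have sB : smooth1 B.
  apply: smooth1M.
  - by have := smooth1_affine 1 (- a) (smooth1_flat 1); under eq_fun do rewrite mul1r.
  - have := smooth1_affine (-1) b (smooth1_flat 1).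
    by under eq_fun do rewrite mulN1r addrC.
have f1E x : flat 1 x = if 0 < x then expR (- x^-1) else 0.
  by rewrite /flat hornerC mul1r.
have f1_ge0 x : 0 <= flat 1 x by rewrite f1E; case: ifP => // _; exact: expR_ge0.
have B0 x : 0 <= B x by exact: mulr_ge0.
have Bpos x : a < x < b -> 0 < B x.
  by move=> /andP[ax xb]; rewrite /B !f1E !subr_gt0 ax xb mulr_gt0// expR_gt0.
have Ba x : x <= a -> B x = 0.
  by move=> xa; rewrite /B f1E subr_gt0 ltNge xa mul0r.
have Bb x : b <= x -> B x = 0.
  by move=> xb; rewrite /B [X in _ * X]f1E subr_gt0 ltNge xb mulr0.
have cB := smooth1_continuous sB.
have [K dK] := primitive_exists cB.
pose J := K b - K a.
have J0 : 0 < J.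
  have [c cab E] := @deriv_at_mvt _ K B a b ab (fun x _ => dK x).
  by rewrite /J E mulr_gt0 ?Bpos// subr_gt0.
pose E x := 1 - (K x - K a) / J.
have Ea x : x <= a -> E x = 1.
  rewrite /E le_eqVlt => /predU1P[->|xa]; first by rewrite subrr mul0r subr0.
  have [c cab D] := @deriv_at_mvt _ K B x a xa (fun x _ => dK x).
  move: D; rewrite Ba; last by case/andP: cab => _ /ltW.
  by rewrite mul0r -opprB => /eqP; rewrite oppr_eq0 => /eqP ->; rewrite mul0r subr0.
have Eb x : b <= x -> E x = 0.
  rewrite /E le_eqVlt => /predU1P[<-|xb]; first by rewrite divff ?subrr// gt_eqF.
  have [c cab D] := @deriv_at_mvt _ K B b x xb (fun x _ => dK x).
  move: D; rewrite Bb; last by case/andP: cab => /ltW.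
  rewrite mul0r => /eqP; rewrite subr_eq0 => /eqP ->.
  by rewrite divff ?subrr// gt_eqF.
exists E.
  have sB' : smooth1 (fun x => - J^-1 * B x) by exact: smooth1M (smooth1_cst _) sB.
  by apply: (smooth1_prim sB') => x; rewrite /E; der; ring.
split => // [x|].
  have [xa|ax] := leP x a; first by rewrite Ea// ler01 lexx.
  have [xb|bx] := ltP x b; last by rewrite Eb// ler01 lexx.
  have [c _ D] := @deriv_at_mvt _ K B a x ax (fun x _ => dK x).
  have [c' _ D'] := @deriv_at_mvt _ K B x b xb (fun x _ => dK x).
  have h1 : 0 <= K x - K a by rewrite D mulr_ge0// subr_ge0 ltW.
  have h2 : 0 <= K b - K x by rewrite D' mulr_ge0// subr_ge0 ltW.
  have h3 : 0 <= (K x - K a) / J by rewrite divr_ge0// ltW.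
  have h4 : (K x - K a) / J <= 1 by rewrite ler_pdivrMr// mul1r /J; lra.
  by rewrite /E; lra.
exists (fun x => - J^-1 * B x); split.
- by move=> x; rewrite /E; der; ring.
- by cont.
- by move=> x; rewrite mulNr oppr_le0 mulr_ge0// invr_ge0 ltW.
- by move=> x /Ba ->; rewrite mulr0.
- by move=> x /Bb ->; rewrite mulr0.
Qed.

End cutoff.

Section test_functions.
Context {R : realType}.
Implicit Types (F phi psi v : R * R -> R) (p q : {poly R}) (g : R -> R).

Definition nrm2 (z : R * R) : R := z.1 ^+ 2 + z.2 ^+ 2.

Lemma C1_nrm2 : C1 nrm2.
Proof.
have C1X (f : R * R -> R) : C1 f -> C1 (fun z => f z ^+ 2).
  by move=> Cf; have := C1M Cf Cf; congr C1; apply/funext => z; rewrite expr2.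
by apply: C1D; apply: C1X; [exact: C1_fst|exact: C1_snd].
Qed.

Lemma partial_nrm2 (i : bool) z : partial i nrm2 z = 2 * (if i then z.2 else z.1).
Proof.
apply: partial_deriv; case: i; rewrite /nrm2 /=; der; ring.
Qed.

(* Closed under differentiation, hence made of smooth functions. *)
Inductive radial_poly : (R * R -> R) -> Prop :=
| radial_poly_mon p q g : smooth1 g ->
    radial_poly (fun z => p.[z.1] * q.[z.2] * g (nrm2 z))
| radial_poly_add F f : radial_poly F -> radial_poly f ->
    radial_poly (fun z => F z + f z).

Lemma radial_mon_C1 p q g : smooth1 g -> C1 (fun z => p.[z.1] * q.[z.2] * g (nrm2 z)).
Proof.
move=> /smooth1_der[g' sg' dg]; apply: C1M.
  exact: poly2_C1 (poly2_mon p q).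
by apply: (C1_comp dg); [exact: smooth1_continuous|exact: C1_nrm2].
Qed.

Lemma radial_poly_C1 F : radial_poly F -> C1 F.
Proof. by elim=> [p q g|f1 f2 _ H1 _ H2]; [exact: radial_mon_C1|exact: C1D]. Qed.

Lemma radial_poly_partial (i : bool) F : radial_poly F -> radial_poly (partial i F).
Proof.
elim=> [p q g sg|f1 f2 R1 H1 R2 H2]; last first.
  have [d1 _ _] := radial_poly_C1 R1; have [d2 _ _] := radial_poly_C1 R2.
  have -> : partial i (fun z => f1 z + f2 z) = (fun z => partial i f1 z + partial i f2 z).
    by apply/funext => z; rewrite partialD.
  exact: radial_poly_add.
have [g' sg' dg] := smooth1_der sg.
have [dpq _ _] := poly2_C1 (poly2_mon p q).
have [dn _ _] := C1_nrm2.
have dG z : differentiable (fun z => g (nrm2 z)) z by apply: df_comp (dg _) _.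
have E z : partial i (fun z => p.[z.1] * q.[z.2] * g (nrm2 z)) z =
    (if i then p.[z.1] * (q^`()).[z.2] else (p^`()).[z.1] * q.[z.2]) * g (nrm2 z) +
    (if i then p.[z.1] * ((2%:P * 'X) * q).[z.2] else ((2%:P * 'X) * p).[z.1] * q.[z.2]) *
    g' (nrm2 z).
  rewrite (partialM _ (dpq z) (dG z)) (partial_comp _ (dg _) (dn z)) partial_nrm2.
  have -> : partial i (fun z => p.[z.1] * q.[z.2]) z =
      (if i then p.[z.1] * (q^`()).[z.2] else (p^`()).[z.1] * q.[z.2]).
    apply: partial_deriv; case: (i) => /=.
      by apply: (deriv_at_eq (derM (der_cst _ _) (der_horner q _))); ring.
    by apply: (deriv_at_eq (derM (der_horner p _) (der_cst _ _))); ring.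
  by case: (i); rewrite !hornerM !hornerX !hornerC; ring.
rewrite (funext E); case: (i); apply: radial_poly_add; exact: radial_poly_mon.
Qed.

Lemma radial_poly_smooth F : radial_poly F -> smooth F.
Proof.
move=> RF s x; have : radial_poly (foldr partial F s).
  by elim: s => //= i s; exact: radial_poly_partial.
by move=> /radial_poly_C1[].
Qed.

Lemma poly2_radial F g : poly2 F -> smooth1 g -> radial_poly (fun z => F z * g (nrm2 z)).
Proof.
move=> PF sg; elim: PF => [p q|f1 f2 _ H1 _ H2]; first exact: radial_poly_mon.
have -> : (fun z => (f1 z + f2 z) * g (nrm2 z)) =
  (fun z => f1 z * g (nrm2 z) + f2 z * g (nrm2 z)) by apply/funext => z; rewrite mulrDl.
exact: radial_poly_add.
Qed.

Definition gdot F f (z : R * R) : R :=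
  partial false F z * partial false f z + partial true F z * partial true f z.

Lemma gdot_cont F f : C1 F -> C1 f -> continuous (gdot F f).
Proof. by move=> [_ ? ?] [_ ? ?]; rewrite /gdot; cont. Qed.

Definition ssupp v (x : R * R) : R := enorm x * \1_[set y | 0 < v y] x.

Lemma bmeas_ssupp v : continuous v -> bmeas (ssupp v).
Proof.
move=> cv; apply: bmeasM; first by apply: bmeas_cont; cont.
have -> : (\1_[set y | 0 < v y] : R * R -> R) = (\1_(`]0, +oo[ : set R) : R -> R) \o v.
  apply/funext => y; rewrite /= !indicE; congr (_ %:R : R); congr nat_of_bool.
  by apply/idP/idP => /set_mem /= H; apply/mem_set; move: H; rewrite /= in_itv/= andbT.
split.
  apply: measurableT_comp; last exact: continuous_measurable.
  exact: measurable_indic.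
by exists 1 => x _; rewrite /= indicE; case: (_ \in _); rewrite ?normr0 ?normr1 ?ler01.
Qed.

End test_functions.

(* Comparing terms that contain [partial] makes [ring] unfold the derivatives. *)
Ltac gen_partial := repeat match goal with
  | |- context [partial ?i ?f ?x] => move: (partial i f x) => ?
  end.

Section green.
Context {R : realType}.
Implicit Types (F phi psi : R * R -> R) (g : R -> R) (r s : R).
Variables (u v : R * R -> R) (rho : R).
Hypotheses (rho01 : 0 < rho < 1) (su : obstacle_solution u) (Cv : C1 v)
  (uv : forall x, enorm x < rho -> v x = u x).

Let cv : continuous v := C1_continuous Cv.

(* As [phi] is smooth with compact support, the distributional equation applies;
   the divergence theorem moves one derivative back to [v]. *)
Lemma weak_poly (Q : R * R -> R) g (b : R) : poly2 Q -> smooth1 g -> 0 < b < rho ->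
  (forall s, b ^+ 2 <= s -> g s = 0) ->
  let phi := fun z => Q z * g (nrm2 z) in
  ball_int 1 (fun x => gdot v phi x + ssupp v x * phi x) = 0.
Proof.
move=> PQ sg /andP[b0 brho] gb phi.
have /andP[rho0 rho1] := rho01.
have Rphi : radial_poly phi by exact: poly2_radial.
have phi0 x : b <= enorm x -> phi x = 0.
  by move=> bx; rewrite /phi gb ?mulr0// /nrm2 -sqr_enorm ler_sqr ?nnegrE ?enorm_ge0// ltW.
have pphi0 F : (forall x, b < enorm x -> F x = 0) -> forall i x, b < enorm x -> partial i F x = 0.
  move=> F0 i x bx.
  have cx : continuous_at x (fun y : R * R => enorm y).
    by apply: cont_enorm; exact: cont_id.
  rewrite (@partial_near _ i F (fun=> 0)) ?partial_cst//.
  near=> y; apply: F0; near: y.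
  exact: (cvgr_gt _ cx).
have p0 i x : b < enorm x -> partial i phi x = 0.
  by apply: pphi0 => y /ltW; exact: phi0.
have pp0 i x : b < enorm x -> partial i (partial i phi) x = 0.
  by apply: pphi0 => y; exact: p0.
have Rp i := radial_poly_partial i Rphi.
have Cphi := radial_poly_C1 Rphi.
have Cp i : C1 (partial i phi) := radial_poly_C1 (Rp i).
have tphi : test_fun phi.
  split; first exact: radial_poly_smooth.
  by exists b; [rewrite b0 (lt_trans brho)|].
have [_ _ /(_ _ tphi)] := su.
have -> : ball_int 1 (fun x => u x * laplacian phi x) =
    ball_int 1 (fun x => v x * laplacian phi x).
  apply: ball_int_eq => x _; have [xb|xb] := ltP (enorm x) rho; first by rewrite uv.
  by rewrite /laplacian !pp0 ?addr0 ?mulr0//; exact: lt_le_trans xb.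
have -> : ball_int 1 (fun x => enorm x * \1_[set y | 0 < u y] x * phi x) =
    ball_int 1 (fun x => ssupp v x * phi x).
  apply: ball_int_eq => x _; have [xb|xb] := ltP (enorm x) rho; last first.
    by rewrite phi0 ?mulr0// ltW// (lt_le_trans brho).
  rewrite /ssupp !indicE; congr (_ * (nat_of_bool _)%:R * _).
  by apply/idP/idP => /set_mem/= H; apply/mem_set => /=; move: H; rewrite uv.
move=> weak.
(* The derivatives of [phi] vanish near the unit circle, so that moving one of them to [v] leaves no
   boundary term. *)
have div i : ball_int 1 (partial i (fun x => v x * partial i phi x)) = 0.
  rewrite ball_int_partial ?ltr01 ?lexx//; last exact: C1M.
  rewrite (@cint_eq _ _ _ _ (fun=> 0)).
    by rewrite cint_cst ?mul0r ?mulr0//; have := @pi_ge0 R; lra.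
  move=> t _; rewrite p0 ?mulr0 ?mul0r// enorm_circ//; exact: lt_trans rho1.
have bv : bmeas v by exact: bmeas_cont.
have bp i : bmeas (partial i phi) by apply: bmeas_cont; exact: C1_continuous.
have bpp i : bmeas (partial i (partial i phi)).
  by apply: bmeas_cont; apply: C1_continuous; exact: radial_poly_C1 (radial_poly_partial i (Rp i)).
have bpv i : bmeas (partial i v) by case: Cv => _ ? ?; apply: bmeas_cont; case: i.
have bphi : bmeas phi by apply: bmeas_cont; exact: C1_continuous.
have divE i : ball_int 1 (fun x => partial i v x * partial i phi x) +
    ball_int 1 (fun x => v x * partial i (partial i phi) x) = 0.
  rewrite -ball_intD//; [|exact: bmeasM..].
  rewrite -[RHS](div i); apply: ball_int_eq => x _.
  have [dv _ _] := Cv; have [dp _ _] := Cp i.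
  by rewrite partialM.
have bs := bmeas_ssupp cv.
rewrite ball_intD//; [|by apply: bmeasD; exact: bmeasM|exact: bmeasM].
rewrite -weak /gdot ball_intD//; [|exact: bmeasM..].
have -> : ball_int 1 (fun x => v x * laplacian phi x) =
  ball_int 1 (fun x => v x * partial false (partial false phi) x) +
  ball_int 1 (fun x => v x * partial true (partial true phi) x).
  rewrite -ball_intD//; [|exact: bmeasM..].
  by apply: ball_int_eq => x _; rewrite /laplacian mulrDr.
by rewrite addrACA; exact: etrans (congr2 +%R (divE false) (divE true)) (addr0 _).
Unshelve. all: end_near. Qed.

Lemma gdotBr F (f1 f2 : R * R -> R) x : differentiable f1 x -> differentiable f2 x ->
  gdot F (fun y => f1 y - f2 y) x = gdot F f1 x - gdot F f2 x.
Proof. by move=> d1 d2; rewrite /gdot !partialB//; gen_partial; ring. Qed.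

Lemma gdotMr F (f1 f2 : R * R -> R) x : differentiable f1 x -> differentiable f2 x ->
  gdot F (fun y => f1 y * f2 y) x = gdot F f1 x * f2 x + f1 x * gdot F f2 x.
Proof. by move=> d1 d2; rewrite /gdot !partialM//; move: (f1 x) (f2 x) => *; gen_partial; ring. Qed.

Lemma C1_radial g : smooth1 g -> C1 (fun z : R * R => g (nrm2 z)).
Proof.
move=> /smooth1_der[g' sg' dg]; apply: (C1_comp dg); last exact: C1_nrm2.
exact: smooth1_continuous.
Qed.

(** For a fixed cutoff [G] the left side is linear in [psi], continuous in the C^1 norm, and zero on
    polynomials by [weak_poly]; these are dense. *)
Lemma weak_C1 psi g (b : R) : C1 psi -> smooth1 g -> 0 < b < rho ->
  (forall s, b ^+ 2 <= s -> g s = 0) ->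
  let G := fun z => g (nrm2 z) in
  ball_int 1 (fun x => G x * (gdot v psi x + ssupp v x * psi x) + psi x * gdot v G x) = 0.
Proof.
move=> Cpsi sg bb gb G.
have CG : C1 G by exact: C1_radial.
have bs := bmeas_ssupp cv.
have bgd F f : C1 F -> C1 f -> bmeas (gdot F f).
  by move=> CF Cf; apply: bmeas_cont; exact: gdot_cont.
have bC F : C1 F -> bmeas F by move=> CF; apply: bmeas_cont; exact: C1_continuous.
pose T f x := G x * (gdot v f x + ssupp v x * f x) + f x * gdot v G x.
have bT f : C1 f -> bmeas (T f).
  move=> Cf; apply: bmeasD; apply: bmeasM; [exact: bC| |exact: bC|exact: bgd].
  by apply: bmeasD; [exact: bgd|apply: bmeasM => //; exact: bC].
have TQ Q : poly2 Q -> ball_int 1 (T Q) = 0.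
  move=> PQ; rewrite -(weak_poly PQ sg bb gb).
  apply: ball_int_eq => x _; rewrite /T -/G.
  have [dQ _ _] := poly2_C1 PQ; have [dG _ _] := CG.
  by rewrite (@gdotMr _ Q G)// /G; ring.
(* A pointwise weight: if [psi] and [Q] differ by at most [d] in value and first derivatives, then
   [T psi] and [T Q] differ by at most [d * B]. *)
pose B x := `|G x| * (`|partial false v x| + `|partial true v x| + `|ssupp v x|) + `|gdot v G x|.
have bB : bmeas B.
  case: (Cv) => _ c1 c2; apply: bmeasD; last by apply: bmeas_norm; exact: bgd.
  apply: bmeasM; first by apply: bmeas_norm; exact: bC.
  by apply: bmeasD; [apply: bmeasD; apply: bmeas_norm; exact: bmeas_cont|exact: bmeas_norm].
have B0 : 0 <= ball_int 1 B.
  by apply: Rintegral_ge0 => x _; rewrite /B !(addr_ge0, mulr_ge0).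
rewrite -/(ball_int 1 (T psi)).
apply/eqP; rewrite -normr_le0; apply/ler_addgt0Pr => e e0; rewrite add0r.
set I := ball_int 1 B in B0.
have d0 : 0 < e / (I + 1) by apply: divr_gt0; lra.
have [Q PQ HQ] := C1_poly2_dense Cpsi d0.
have CQ := poly2_C1 PQ.
have -> : ball_int 1 (T psi) = ball_int 1 (fun x => T psi x - T Q x).
  by rewrite (ball_intB (lexx 1) (bT _ Cpsi) (bT _ CQ)) (TQ _ PQ) subr0.
apply: (@le_trans _ _ (e / (I + 1) * I)); last first.
  by rewrite mulrAC ler_pdivrMr; [apply: ler_wpM2l; lra|lra].
rewrite /I -ball_intZ//.
apply: ball_int_norm => //.
- exact: (bmeasB (bT _ Cpsi) (bT _ CQ)).
- by apply: bmeasM => //; exact: bmeas_cst.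
move=> x /eball_coord[x1 x2].
have [H0 H1] := HQ x ltac:(lra) ltac:(lra).
have -> : T psi x - T Q x = - (G x * (partial false v x * (partial false Q x - partial false psi x)
   + partial true v x * (partial true Q x - partial true psi x) + ssupp v x * (Q x - psi x))
   + (Q x - psi x) * gdot v G x).
  rewrite /T /gdot; gen_partial.
  by move: (G x) (Q x) (psi x) (ssupp v x) => *; ring.
move: (H1 false) (H1 true) H0; set d := e / _ in d0 *.
move: (Q x - psi x) (partial false Q x - _) (partial true Q x - _) => a a1 a2 h1 h2 h0.
rewrite normrN /B [leRHS]mulrDr; apply: (le_trans (ler_normD _ _)); apply: lerD; last first.
  by rewrite normrM ler_wpM2r.
rewrite normrM mulrCA ler_wpM2l// !mulrDr.
apply: (le_trans (ler_normD _ _)); apply: lerD.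
  by apply: (le_trans (ler_normD _ _)); apply: lerD; rewrite normrM mulrC ler_wpM2r.
by rewrite normrM mulrC ler_wpM2r.
Qed.

(** The boundary term of Green's formula: the integral over the circle of radius [s] of [psi] times
    the outward normal derivative of [v]. *)
Definition flux psi (s : R) : R := s * cint 0 (2 * pi) (fun t =>
  psi (s * cos t, s * sin t) *
  (cos t * partial false v (s * cos t, s * sin t) + sin t * partial true v (s * cos t, s * sin t))).

Lemma fluxE psi s : flux psi s = s * cint 0 (2 * pi) (fun t =>
  psi (s * cos t, s * sin t) *
  (cos t * partial false v (s * cos t, s * sin t) + sin t * partial true v (s * cos t, s * sin t))).
Proof. by []. Qed.

Lemma flux_cont psi : continuous psi -> continuous (flux psi).
Proof.
case: Cv => _ c1 c2 cpsi s; apply: contM; first exact: cont_id.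
apply: (@cont_param _ (fun z => psi (z.1 * cos z.2, z.1 * sin z.2) *
  (cos z.2 * partial false v (z.1 * cos z.2, z.1 * sin z.2) +
   sin z.2 * partial true v (z.1 * cos z.2, z.1 * sin z.2)))) => //.
by cont.
Qed.

Opaque flux.

(* Integrate the equation against [psi] times a radial cutoff decreasing from 1 to
   0 on [r, r + d]; in polar coordinates the gradient of the cutoff yields an
   average of [flux] over that interval. *)
Lemma green psi r : C1 psi -> 0 < r < rho ->
  ball_int r (fun x => gdot v psi x + ssupp v x * psi x) = flux psi r.
Proof.
move=> Cpsi /andP[r0 rrho].
have /andP[rho0 rho1] := rho01.
have cpsi := C1_continuous Cpsi.
pose H x := gdot v psi x + ssupp v x * psi x.
have bH : bmeas H.
  apply: bmeasD; first by apply: bmeas_cont; exact: gdot_cont.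
  by apply: bmeasM; [exact: bmeas_ssupp|exact: bmeas_cont].
have [M HM] : exists M, forall x, eball 1 x -> `|H x| <= M := bH.2.
have M0 : 0 <= M.
  apply: le_trans (HM (0, 0) _) => //.
  by rewrite /eball /= enorm_lt ?ler01//= expr0n/= addr0 expr1n ltr01.
rewrite -/(ball_int r H).
have cB := flux_cont cpsi.
apply/eqP; rewrite -subr_eq0 -normr_le0; apply/ler_addgt0Pr => e e0; rewrite add0r.
have e20 : 0 < e / 2 by rewrite divr_gt0.
(* [d] is so small that the flux varies by at most [e / 2] on [r, r + d], and that the annulus, of
   area at most [3 pi d], contributes at most [e / 2]. *)
have [d [d0 dB dM]] : exists d, [/\ 0 < d < (rho - r), forall s, r <= s <= r + d ->
    `|flux psi s - flux psi r| <= e / 2 & M * (pi * (3 * d)) <= e / 2].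
  have /cvgrPdist_le/(_ _ e20) := cB r.
  move=> [d /= d0 Hd].
  have p0 := @pi_gt0 R.
  have C0 : 0 < M * (pi * 3) + 1 by apply: ltr_pwDr => //; rewrite mulr_ge0// mulr_ge0// ltW.
  pose m := Num.min (d / 2) (Num.min ((rho - r) / 2) (e / 2 / (M * (pi * 3) + 1))).
  have m0 : 0 < m by rewrite !lt_min !divr_gt0//; lra.
  have m1 : m <= d / 2 by rewrite ge_min lexx.
  have m2 : m <= (rho - r) / 2 by rewrite !ge_min lexx orbT.
  have m3 : m <= e / 2 / (M * (pi * 3) + 1) by rewrite !ge_min lexx !orbT.
  exists m; split; first by apply/andP; split; lra.
    move=> s rs; rewrite distrC; apply: Hd; rewrite /ball_/=.
    by rewrite ltr_norml; apply/andP; split; lra.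
  by move: m3; rewrite ler_pdivlMr// => m3; lra.
pose b := r + d.
have bb : 0 < b < rho by rewrite /b; lra.
have ab : r ^+ 2 < b ^+ 2 by rewrite ltr_sqr ?nnegrE /b; lra.
have [g sg [g01 g1 g0 [g' [dg cg' g'0 g'a g'b]]]] := cutoff_exists ab.
have W := weak_C1 Cpsi sg bb g0.
set G := fun z => g (nrm2 z) in W.
have CG : C1 G by exact: C1_radial.
have bG : bmeas G by apply: bmeas_cont; exact: C1_continuous.
have cvG : continuous (gdot v G) by exact: gdot_cont.
have W' : ball_int 1 (fun x => G x * H x) +
    ball_int 1 (fun x => psi x * gdot v G x) = 0.
  rewrite -ball_intD//; first exact: bmeasM.
  by apply: bmeas_cont; cont.
(* The radial derivative of the cutoff; [- k] is a probability density on [r, b]. *)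
pose k s := 2 * s * g' (s ^+ 2).
have ck : continuous k by rewrite /k; cont.
have kint : cint 0 1 k = -1.
  rewrite (@integral_derive _ (fun s => g (s ^+ 2)))//.
  - by rewrite expr1n expr0n/= g0 ?g1 ?sqr_ge0 ?sub0r//; nra.
  - by move=> s; rewrite /k; der; ring.
have P1 : ball_int 1 (fun x => psi x * gdot v G x) = cint 0 1 (fun s => k s * flux psi s).
  rewrite polar ?ltr01 ?lexx//; last by cont.
  apply: cint_eq => s /andP[s0 s1].
  case: (Cv) => dv c1 c2.
  rewrite /circ_int fluxE [RHS]mulrCA -[in RHS]cintZ; last by cont.
  congr (s * _); apply: cint_eq => t _.
  have nE : nrm2 (s * cos t, s * sin t) = s ^+ 2.
    by rewrite /nrm2 /= !exprMn -mulrDr cos2Dsin2 mulr1.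
  have [dn _ _] := @C1_nrm2 R.
  rewrite /gdot /G !(partial_comp _ (dg _) (dn _)) !partial_nrm2 nE /k /=.
  by gen_partial; move: (psi _) => ?; move: (g' _) => ?; ring.
have I1 : `|ball_int 1 (fun x => G x * H x) - flux psi r| <= e / 2.
  have E : cint 0 1 (fun s => k s * (flux psi s - flux psi r)) =
      cint 0 1 (fun s => k s * flux psi s) + flux psi r.
    transitivity (cint 0 1 (fun s => k s * flux psi s - flux psi r * k s)).
      by apply: cint_eq => s _; rewrite mulrBr; congr (_ - _); exact: mulrC.
    rewrite (@cintB _ 0 1 (fun s => k s * flux psi s) (fun s => flux psi r * k s));
      [|by cont|by cont].
    by rewrite (cintZ 0 1 _ ck) kint mulrN1 opprK.
  have -> : ball_int 1 (fun x => G x * H x) - flux psi r =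
      - cint 0 1 (fun s => k s * (flux psi s - flux psi r)).
    by rewrite E -P1 opprD; congr (_ - _); apply/eqP; rewrite -addr_eq0; exact/eqP.
  rewrite normrN; apply: (le_trans (cint_norm _ _ _)); first by cont.
  have -> : e / 2 = cint 0 1 (fun s => - (e / 2) * k s) by rewrite cintZ// kint; ring.
  apply: cint_le; [by cont|by cont|move=> s /andP[s0 s1]].
  have k0 : k s <= 0.
    by rewrite /k -mulrA mulr_ge0_le0// mulr_ge0_le0.
  rewrite normrM ler0_norm//.
  have -> : - (e / 2) * k s = - k s * (e / 2) by rewrite mulNr mulrC mulNr.
  have [rs|sr] := ltP s r.
    suff -> : k s = 0 by rewrite oppr0 !mul0r.
    by rewrite /k g'a ?mulr0// ler_sqr ?nnegrE// ltW.
  have [sb|bs] := leP s b.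
    by apply: ler_wpM2l; [rewrite oppr_ge0|apply: dB; rewrite sr].
  suff -> : k s = 0 by rewrite oppr0 !mul0r.
  have b0 : 0 <= b by case/andP: bb => /ltW.
  by rewrite /k g'b ?mulr0// ler_sqr ?nnegrE// ltW.
have I2 : `|ball_int 1 (fun x => G x * H x) - ball_int r H| <= e / 2.
  have rr1 : r <= 1 by lra.
  rewrite (ball_int_indic H rr1) -ball_intB//; [|exact: bmeasM|by apply: bmeasM => //; exact: bmeas_ball].
  have b1 : b <= 1 by lra.
  apply: (le_trans _ dM).
  apply: (@le_trans _ _ (M * (ball_int b (fun=> 1) - ball_int r (fun=> 1)))); last first.
    rewrite !disc_area; [|by rewrite r0|by lra].
    by apply: ler_wpM2l => //; rewrite -mulrBr; apply: ler_wpM2l; [exact: pi_ge0|rewrite /b; nra].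
  have c1 : bmeas (fun _ : R * R => 1 : R) := bmeas_cst 1.
  rewrite (ball_int_indic _ rr1) (ball_int_indic _ b1) -ball_intB//; try (by apply: bmeasM => //; exact: bmeas_ball).
  rewrite -ball_intZ//; last by apply: bmeasB; apply: bmeasM => //; exact: bmeas_ball.
  apply: ball_int_norm => //.
  - by apply: bmeasB; apply: bmeasM => //; exact: bmeas_ball.
  - by apply: bmeasM; [exact: bmeas_cst|apply: bmeasB; apply: bmeasM => //; exact: bmeas_ball].
  move=> x x1; rewrite -mulrBr [H x * _]mulrC -mulrBl !mul1r normrM mulrC.
  apply: ler_pM => //; first exact: HM.
  have nn : G x = g (enorm x ^+ 2) by rewrite sqr_enorm.
  have [xr|rx] := ltP (enorm x) r.
    rewrite nn g1; last by rewrite ler_sqr ?nnegrE ?enorm_ge0// ltW.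
    rewrite !indicE !mem_set ?subrr ?normr0//=.
    by rewrite /eball/= (lt_trans xr)// /b ltrDl; case/andP: d0.
  have nr : x \in (eball r : set (R * R)) = false.
    by apply/negP => /set_mem; rewrite /eball/= ltNge rx.
  have := g01 (enorm x ^+ 2); rewrite -nn => /andP[G0 G1].
  have [xb|bx] := ltP (enorm x) b.
    by rewrite !indicE nr mem_set// !subr0 ger0_norm.
  rewrite nn g0 ?ler_sqr ?nnegrE ?enorm_ge0//; last by case/andP: bb => /ltW.
  have nb : x \in (eball b : set (R * R)) = false.
    by apply/negP => /set_mem; rewrite /eball/= ltNge bx.
  by rewrite !indicE nr nb !subr0 normr0.
have -> : ball_int r H - flux psi r = (ball_int 1 (fun x => G x * H x) - flux psi r) -
  (ball_int 1 (fun x => G x * H x) - ball_int r H).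
  by move: (ball_int _ _) (ball_int _ _) (flux _ _) => *; ring.
apply: (le_trans (ler_normB _ _)).
by rewrite [leRHS](splitr e); exact: lerD I1 I2.
Qed.

End green.

(** * From a solution on the unit ball to a C^1 function on the plane *)

Section extension.
Context {R : realType}.
Implicit Types (f u v psi w : R * R -> R) (r s : R).

Lemma near_enorm_lt (x : R * R) r : enorm x < r -> \forall y \near x, enorm y < r.
Proof.
move=> xr; have cx : continuous_at x (fun y : R * R => enorm y).
  by apply: cont_enorm; exact: cont_id.
exact: (cvgr_lt _ cx).
Qed.

Lemma near_enorm_gt (x : R * R) r : r < enorm x -> \forall y \near x, r < enorm y.
Proof.
move=> xr; have cx : continuous_at x (fun y : R * R => enorm y).
  by apply: cont_enorm; exact: cont_id.
exact: (cvgr_gt _ cx).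
Qed.

(** It serves twice: for the locality of differentiability, applied to a difference vanishing near
    [x], and for homogeneous functions at the origin. *)
Lemma small_differentiable (V W : normedModType R) (f : V -> W) (x : V) :
  (forall e, 0 < e -> \forall y \near x, `|f y| <= e * `|y - x|) ->
  differentiable f x /\ 'd f x = \0 :> (V -> W).
Proof.
move=> fs.
have fx0 : f x = 0.
  have := nbhs_singleton (fs 1 ltr01).
  by rewrite subrr normr0 mulr0 normr_le0 => /eqP.
have E : f \o shift x = cst (f x) + \0 +o_ 0 id.
  apply/eqaddoP => _/posnumP[e].
  have := fs e%:num (gt0 e); rewrite (near_shift 0 x) subr0 => fe.
  near=> h.
  rewrite !fctE fx0 addr0 subr0.
  have -> : `|id h| = `|h + x - x| by rewrite addrK.
  by near: h; exact: fe.
have c0 : continuous (\0 : V -> W) by move=> y; exact: cvg_cst.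
have d0 := @diff_unique _ _ _ f (\0 : {linear V -> W}) x c0 E.
by split=> //; apply/diff_locallyP; rewrite d0.
Unshelve. all: end_near. Qed.

Lemma near_differentiable f g (x : R * R) : (\forall y \near x, f y = g y) ->
  differentiable g x -> differentiable f x.
Proof.
move=> fg dg.
have -> : f = (fun y => (f y - g y) + g y) by apply/funext => y; rewrite subrK.
apply: dfD => //; apply: (small_differentiable _).1 => e e0.
by near=> y; rewrite (_ : f y = g y) ?subrr ?normr0 ?mulr_ge0 ?(ltW e0)//; near: y.
Unshelve. all: end_near. Qed.

Lemma near_continuous_at f g (x : R * R) : (\forall y \near x, f y = g y) ->
  continuous_at x g -> continuous_at x f.
Proof.
move=> fg cg; rewrite /continuous_at (nbhs_singleton fg).
by apply: cvg_trans cg; apply: near_eq_cvg; near do apply: esym.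
Unshelve. all: end_near. Qed.

(** [u] is multiplied by a smooth radial cutoff, equal to 1 on the ball of radius [r] and to 0 from
    a radius [b < 1] on, where the product is 0 whatever the values of [u]. *)
Lemma C1_extension u r : 0 < r < 1 -> C1_on (eball 1) u ->
  exists2 v, C1 v & forall x, enorm x < r -> v x = u x.
Proof.
move=> /andP[r0 r1] Cu.
pose b := (r + 1) / 2.
have ab : r ^+ 2 < b ^+ 2 by rewrite ltr_sqr ?nnegrE /b; lra.
have b0 : 0 <= b by rewrite /b; lra.
have [g sg [g01 g1 g0 _]] := cutoff_exists ab.
pose G z := g (nrm2 z).
have CG : C1 G by exact: C1_radial.
have cG := C1_continuous CG.
have [dG cG1 cG2] := CG.
have cGi i : continuous (partial i G) by case: i.
exists (fun x => u x * G x); last first.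
  by move=> x xr; rewrite /G g1 ?mulr1// /nrm2 -sqr_enorm ler_sqr ?nnegrE ?enorm_ge0 ?(ltW r0)// ltW.
have out z : b < enorm z -> \forall y \near z, u y * G y = 0.
  move=> bz; have := near_enorm_gt bz; apply: filterS => y by_.
  by rewrite /G g0 ?mulr0// /nrm2 -sqr_enorm ler_sqr ?nnegrE ?enorm_ge0// ltW.
have cases (x : R * R) : enorm x < 1 \/ b < enorm x.
  by have [?|?] := ltP (enorm x) 1; [left|right; apply: lt_le_trans (_ : b < 1) _; rewrite // /b; lra].
have dV x : differentiable (fun x => u x * G x) x.
  have [x1|/out x1] := cases x; last exact: (near_differentiable x1 (df_cst 0 x)).
  by have [du _] := Cu x x1; exact: dfM du (dG x).
have cV i : continuous (partial i (fun x => u x * G x)).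
  move=> x; have [x1|bx] := cases x; last first.
    apply: (@near_continuous_at _ (fun=> 0)); last exact: cont_cst.
    have := near_enorm_gt bx; apply: filterS => y /out h.
    by rewrite (partial_near _ h) partial_cst.
  apply: (@near_continuous_at _ (fun y => partial i u y * G y + u y * partial i G y)).
    have := near_enorm_lt x1; apply: filterS => y y1.
    by have [du _] := Cu y y1; exact: partialM du (dG y).
  have [du cu] := Cu x x1.
  apply: contD; apply: contM; [|exact: cG|exact: differentiable_continuous|exact: cGi].
  by case: (i); [exact: (cont_snd cu)|exact: (cont_fst cu)].
exact: And3 dV (cV false) (cV true).
Qed.

(* [v] is a solution on the ball of radius [r], extended to the plane as a C^1
   function; the equation is tested up to the boundary of smaller balls. *)
Definition local_solution v r : Prop :=
  [/\ 0 < r < 1, C1 v, forall x, enorm x < r -> 0 <= v x &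
    forall psi s, C1 psi -> 0 < s < r ->
      ball_int s (fun x => gdot v psi x + ssupp v x * psi x) = flux v psi s].

Lemma local_solution_exists u r : 0 < r < 1 -> obstacle_solution u ->
  exists2 v, local_solution v r & forall x, enorm x < r -> v x = u x.
Proof.
move=> r01 su; have [[Cu _] u0 _] := su.
have [v Cv vu] := C1_extension r01 Cu.
exists v => //; split; [exact: r01|exact: Cv| |]; [|exact: (green r01 su Cv vu)].
by move=> x xr; rewrite vu// u0// /eball/= (lt_trans xr)//; case/andP: r01.
Qed.

Lemma ball_int_scale (F : R * R -> R) r : 0 < r <= 1 -> continuous F ->
  ball_int r (fun x => F (x.1 / r, x.2 / r)) = r ^+ 2 * ball_int 1 F.
Proof.
move=> r01 cF; have /andP[r0 r1] := r01.
have rn0 : r != 0 by rewrite gt_eqF.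
rewrite polar//; last by cont.
rewrite polar ?ltr01 ?lexx//.
have [K dK] := primitive_exists (circ_cont cF).
rewrite (integral_derive _ (circ_cont cF) dK)//.
have -> : (fun s => circ_int s (fun x => F (x.1 / r, x.2 / r))) =
    (fun s => r * circ_int (s / r) F).
  apply/funext => s; rewrite /circ_int mulrA [r * _]mulrC divfK//; congr (s * _).
  by apply: cint_eq => t _ /=; congr (F (_, _)); rewrite mulrAC.
have cF' := circ_cont cF.
rewrite (@integral_derive _ (fun s => r ^+ 2 * K (s / r))).
- by rewrite divff// mul0r mulrBr.
- exact: ltW.
- move=> s; apply: contM; first exact: cont_cst.
  apply: (cont_comp (h := fun s => circ_int s F) (k := fun y : R => y / r)); first exact: cF'.
  by apply: contM; [exact: cont_id|exact: cont_cst].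
- move=> s; apply: deriv_at_eq.
    apply: derM; first exact: der_cst.
    apply: der_comp; first exact: dK.
    by apply: derM; [exact: der_id|exact: der_cst].
  by move: (circ_int _ _) => *; field.
Qed.

End extension.

(** * Minimality *)

Section minimality.
Context {R : realType}.
Notation mR := (measurableTypeR R).
Implicit Types (f u v psi w : R * R -> R) (r s rho : R).

Definition dens w (x : R * R) : R := gdot w w x + 2 * enorm x * Num.max (w x) 0.

Lemma dens_cont w : C1 w -> continuous (dens w).
Proof.
move=> Cw; have cw := C1_continuous Cw; have cg := gdot_cont Cw Cw.
by rewrite /dens; cont.
Qed.

Definition radial v r t : R :=
  cos t * partial false v (r * cos t, r * sin t) +
  sin t * partial true v (r * cos t, r * sin t).

Lemma radial_cont v r : C1 v -> continuous (radial v r).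
Proof. by move=> [_ c1 c2]; rewrite /radial; cont. Qed.

Lemma partial_dilate (i : bool) w r x : C1 w ->
  partial i (fun x => w (r * x.1, r * x.2)) x = r * partial i w (r * x.1, r * x.2).
Proof.
move=> [dw c1 c2]; apply: partial_deriv; case: i => /=.
- have d := @der_path _ w (fun=> r * x.1) (fun s => r * s) x.2 _ _ (dw _)
    (der_cst _ _) (derM (der_cst x.2 r) (der_id x.2)).
  by apply: (deriv_at_eq d); gen_partial; ring.
- have d := @der_path _ w (fun s => r * s) (fun=> r * x.2) x.1 _ _ (dw _)
    (derM (der_cst x.1 r) (der_id x.1)) (der_cst _ _).
  by apply: (deriv_at_eq d); gen_partial; ring.
Qed.

Lemma C1_dilate w r : C1 w -> C1 (fun x => w (r * x.1, r * x.2)).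
Proof.
move=> Cw; have [dw c1 c2] := Cw.
have E i x := partial_dilate i r x Cw.
apply: (C1_intro _ (E false) (E true)); try by cont.
move=> x.
have dp : differentiable (fun x : R * R => (r * x.1, r * x.2)) x.
  apply: differentiable_pair; apply: dfM;
    [exact: df_cst|exact: df_fst|exact: df_cst|exact: df_snd].
exact: differentiable_comp dp (dw _).
Qed.

(* The energy is convex, and [v] satisfies its Euler-Lagrange equation. *)
Lemma min_C1 v rho w r : local_solution v rho -> 0 < r < rho -> C1 w ->
  r ^- 6 * ball_int r (dens v) <= ball_int 1 (dens w) -
  2 * r ^- 2 * cint 0 (2 * pi) (fun t =>
    (w (cos t, sin t) - v (r * cos t, r * sin t) / r ^+ 3) * radial v r t).
Proof.
move=> [rho01 Cv v0 G] rr Cw.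
have r0 : 0 < r by case/andP: rr.
have r1 : r <= 1 by case/andP: rr; case/andP: rho01; lra.
have rn0 : r != 0 by rewrite gt_eqF.
(* [w] is transported to the ball of radius [r] by the scaling of degree 3, under which the energy
   gains the factor [r ^+ 6]. *)
pose wr x := r ^+ 3 * w (r^-1 * x.1, r^-1 * x.2).
have Cw1 := C1_dilate r^-1 Cw.
have Cwr : C1 wr by exact: C1M (C1_cst _) Cw1.
have pwr i x : partial i wr x = r ^+ 2 * partial i w (r^-1 * x.1, r^-1 * x.2).
  have [d _ _] := Cw1.
  rewrite /wr (@partialM _ i (fun=> r ^+ 3) _ x (df_cst _ _) (d x)).
  by rewrite partial_cst mul0r add0r partial_dilate//; gen_partial; field.
pose psi x := wr x - v x.
have Cpsi : C1 psi by exact: C1B.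
have Gr := G psi r Cpsi rr.
have dwr : ball_int r (dens wr) = r ^+ 6 * ball_int 1 (dens w).
  have -> : r ^+ 6 * ball_int 1 (dens w) = r ^+ 2 * ball_int 1 (fun x => r ^+ 4 * dens w x).
    by rewrite (ball_intZ (r ^+ 4) (lexx 1) (bmeas_cont (dens_cont Cw))) mulrA -exprD.
  have cd := dens_cont Cw.
  rewrite -ball_int_scale; [|by rewrite r0|by cont].
  apply: ball_int_eq => x _; rewrite /dens /gdot !pwr.
  have -> : (x.1 / r, x.2 / r) = (r^-1 * x.1, r^-1 * x.2) by rewrite !(mulrC r^-1).
  have -> : enorm x = r * enorm (r^-1 * x.1, r^-1 * x.2).
    rewrite /enorm /= !exprMn -mulrDr sqrtrM ?sqr_ge0// sqrtr_sqr gtr0_norm ?invr_gt0//.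
    by rewrite mulrA divff// mul1r.
  have -> : Num.max (wr x) 0 = r ^+ 3 * Num.max (w (r^-1 * x.1, r^-1 * x.2)) 0.
    by rewrite maxr_pMr ?exprn_ge0 ?(ltW r0)// mulr0.
  gen_partial; move: (enorm _) (Num.max _ _) => *; ring.
have bd f : C1 f -> bmeas (dens f) by move=> Cf; apply: bmeas_cont; exact: dens_cont.
have bs := bmeas_ssupp (C1_continuous Cv).
have bH : bmeas (fun x => gdot v psi x + ssupp v x * psi x).
  apply: bmeasD; first by apply: bmeas_cont; exact: gdot_cont.
  by apply: bmeasM => //; apply: bmeas_cont; exact: C1_continuous.
(* Pointwise, [dens wr] lies above [dens v] plus twice the integrand of Green's formula: squares are
   convex, and the term with the positive part is compared separately where [v > 0] and where
   [v = 0]. *)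
have key : ball_int r (dens v) + 2 * flux v psi r <= r ^+ 6 * ball_int 1 (dens w).
  rewrite -dwr -Gr -ball_intZ// -ball_intD//; [|exact: bd|exact: bmeasM (bmeas_cst 2) bH].
  apply: ball_int_le => //; [|exact: bd|].
    by apply: bmeasD; [exact: bd|exact: bmeasM (bmeas_cst 2) bH].
  move=> x xr; have vx : 0 <= v x by apply: v0; apply: (lt_trans xr); case/andP: rr.
  have [dv _ _] := Cv; have [dwr' _ _] := Cwr.
  rewrite /psi gdotBr// /dens /gdot /ssupp indicE.
  have e0 := enorm_ge0 x.
  have -> : Num.max (v x) 0 = v x by apply/max_idPl.
  have sq (a b : R) : 0 <= (a - b) ^+ 2 := sqr_ge0 _.
  have := sq (partial false wr x) (partial false v x).
  have := sq (partial true wr x) (partial true v x).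
  have M1 : wr x <= Num.max (wr x) 0 by rewrite le_max lexx.
  have M2 : 0 <= Num.max (wr x) 0 by rewrite le_max lexx orbT.
  gen_partial => h1 h2.
  have [|nv] := boolP (x \in _).
    move=> _ /=; move: vx M1 M2 e0 h1 h2; move: (v x) (wr x) (enorm x) => a b c.
    by move: (Num.max _ _) => d *; nra.
  have -> : v x = 0.
    apply/eqP; rewrite eq_le vx andbT leNgt; apply/negP => vx0.
    by move/negP: nv; apply; apply/mem_set.
  move: M1 M2 e0 h1 h2; rewrite /=; move: (wr x) (enorm x) => b c.
  by move: (Num.max _ _) => d *; nra.
have fE : flux v psi r = r ^+ 4 * cint 0 (2 * pi) (fun t =>
    (w (cos t, sin t) - v (r * cos t, r * sin t) / r ^+ 3) * radial v r t).
  have cw := C1_continuous Cw; have cv := C1_continuous Cv.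
  have cr := radial_cont (r := r) Cv.
  rewrite fluxE exprS -mulrA; congr (r * _); rewrite -cintZ; last by cont.
  apply: cint_eq => t _; rewrite mulrA -/(radial v r t).
  congr (_ * _); rewrite /psi /wr /=.
  have e (a : R) : r^-1 * (r * a) = a by rewrite mulrA mulVf// mul1r.
  by rewrite !e mulrBr mulrCA divff ?mulr1// expf_neq0.
move: key; rewrite fE.
move: (Rintegral _ _ _) (ball_int r _) (ball_int 1 _) => I A B key.
rewrite -(ler_pM2l (exprn_gt0 6 r0)) mulrA divff ?expf_neq0// mul1r.
have -> : r ^+ 6 * (B - 2 * r ^- 2 * I) = r ^+ 6 * B - 2 * (r ^+ 4 * I) by field.
lra.
Qed.

End minimality.

Section trace.
Context {R : realType}.
Notation mR := (measurableTypeR R).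
Implicit Types (f u v psi w c : R * R -> R) (r s rho : R).

Let I1 f := ((@lebesgue2 R).-integrable (eball 1) (EFin \o f))%E.

Let I1D f g : I1 f -> I1 g -> I1 (fun x => f x + g x).
Proof. by move=> If Ig; exact: (integrableD (measurable_eball 1) If Ig). Qed.

Let I1Z (a : R) f : I1 f -> I1 (fun x => a * f x).
Proof. by move=> If; exact: (integrableZl (measurable_eball 1) a If). Qed.

Let I1c (a : R) : I1 (fun=> a).
Proof. by apply: continuous_integrable2 => //; cont. Qed.

Let I1_dom f g : measurable_fun (eball 1 : set (mR * mR)) (f : mR * mR -> mR) ->
  I1 g -> (forall x, eball 1 x -> `|f x| <= g x) -> I1 f.
Proof.
move=> mf Ig fg; apply: (le_integrable (measurable_eball 1) _ _ Ig).
  exact/measurable_EFinP.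
move=> x x1; rewrite /= lee_fin.
exact: le_trans (fg x x1) (ler_norm _).
Qed.

Let biD f g : I1 f -> I1 g ->
  ball_int 1 (fun x => f x + g x) = ball_int 1 f + ball_int 1 g.
Proof. by move=> If Ig; apply: RintegralD => //; exact: measurable_eball. Qed.

Let biZ (a : R) f : I1 f -> ball_int 1 (fun x => a * f x) = a * ball_int 1 f.
Proof. by move=> If; apply: RintegralZl => //; exact: measurable_eball. Qed.

Let bi_le f g : I1 f -> I1 g -> (forall x, eball 1 x -> f x <= g x) ->
  ball_int 1 f <= ball_int 1 g.
Proof. by move=> If Ig fg; apply: le_Rintegral => //; exact: measurable_eball. Qed.

(* Approximating the competitor by functions of class C^1, for which the
   minimality is known; the loss is controlled by the inequality
   [2 a b <= d a^2 + b^2 / d]. *)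
Lemma min_trace v rho r (w : R * R -> R) (dw : R * R -> R * R) c :
  local_solution v rho -> 0 < r < rho -> W12 w dw -> has_trace w dw c ->
  (forall t, c (cos t, sin t) = v (r * cos t, r * sin t) / r ^+ 3) ->
  r ^- 6 * ball_int r (dens v) <=
  ball_int 1 (fun x => enorm (dw x) ^+ 2 + 2 * enorm x * Num.max (w x) 0).
Proof.
move=> sv rr [[mw mdw] Iw2 Idw2 _] [_ _ [phi [Cphi cvg1 cvg2]]] cE.
have [rho01 Cv _ _] := sv; have cv := C1_continuous Cv.
have r0 : 0 < r by case/andP: rr.
have Cp k : C1 (phi k) by apply/C1P; exact: Cphi.
pose A x := enorm (dw x) ^+ 2 + 2 * enorm x * Num.max (w x) 0.
pose D x := enorm (dw x) ^+ 2.
pose E k x := (phi k x - w x) ^+ 2 + enorm (grad (phi k) x - dw x) ^+ 2.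
have mcont f : continuous f -> measurable_fun (eball 1 : set (mR * mR)) (f : mR * mR -> mR).
  exact: continuous_measurable.
have mdw1 : measurable_fun (eball 1 : set (mR * mR)) ((fun x => (dw x).1) : mR * mR -> mR).
  exact: (measurableT_comp measurable_fst mdw).
have mdw2 : measurable_fun (eball 1 : set (mR * mR)) ((fun x => (dw x).2) : mR * mR -> mR).
  exact: (measurableT_comp measurable_snd mdw).
have ID : I1 D by [].
have Iw : I1 (fun x => w x ^+ 2) by [].
have e1 x : eball 1 x -> 0 <= enorm x <= 1.
  by move=> x1; rewrite enorm_ge0 /= ltW.
have IA : I1 A.
  apply: I1D => //.
  apply: (@I1_dom _ (fun x => 1 + w x ^+ 2)); last 1 first.
  - move=> x /e1/andP[x0 x1]; rewrite ger0_norm; last first.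
      by rewrite mulr_ge0 ?mulr_ge0// le_max lexx orbT.
    rewrite maxr_pMr ?mulr_ge0// mulr0 ge_max; apply/andP; split; last first.
      by rewrite addr_ge0// sqr_ge0.
    have := sqr_ge0 (w x - enorm x); have : enorm x ^+ 2 <= 1 by rewrite expr_le1.
    nra.
  - apply: measurable_funM; first by apply: mcont; cont.
    by apply: measurable_maxr.
  - by apply: I1D => //; exact: I1c.
have IE k : I1 (E k).
  have [_ c1 c2] := Cp k; have cp := C1_continuous (Cp k).
  have Eq : E k = fun x => (phi k x - w x) ^+ 2 +
      ((partial false (phi k) x - (dw x).1) ^+ 2 + (partial true (phi k) x - (dw x).2) ^+ 2).
    by apply/funext => x; rewrite /E sqr_enorm.
  apply: (@I1_dom _ (fun x => 2 * phi k x ^+ 2 + 2 * w x ^+ 2 +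
    (2 * (partial false (phi k) x ^+ 2 + partial true (phi k) x ^+ 2) + 2 * D x))).
  - rewrite Eq; apply: measurable_funD; first by apply: measurable_funX; apply: measurable_funB => //; exact: mcont.
    by apply: measurable_funD; apply: measurable_funX; apply: measurable_funB => //; exact: mcont.
  - apply: I1D; first by apply: I1D; [apply: continuous_integrable2 => //; cont|exact: I1Z].
    by apply: I1D; [apply: continuous_integrable2 => //; cont|exact: I1Z].
  - move=> x _; rewrite /D Eq sqr_enorm ger0_norm; last by rewrite !(addr_ge0, sqr_ge0).
    have sq (a b : R) : (a - b) ^+ 2 <= 2 * a ^+ 2 + 2 * b ^+ 2.
      by have := sqr_ge0 (a + b); nra.
    move: (partial false (phi k) x) (partial true (phi k) x) => a b; have := sq a (dw x).1; have := sq b (dw x).2; have := sq (phi k x) (w x).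
    lra.
(* Up to terms proportional to [d], the energies of [phi k] and [w] differ by the squared W^{1,2}
   distance, at the price of the factor [1 + d^-1]. *)
have step k d : 0 < d -> ball_int 1 (dens (phi k)) <=
    ball_int 1 A + d * ball_int 1 D + d * pi + (1 + d^-1) * ball_int 1 (E k).
  move=> d0.
  have -> : d * pi = ball_int 1 (fun=> d) :> R.
    have -> : ball_int 1 (fun=> d) = ball_int 1 (fun=> d * 1) by rewrite mulr1.
    by rewrite (biZ d (I1c 1)) disc_area ?ltr01 ?lexx// expr1n mulr1.
  have I1' := I1D IA (I1Z d ID); have I2' := I1D I1' (I1c d).
  have I3' := I1D I2' (I1Z (1 + d^-1) (IE k)).
  rewrite -(biZ d ID) -(biZ _ (IE k)) -(biD IA (I1Z d ID)) -(biD I1' (I1c d)).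
  rewrite -(biD I2' (I1Z (1 + d^-1) (IE k))).
  apply: bi_le I3' _.
    by apply: continuous_integrable2 => //; exact: dens_cont.
  move=> x /e1/andP[x0 x1].
  have dV : 0 < d^-1 by rewrite invr_gt0.
  rewrite /dens /gdot /A /D /E !sqr_enorm /=.
  have sq (a b : R) : a * a <= b ^+ 2 + d * b ^+ 2 + (1 + d^-1) * (a - b) ^+ 2.
    rewrite -subr_ge0.
    have -> : b ^+ 2 + d * b ^+ 2 + (1 + d^-1) * (a - b) ^+ 2 - a * a =
      d^-1 * (d * b - (a - b)) ^+ 2 by field; rewrite gt_eqF.
    by rewrite mulr_ge0 ?sqr_ge0// ltW.
  have m1 : Num.max (phi k x) 0 <= Num.max (w x) 0 + `|phi k x - w x|.
    rewrite ge_max; apply/andP; split.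
      have : w x <= Num.max (w x) 0 by rewrite le_max lexx.
      by have := ler_norm (phi k x - w x); lra.
    by rewrite addr_ge0// le_max lexx orbT.
  have m2 : 2 * enorm x * `|phi k x - w x| <= d + d^-1 * (phi k x - w x) ^+ 2.
    rewrite -[(phi k x - w x) ^+ 2]real_normK ?num_real//.
    have n0 : 0 <= `|phi k x - w x| by [].
    move: `|phi k x - w x| n0 => a a0.
    apply: (@le_trans _ _ (2 * a)).
      by rewrite -mulrA ler_pM2l// ler_piMl.
    rewrite -subr_ge0.
    have -> : d + d^-1 * a ^+ 2 - 2 * a = d^-1 * (d - a) ^+ 2 by field; rewrite gt_eqF.
    by rewrite mulr_ge0 ?sqr_ge0// ltW.
  have m3 : 2 * enorm x * Num.max (phi k x) 0 <=
      2 * enorm x * Num.max (w x) 0 + 2 * enorm x * `|phi k x - w x|.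
    by rewrite -mulrDr ler_wpM2l// mulr_ge0.
  have s0 : 0 <= (phi k x - w x) ^+ 2 := sqr_ge0 _.
  have := sq (partial false (phi k) x) (dw x).1; have := sq (partial true (phi k) x) (dw x).2.
  move: (partial false (phi k) x) (partial true (phi k) x) => a b.
  move: (2 * enorm x * Num.max (phi k x) 0) m3 => T1 m3.
  move: (2 * enorm x * `|_|) m3 m2 => T2 m3.
  move: (2 * enorm x * Num.max (w x) 0) m3 => T3 m3.
  move: ((phi k x - w x) ^+ 2) s0 => T4 T40 m2.
  rewrite -!expr2 !(mulrDr, mulrDl) !mul1r !addrA.
  lra.
pose Nv := cint 0 (2 * pi) (fun t => radial v r t ^+ 2).
pose eta k := circ_int 1 (fun x => (phi k x - c x) ^+ 2).
have bstep k d : 0 < d -> r ^- 6 * ball_int r (dens v) <=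
    ball_int 1 (dens (phi k)) + r ^- 2 * (d * Nv + d^-1 * eta k).
  move=> d0; apply: (le_trans (min_C1 sv rr (Cp k))).
  have cp := C1_continuous (Cp k).
  have cr := radial_cont (r := r) Cv.
  pose a t := phi k (cos t, sin t) - v (r * cos t, r * sin t) / r ^+ 3.
  have ca : continuous a by rewrite /a; cont.
  have -> : eta k = cint 0 (2 * pi) (fun t => a t ^+ 2).
    by rewrite /eta /circ_int mul1r; apply: cint_eq => t _; rewrite !mul1r cE.
  rewrite lerD2l.
  have eN (x y : R) : - (2 * y * x) = y * (- 2 * x) by ring.
  rewrite eN ler_pM2l ?invr_gt0 ?exprn_gt0//.
  rewrite /Nv -!cintZ; try by cont.
  rewrite -cintD; try by cont.
  apply: cint_le; try by cont.
  move=> t _; rewrite -/(a t); move: (a t) (radial v r t) => x y.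
  rewrite -subr_ge0.
  have -> : d * y ^+ 2 + d^-1 * x ^+ 2 - - 2 * (x * y) = d^-1 * (d * y + x) ^+ 2.
    by field; rewrite gt_eqF.
  by rewrite mulr_ge0 ?sqr_ge0// invr_ge0 ltW.
(* [m] majorises the sum of all factors of [d], so that with [d = e / 2 / m] these terms amount to
   at most [e / 2]; for this fixed [d] the remaining ones tend to 0 with [k]. *)
pose m := ball_int 1 D + pi + r ^- 2 * Nv + 1.
have D0 : 0 <= ball_int 1 D by apply: Rintegral_ge0 => x _; exact: sqr_ge0.
have N0 : 0 <= Nv by apply: cint_ge0 => t _; exact: sqr_ge0.
have rV : 0 < r ^- 2 by rewrite invr_gt0 exprn_gt0.
have m0 : 0 < m.
  by have := @pi_gt0 R; have := mulr_ge0 (ltW rV) N0; rewrite /m; lra.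
rewrite -/(ball_int 1 A).
apply/ler_addgt0Pr => e e0.
pose d := e / 2 / m.
have d0 : 0 < d by rewrite !divr_gt0.
have dV : 0 < d^-1 by rewrite invr_gt0.
have dm : d * m = e / 2 by rewrite /d divfK// gt_eqF.
have lim0 : (1 + d^-1) * ball_int 1 (E k) + r ^- 2 * (d^-1 * eta k) @[k --> \oo] --> (0 : R).
  have -> : 0 = (1 + d^-1) * 0 + r ^- 2 * (d^-1 * 0) :> R by rewrite !mulr0 addr0.
  apply: cvgD; first by apply: cvgM; [exact: cvg_cst|exact: cvg1].
  by apply: cvgM; [exact: cvg_cst|apply: cvgM; [exact: cvg_cst|exact: cvg2]].
have e20 : 0 < e / 2 by rewrite divr_gt0.
have /cvgr_lt/(_ _ e20)[k _ /(_ k (leqnn k))] := lim0.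
have := bstep k d d0; have := step k d d0; move: dm; rewrite /m.
have eP (P : R) : r ^- 2 * (d * Nv + d^-1 * P) = d * (r ^- 2 * Nv) + r ^- 2 * (d^-1 * P).
  by ring.
rewrite eP !mulrDr mulr1.
move: (r ^- 6 * _) (r ^- 2 * (d^-1 * _)) ((1 + d^-1) * _) => X1 X2 X3.
move: (ball_int 1 (dens _)) (ball_int 1 A) (d * _) (d * _) (d * _) => X4 X5 X6 X7 X8.
lra.
Qed.

End trace.

(** * Homogeneous functions of degree 3 *)

Section polar_angle.
Context {R : realType}.

Lemma deriv_at_unique (f : R -> R) (x a b : R) : deriv_at f x a -> deriv_at f x b -> a = b.
Proof. by move=> [_ <-] [_ <-]. Qed.

Lemma unit_angle (a b : R) : a ^+ 2 + b ^+ 2 = 1 ->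
  exists2 t, - pi <= t <= pi & cos t = a /\ sin t = b.
Proof.
move=> ab.
have a1 : -1 <= a <= 1 by have := sqr_ge0 b; nra.
have sa : sin (acos a) = `|b|.
  rewrite sin_acos//; have -> : 1 - a ^+ 2 = b ^+ 2 by lra.
  exact: sqrtr_sqr.
have c0 := acos_ge0 a1; have cp := acos_lepi a1; have p0 := @pi_ge0 R.
have [b0|b0] := leP 0 b.
  exists (acos a); first lra.
  by rewrite sa ger0_norm// acosK// in_itv.
exists (- acos a); first lra.
by rewrite cosN sinN sa ltr0_norm// opprK acosK// in_itv.
Qed.

Lemma polar_angle (x : R * R) :
  exists2 t, - pi <= t <= pi & x = (enorm x * cos t, enorm x * sin t).
Proof.
have [x0|x0] := eqVneq (enorm x) 0.
  exists 0; first by have := @pi_ge0 R; lra.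
  have := sqr_enorm x; rewrite x0 expr0n/= => /esym/eqP.
  rewrite paddr_eq0 ?sqr_ge0// !sqrf_eq0 => /andP[/eqP ? /eqP ?].
  by rewrite !mul0r; exact: injective_projections.
have [|t tp [ct st]] := @unit_angle (x.1 / enorm x) (x.2 / enorm x).
  by rewrite !expr_div_n -mulrDl -sqr_enorm divff// expf_neq0.
exists t => //; rewrite ct st !(mulrC (enorm x)) !divfK//; exact: surjective_pairing.
Qed.

End polar_angle.

Section homogeneous.
Context {R : realType}.
Variables (c : R * R -> R) (G G' : R -> R).
Hypotheses (dG : forall t, deriv_at G t (G' t)) (cG' : continuous G')
  (cE : forall s t, 0 <= s -> c (s * cos t, s * sin t) = s ^+ 3 * G t).

Let cG : continuous G := fun t => deriv_at_continuous (dG t).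

Section local_angle.
Variable (t0 : R).
(* Coordinates in the frame rotated by [t0], and the polar angle in the half-plane
   [0 < rotp]. *)
Definition rotp (x : R * R) := x.1 * cos t0 + x.2 * sin t0.
Definition rotq (x : R * R) := x.2 * cos t0 - x.1 * sin t0.
Definition rota (x : R * R) := t0 + atan (rotq x / rotp x).

Lemma rota_polar x : 0 < rotp x -> x = (enorm x * cos (rota x), enorm x * sin (rota x)).
Proof.
move=> p0.
have cs := cos2Dsin2 t0.
have E : enorm x = Num.sqrt (rotp x ^+ 2 + rotq x ^+ 2).
  congr Num.sqrt; rewrite /rotp /rotq -[LHS]mulr1 -cs; ring.
have w0 : 0 < 1 + (rotq x / rotp x) ^+ 2 by rewrite ltr_pwDl// sqr_ge0.
have E2 : enorm x = rotp x * Num.sqrt (1 + (rotq x / rotp x) ^+ 2).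
  have -> : enorm x = Num.sqrt (rotp x ^+ 2 * (1 + (rotq x / rotp x) ^+ 2)).
    rewrite E; congr Num.sqrt; move: (rotp x) (rotq x) p0 => a b a0.
    by field; rewrite gt_eqF.
  by rewrite sqrtrM ?sqr_ge0// sqrtr_sqr gtr0_norm.
have s0 : Num.sqrt (1 + (rotq x / rotp x) ^+ 2) != 0 by rewrite gt_eqF// sqrtr_gt0.
have ca : enorm x * cos (atan (rotq x / rotp x)) = rotp x.
  by rewrite E2 cos_atan mulfK.
have sa : enorm x * sin (atan (rotq x / rotp x)) = rotq x.
  have cn : cos (atan (rotq x / rotp x)) != 0 by rewrite cos_atan invr_eq0.
  have := atanK (rotq x / rotp x); rewrite /tan => H.
  have := divfK cn (sin (atan (rotq x / rotp x))); rewrite H => <-.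
  by rewrite mulrCA ca divfK// gt_eqF.
apply: injective_projections; rewrite /rota /= ?cosD ?sinD ?mulrBr ?mulrDr mulrCA ca.
- rewrite [X in _ - X]mulrCA sa /rotp /rotq -[LHS]mulr1 -cs; ring.
- rewrite [X in _ + X]mulrCA sa /rotp /rotq -[LHS]mulr1 -cs; ring.
Qed.

Lemma rota_df x : 0 < rotp x -> differentiable rota x.
Proof.
move=> p0; have pn0 : rotp x != 0 by rewrite gt_eqF.
have dp : differentiable rotp x by rewrite /rotp; repeat df1.
have dq : differentiable rotq x by rewrite /rotq; repeat df1.
have dV : differentiable (fun y => (rotp y)^-1) x.
  have dv : deriv_at (fun z : R => z^-1) (rotp x) (- 1 / rotp x ^+ 2).
    exact: (derV (f := id) pn0 (der_id (rotp x))).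
  exact: df_comp dv dp.
apply: dfD; first exact: df_cst.
have da : deriv_at atan (rotq x / rotp x) ('D_1 atan (rotq x / rotp x)) by split=> //; exact: derivable_atan.
by apply: (df_comp da); exact: dfM.
Qed.

Lemma near_rotp x : 0 < rotp x -> \forall y \near x, 0 < rotp y.
Proof.
move=> p0; have cp : continuous rotp by rewrite /rotp; cont.
exact: (cvgr_gt _ (cp x)).
Qed.

Lemma rotp_polar s : rotp (s * cos t0, s * sin t0) = s.
Proof. by rewrite /rotp /= -[RHS]mulr1 -(cos2Dsin2 t0); ring. Qed.

Lemma homog_df_local x : 0 < rotp x -> differentiable c x.
Proof.
move=> p0.
have x0 : 0 < enorm x.
  rewrite lt_neqAle enorm_ge0 andbT; apply/eqP => e0.
  have := sqr_enorm x; rewrite -e0 expr0n/= => /esym/eqP.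
  rewrite paddr_eq0 ?sqr_ge0// !sqrf_eq0 => /andP[/eqP x1 /eqP x2].
  by move: p0; rewrite /rotp x1 x2 !mul0r addr0 ltxx.
apply: (@near_differentiable _ _ (fun y => enorm y ^+ 3 * G (rota y))).
  have := near_rotp p0; apply: filterS => y py.
  by rewrite {1}(rota_polar py) cE ?enorm_ge0.
apply: dfM; last exact: df_comp (dG _) (rota_df p0).
apply: dfX; have [dn _ _] := @C1_nrm2 R.
have n0 : 0 < nrm2 x by rewrite /nrm2 -sqr_enorm exprn_gt0.
exact: (df_comp (h := Num.sqrt) (is_derive1_sqrt n0) (dn x)).
Qed.

End local_angle.

Lemma homog_df_polar s t : 0 < s -> differentiable c (s * cos t, s * sin t).
Proof. by move=> s0; apply: (@homog_df_local t); rewrite rotp_polar. Qed.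

Lemma homog_bound : exists2 M, 0 <= M &
  forall t, - pi <= t <= pi -> `|G t| <= M /\ `|G' t| <= M.
Proof.
have [M M0 HM] := @rect_bounded _ (fun z => G z.2) 0 0 (- pi) pi ltac:(by cont).
have [M' M'0 HM'] := @rect_bounded _ (fun z => G' z.2) 0 0 (- pi) pi ltac:(by cont).
exists (M + M') => [|t tp]; first exact: addr_ge0.
have h0 : (0 : R) <= (0 : R) <= 0 by apply/andP.
have := HM 0 t h0 tp; have := HM' 0 t h0 tp => /=.
by move=> h1 h2; split; [apply: (le_trans h2); rewrite lerDl|apply: (le_trans h1); rewrite lerDr].
Qed.

(** Cubic growth makes [c] negligible against |x| at the origin. *)
Lemma homog_df0 : differentiable c (0, 0) /\ forall i, partial i c (0, 0) = 0.
Proof.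
have [M M0 HM] := homog_bound.
have [|dc d0] := @small_differentiable R _ _ c (0, 0).
  move=> e e0.
  have ce : continuous_at ((0, 0) : R * R) (fun y : R * R => 2 * M * enorm y ^+ 2).
    apply: contM; first exact: cont_cst.
    by apply: contX; apply: cont_enorm; exact: cont_id.
  have z0 : 2 * M * enorm ((0, 0) : R * R) ^+ 2 < e.
    by rewrite sqr_enorm /= expr0n/= addr0 mulr0.
  near=> y; have ye : 2 * M * enorm y ^+ 2 < e.
    by near: y; exact: (cvgr_lt _ ce _ z0).
  have [t tp yE] := polar_angle y.
  have -> : c y = enorm y ^+ 3 * G t by rewrite {1}yE cE ?enorm_ge0.
  rewrite subr0 normrM ger0_norm ?exprn_ge0 ?enorm_ge0//.
  have e2 : enorm y <= 2 * `|y|.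
    rewrite enorm_le ?mulr_ge0//.
    have h1 : `|y.1| <= `|y| by rewrite prod_normE le_max lexx.
    have h2 : `|y.2| <= `|y| by rewrite prod_normE le_max lexx orbT.
    rewrite -(real_normK (num_real y.1)) -(real_normK (num_real y.2)).
    have := normr_ge0 y.1; have := normr_ge0 y.2; nra.
  apply: (@le_trans _ _ (enorm y ^+ 3 * M)).
    by rewrite ler_wpM2l ?exprn_ge0 ?enorm_ge0//; exact: (HM t tp).1.
  apply: (@le_trans _ _ (2 * M * enorm y ^+ 2 * `|y|)); last by rewrite ler_wpM2r// ltW.
  have -> : enorm y ^+ 3 * M = (M * enorm y ^+ 2) * enorm y by ring.
  have -> : 2 * M * enorm y ^+ 2 * `|y| = (M * enorm y ^+ 2) * (2 * `|y|) by ring.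
  by rewrite ler_wpM2l// mulr_ge0// sqr_ge0.
split => // i; rewrite /partial deriveE// d0; by case: i.
Unshelve. all: end_near. Qed.

(** Along rays and circles [c] is explicit, which gives the radial and tangential components of its
    gradient; the Cartesian ones follow by inverting a rotation. At the origin both sides are 0. *)
Lemma homog_partial s t : 0 <= s ->
  partial false c (s * cos t, s * sin t) = s ^+ 2 * (3 * G t * cos t - G' t * sin t) /\
  partial true c (s * cos t, s * sin t) = s ^+ 2 * (3 * G t * sin t + G' t * cos t).
Proof.
rewrite le_eqVlt => /predU1P[<-|s0].
  by rewrite !mul0r expr0n/= !mul0r; have [_ h] := homog_df0; rewrite !h.
have dc := homog_df_polar t s0.
have d1 := @der_path _ c (fun s => s * cos t) (fun s => s * sin t) s _ _ dc
  (derM (der_id s) (der_cst s (cos t))) (derM (der_id s) (der_cst s (sin t))).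
have d2 := @der_path _ c (fun t => s * cos t) (fun t => s * sin t) t _ _ dc
  (derM (der_cst t s) (der_cos (der_id t))) (derM (der_cst t s) (der_sin (der_id t))).
have e1 : deriv_at (fun s => c (s * cos t, s * sin t)) s (3 * s ^+ 2 * G t).
  have near_s : \near s, s ^+ 3 * G t = c (s * cos t, s * sin t).
    near=> y; rewrite cE//; apply: ltW; near: y; exact: lt_nbhsr.
  apply: (near_eq_is_derive near_s).
  have := derM (derX 2 (der_id s)) (der_cst s (G t)).
  by move=> /deriv_at_eq; apply; ring.
have e2 : deriv_at (fun t => c (s * cos t, s * sin t)) t (s ^+ 3 * G' t).
  have -> : (fun t => c (s * cos t, s * sin t)) = (fun t => s ^+ 3 * G t).
    by apply/funext => y; rewrite cE// ltW.
  have := derM (der_cst t (s ^+ 3)) (dG t).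
  by move=> /deriv_at_eq; apply; ring.
have E1 := deriv_at_unique d1 e1; have E2 := deriv_at_unique d2 e2.
move: E1 E2; move: (partial _ _ _) (partial _ _ _) (cos2Dsin2 t) => b a cs.
move: (cos t) (sin t) cs => x y cs E1 E2.
have sn0 : s != 0 by rewrite gt_eqF.
have F1 : x * a + y * b = 3 * s ^+ 2 * G t by rewrite -E1; ring.
have F2 : x * b - y * a = s ^+ 2 * G' t.
  apply: (mulfI sn0); have -> : s * (s ^+ 2 * G' t) = s ^+ 3 * G' t by ring.
  by rewrite -E2; ring.
split.
- have -> : a = (x ^+ 2 + y ^+ 2) * a by rewrite cs mul1r.
  have -> : (x ^+ 2 + y ^+ 2) * a = x * (x * a + y * b) - y * (x * b - y * a) by ring.
  by rewrite F1 F2; ring.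
- have -> : b = (x ^+ 2 + y ^+ 2) * b by rewrite cs mul1r.
  have -> : (x ^+ 2 + y ^+ 2) * b = y * (x * a + y * b) + x * (x * b - y * a) by ring.
  by rewrite F1 F2; ring.
Unshelve. all: end_near. Qed.

(** Away from the origin the partial derivatives are continuous functions of the modulus and of a
    local branch [rota] of the angle; at the origin they are of the order of |x|^2. *)
Lemma homog_C1 : C1 c.
Proof.
have df x : differentiable c x.
  have [t _ ->] := polar_angle x; have := enorm_ge0 x; rewrite le_eqVlt => /predU1P[<-|x0].
    by rewrite !mul0r; exact: homog_df0.1.
  exact: homog_df_polar.
have [M M0 HM] := homog_bound.
suff cp i : continuous (partial i c) by exact: And3 df (cp false) (cp true).
pose H i s t := s ^+ 2 * (3 * G t * (if i then sin t else cos t) +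
   G' t * (if i then cos t else - sin t)).
have pE s t : 0 <= s -> partial i c (s * cos t, s * sin t) = H i s t.
  by move=> /(homog_partial t)[h1 h2]; rewrite /H; case: (i); rewrite ?h1 ?h2 ?mulrN.
move=> x; have [t0 _ x0E] := polar_angle x.
have := enorm_ge0 x; rewrite le_eqVlt => /predU1P[x0|x0].
  have {}x0E : x = (0, 0) by rewrite x0E -x0 !mul0r.
  rewrite x0E; apply/cvgrPdist_le => e e0.
  have ce : continuous_at ((0, 0) : R * R) (fun y : R * R => 4 * M * enorm y ^+ 2).
    apply: contM; first exact: cont_cst.
    by apply: contX; apply: cont_enorm; exact: cont_id.
  have z0 : 4 * M * enorm ((0, 0) : R * R) ^+ 2 < e.
    by rewrite sqr_enorm /= expr0n/= addr0 mulr0.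
  near=> y; have ye : 4 * M * enorm y ^+ 2 < e.
    by near: y; exact: (cvgr_lt _ ce _ z0).
  rewrite homog_df0.2 sub0r normrN; apply: (le_trans _ (ltW ye)).
  have [t tp yE] := polar_angle y; rewrite {1}yE pE ?enorm_ge0// /H.
  have [g1 g2] := HM t tp.
  rewrite normrM ger0_norm ?sqr_ge0// mulrC ler_wpM2r ?sqr_ge0//.
  have nc : `|if i then sin t else cos t| <= 1 by case: (i); [exact: sin_max|exact: cos_max].
  have ns : `|if i then cos t else - sin t| <= 1.
    by case: (i); rewrite ?normrN; [exact: cos_max|exact: sin_max].
  apply: (le_trans (ler_normD _ _)); rewrite !normrM ger0_norm//.
  have := ler_pM (normr_ge0 _) (normr_ge0 _) g1 nc.
  have := ler_pM (normr_ge0 _) (normr_ge0 _) g2 ns.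
  by rewrite !mulr1 -mulrA => *; lra.
have px : 0 < rotp t0 x by rewrite x0E rotp_polar.
apply: (@near_continuous_at _ _ (fun y => H i (enorm y) (rota t0 y))).
  have := near_rotp px; apply: filterS => y py.
  by rewrite {1}(rota_polar py) pE ?enorm_ge0.
have ct : continuous_at x (rota t0) by apply: differentiable_continuous; exact: rota_df.
rewrite /H; apply: contM.
  by apply: contX; apply: cont_enorm; exact: cont_id.
apply: contD; apply: contM.
- apply: contM; first exact: cont_cst.
  by apply: (@cont_comp _ _ _ G (rota t0)); [exact: cG|exact: ct].
- by case: (i); [exact: cont_sin|exact: cont_cos].
- by apply: (@cont_comp _ _ _ G' (rota t0)); [exact: cG'|exact: ct].
- by case: (i); [exact: cont_cos|apply: contN; exact: cont_sin].
Unshelve. all: end_near. Qed.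

(** Integrating [s ^+ 5] along rays gives 1/6. In units of 1/6, the radial derivative contributes 9
    G^2 and the boundary term -18 G^2, whence -9 G^2. *)
Lemma homog_weissM : weissM_C1 c =
  6^-1 * cint 0 (2 * pi) (fun t => G' t ^+ 2 + 2 * Num.max (G t) 0 - 9 * G t ^+ 2).
Proof.
have Cc := homog_C1.
rewrite /weissM_C1 /weissM.
have -> : ball_int 1 (fun x => enorm (grad c x) ^+ 2 + 2 * enorm x * Num.max (c x) 0) =
    ball_int 1 (dens c).
  by apply: ball_int_eq => x _; rewrite /dens /gdot sqr_enorm /grad /= !expr2.
pose k t := 9 * G t ^+ 2 + G' t ^+ 2 + 2 * Num.max (G t) 0.
have ck : continuous k by rewrite /k; cont.
rewrite polar ?ltr01 ?lexx//; last exact: dens_cont.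
have -> : cint 0 1 (fun s => circ_int s (dens c)) = cint 0 1 (fun s => cint 0 (2 * pi) k * s ^+ 5).
  apply: cint_eq => s /andP[s0 _].
  rewrite /circ_int exprS mulrCA; congr (s * _); rewrite [RHS]mulrC -cintZ//.
  apply: cint_eq => t _; rewrite /dens /gdot enorm_circ//.
  have [-> ->] := homog_partial t s0.
  rewrite cE//.
  have -> : Num.max (s ^+ 3 * G t) 0 = s ^+ 3 * Num.max (G t) 0.
    by rewrite maxr_pMr ?exprn_ge0// mulr0.
  rewrite /k; have := cos2Dsin2 t.
  move: (Num.max (G t) 0) (G t) (G' t) (cos t) (sin t) => m g g' x y cs.
  have -> : s ^+ 2 * (3 * g * x - g' * y) * (s ^+ 2 * (3 * g * x - g' * y)) +
     s ^+ 2 * (3 * g * y + g' * x) * (s ^+ 2 * (3 * g * y + g' * x)) =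
     s ^+ 4 * ((9 * g ^+ 2 + g' ^+ 2) * (x ^+ 2 + y ^+ 2)) by ring.
  by rewrite cs; ring.
have -> : cint 0 1 (fun s => cint 0 (2 * pi) k * s ^+ 5) = 6^-1 * cint 0 (2 * pi) k.
  rewrite (@integral_derive _ (fun s => 6^-1 * cint 0 (2 * pi) k * s ^+ 6)) ?ler01//.
  - by rewrite expr1n expr0n/= mulr0 subr0 mulr1.
  - by cont.
  - by move=> s; der; move: (Rintegral _ _ _) => K; field.
have -> : circ_int 1 (fun x => c x ^+ 2) = cint 0 (2 * pi) (fun t => G t ^+ 2).
  by rewrite /circ_int mul1r; apply: cint_eq => t _; rewrite cE// expr1n mul1r.
rewrite -cintZ; last by cont.
have -> : 3 * cint 0 (2 * pi) (fun t => G t ^+ 2) =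
    cint 0 (2 * pi) (fun t => 3 * G t ^+ 2) by rewrite cintZ//; cont.
rewrite -cintB; [|by cont|by cont].
rewrite -cintZ; last by cont.
by apply: cint_eq => t _; rewrite /k; field.
Qed.

End homogeneous.

(** * Energy of the homogeneous solutions supported in a sector *)

Section sector.
Context {R : realType}.

Lemma deriv_atP (f : R -> R) (x a : R) :
  h^-1 *: (f (h *: 1 + x) - f x) @[h --> 0^'] --> a -> deriv_at f x a.
Proof.
move=> fa; split; first by apply/cvg_ex; exists a.
exact/cvg_lim.
Qed.

Lemma deriv_at_cvg (f : R -> R) (x a : R) : deriv_at f x a ->
  h^-1 *: (f (h *: 1 + x) - f x) @[h --> 0^'] --> a.
Proof. by move=> [df <-]; exact: df. Qed.

Lemma cos_periodZ (x : R) (k : int) : cos (x + 2 * pi * k%:~R) = cos x.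
Proof.
have pos (y : R) (n : nat) : cos (y + 2 * pi * n%:R) = cos y.
  by rewrite mulr_natr [2 * pi]mulr_natl; exact: (periodicn (@cosD2pi R)).
case: k => n; first exact: pos.
rewrite NegzE -(pos (x + _) n.+1); congr cos.
by rewrite intrN; ring.
Qed.

Lemma sin_periodZ (x : R) (k : int) : sin (x + 2 * pi * k%:~R) = sin x.
Proof.
have pos (y : R) (n : nat) : sin (y + 2 * pi * n%:R) = sin y.
  by rewrite mulr_natr [2 * pi]mulr_natl; exact: (periodicn (@sinD2pi R)).
case: k => n; first exact: pos.
rewrite NegzE -(pos (x + _) n.+1); congr sin.
by rewrite intrN; ring.
Qed.

Variables (t1 : R).
Notation pi := (@pi R).

(** The number of full turns to remove from [t] to reach the interval [t1, t1 + 2 pi[, on which the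
    sector solution is given. *)
Definition turn (t : R) : int := Num.floor ((t - t1) / (2 * pi)).
Definition wind (t : R) : R := t - 2 * pi * (turn t)%:~R.

Let p0 : 0 < pi := pi_gt0 R.

Lemma windP t : t1 <= wind t < t1 + 2 * pi.
Proof.
have p20 : 0 < 2 * pi by rewrite mulr_gt0.
have := Num.Theory.floor_itv ((t - t1) / (2 * pi)).
rewrite -/(turn t) ler_pdivlMr// ltr_pdivrMr// /wind intrD mulrDl => /andP[h1 h2].
by apply/andP; split; lra.
Qed.

Lemma wind_eq t (k : int) : t1 <= t - 2 * pi * k%:~R < t1 + 2 * pi -> wind t = t - 2 * pi * k%:~R.
Proof.
have p20 : 0 < 2 * pi by rewrite mulr_gt0.
move=> /andP[h1 h2]; rewrite /wind /turn.
suff -> : Num.floor ((t - t1) / (2 * pi)) = k by [].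
apply: Num.Theory.floor_def; rewrite intrD ler_pdivlMr// ltr_pdivrMr// mulrDl.
by apply/andP; split; lra.
Qed.

Definition sect (t : R) : R := if t1 < wind t < t1 + 2 * pi / 3 then 1 else 0.
Definition bump (t : R) : R := (1 - cos (3 * (t - t1))) / 9.
Definition dbump (t : R) : R := sin (3 * (t - t1)) / 3.

(** [sect] jumps at the two edges of the sector only, and there [bump] and its derivative vanish
    because 1 - cos has double zeros. This is why [sect * bump] is C^1. *)
Lemma sect_cases t : (bump t = 0 /\ dbump t = 0) \/ \forall y \near t, sect y = sect t.
Proof.
have h3 (k : int) : 3 * (t - 2 * pi * k%:~R - t1) = 3 * (t - t1) + 2 * pi * (- (3 * k))%:~R.
  by rewrite intrN intrM; ring.
have /andP[w1 w2] := windP t.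
have special a : wind t = a -> cos (3 * (a - t1)) = 1 -> sin (3 * (a - t1)) = 0 ->
    bump t = 0 /\ dbump t = 0.
  move=> <-; rewrite /wind h3 cos_periodZ sin_periodZ /bump /dbump => -> ->.
  by rewrite subrr !mul0r.
have [e1|n1] := eqVneq (wind t) t1.
  by left; apply: (special _ e1); rewrite subrr mulr0 ?cos0 ?sin0.
have [e2|n2] := eqVneq (wind t) (t1 + 2 * pi / 3).
  have e : 3 * (t1 + 2 * pi / 3 - t1) = 2 * pi by field.
  by left; apply: (special _ e2); rewrite e mulr_natl ?cos2pi ?sin2pi.
right; pose k := turn t.
have near_itv (a b : R) : a < wind t -> wind t < b ->
    \forall y \near t, a < y - 2 * pi * k%:~R < b.
  move=> wa wb; have cw : continuous_at t (fun y : R => y - 2 * pi * k%:~R).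
    by apply: contB; [exact: cont_id|exact: cont_cst].
  near=> y; apply/andP; split; near: y.
    exact: (cvgr_gt _ cw).
  exact: (cvgr_lt _ cw).
have w1' : t1 < wind t by rewrite lt_neqAle eq_sym n1.
have [lt3|ge3] := ltP (wind t) (t1 + 2 * pi / 3).
  have := near_itv _ _ w1' lt3; apply: filterS => y yk.
  have yw : wind y = y - 2 * pi * k%:~R by apply: wind_eq; have := p0; lra.
  by rewrite /sect yw yk w1' lt3.
have gt3 : t1 + 2 * pi / 3 < wind t by rewrite lt_neqAle eq_sym n2.
have := near_itv _ _ gt3 w2; apply: filterS => y yk.
have yw : wind y = y - 2 * pi * k%:~R by apply: wind_eq; have := p0; lra.
have -> : sect t = 0 by rewrite /sect [wind t < _]ltNge ge3 andbF.
rewrite /sect yw; case: ifP => // /andP[_]; lra.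
Unshelve. all: end_near. Qed.

Lemma sect01 t : sect t = 0 \/ sect t = 1.
Proof. by rewrite /sect; case: ifP; [right|left]. Qed.

Lemma der_bump t : deriv_at bump t (dbump t).
Proof. by rewrite /bump /dbump; der; field. Qed.

Lemma der_sect_bump t : deriv_at (fun t => sect t * bump t) t (sect t * dbump t).
Proof.
have [[b0 d0]|near_t] := sect_cases t; last first.
  apply: (near_eq_is_derive (f := fun y => sect t * bump y)).
    by near=> y; rewrite (_ : sect y = sect t)//; near: y.
  have := derM (der_cst t (sect t)) (der_bump t).
  by move=> /deriv_at_eq; apply; ring.
rewrite d0 mulr0; apply: deriv_atP; apply: norm_cvg0.
have := deriv_at_cvg (der_bump t); rewrite d0 => /cvg_norm; rewrite normr0 => c0.
apply: (squeeze_cvgr _ (cvg_cst 0) c0).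
near=> h; rewrite normr_ge0 /= b0 mulr0 !subr0 /GRing.scale/= !normrM ler_wpM2l//.
by have [->|->] := sect01 (h * 1 + t); rewrite ?normr0 ?mul0r// normr1 mul1r.
Unshelve. all: end_near. Qed.

Lemma cont_sect_dbump : continuous (fun t => sect t * dbump t).
Proof.
have cd : continuous dbump by rewrite /dbump; cont.
move=> t; have [[b0 d0]|near_t] := sect_cases t; last first.
  have c1 : continuous_at t (fun y => sect t * dbump y).
    by apply: contM; [exact: cont_cst|exact: cd].
  rewrite /continuous_at; apply: cvg_trans c1; apply: near_eq_cvg.
  by near=> y; rewrite (_ : sect y = sect t)//; near: y.
rewrite /continuous_at d0 mulr0; apply: norm_cvg0.
have := cd t; rewrite /continuous_at d0 => /cvg_norm; rewrite normr0 => c0.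
apply: (squeeze_cvgr _ (cvg_cst 0) c0).
near=> h; rewrite normr_ge0 /= normrM.
by have [->|->] := sect01 h; rewrite ?normr0 ?mul0r// normr1 mul1r.
Unshelve. all: end_near. Qed.

(** On the sector the integrand of [homog_weissM] reduces to 2/9 times the squared sine of
    [3 (t - t1)]. Over the opening [2 pi / 3] its integral is [2 pi / 27], and the energy is one
    sixth of that. *)
Lemma sector_weissM (h : R * R -> R) :
  (forall r t : R, 0 <= r -> t1 <= t < t1 + 2 * pi ->
    h (r * cos t, r * sin t) =
      if t1 < t < t1 + 2 * pi / 3 then r ^+ 3 / 9 * (1 - cos (3 * (t - t1))) else 0) ->
  weissM_C1 h = pi / 81.
Proof.
move=> hE.
have h3 t (k : int) : 3 * (t - 2 * pi * k%:~R - t1) = 3 * (t - t1) + 2 * pi * (- (3 * k))%:~R.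
  by rewrite intrN intrM; ring.
have hN t (k : int) : t - 2 * pi * k%:~R = t + 2 * pi * (- k)%:~R by rewrite intrN; ring.
have cE s t : 0 <= s -> h (s * cos t, s * sin t) = s ^+ 3 * (sect t * bump t).
  move=> s0; have := hE s (wind t) s0 (windP t).
  rewrite {1 2}/wind hN cos_periodZ sin_periodZ => ->.
  rewrite /sect; case: ifP => _; last by rewrite mul0r mulr0.
  by rewrite /wind h3 cos_periodZ /bump; field.
rewrite (homog_weissM der_sect_bump cont_sect_dbump cE).
have cS : continuous (fun t => sect t * bump t) := fun t => deriv_at_continuous (der_sect_bump t).
pose k t := 2 / 9 * sin (3 * (t - t1)) ^+ 2.
pose D t := sect t * dbump t; pose G t := sect t * bump t.
have cD : continuous D := cont_sect_dbump.
have cG : continuous G := cS.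
pose f t := D t ^+ 2 + 2 * Num.max (G t) 0 - 9 * G t ^+ 2.
have cf : continuous f by rewrite /f; cont.
have bump_ge0 t : 0 <= bump t by rewrite /bump divr_ge0// subr_ge0 cos_le1.
have fE t : f t = sect t * k t.
  rewrite /f /D /G; have -> : Num.max (sect t * bump t) 0 = sect t * bump t.
    by apply/max_idPl; have [->|->] := sect01 t; rewrite ?mul0r ?mul1r.
  have := cos2Dsin2 (3 * (t - t1)); rewrite /bump /dbump /k.
  move: (cos _) (sin _) => c s cs.
  have {cs} sE : s ^+ 2 = 1 - c ^+ 2 by lra.
  have [->|->] := sect01 t; first ring.
  have -> : (1 * (s / 3)) ^+ 2 + 2 * (1 * ((1 - c) / 9)) - 9 * (1 * ((1 - c) / 9)) ^+ 2 =
    (s ^+ 2 + (1 - c ^+ 2)) / 9 by field.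
  by rewrite sE; field.
have [K dK] := primitive_exists cf.
have per t : f (t + 2 * pi) = f t.
  have w2 : wind (t + 2 * pi) = wind t.
    have := windP t; rewrite {1 2}/wind => wt.
    rewrite (@wind_eq _ (turn t + 1)) ?intrD; first by rewrite /wind; ring.
    by move: wt; lra.
  rewrite !fE /k /sect w2; congr (_ * (_ * _ ^+ 2)).
  have -> : 3 * (t + 2 * pi - t1) = 3 * (t - t1) + 2 * pi * 3%:Z%:~R by ring.
  exact: sin_periodZ.
rewrite (integral_derive _ cf dK); last by have := p0; lra.
(* By periodicity the turn may start at [t1], so that a sector crossing the half-line of angle 0 is
   no special case. *)
rewrite -(primitive_periodic t1 dK per).
have a1 : K (t1 + 2 * pi) = K (t1 + 2 * pi / 3).
  apply/eqP; rewrite -subr_eq0 -(integral_derive _ cf dK); last by have := p0; lra.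
  rewrite (@cint_eq _ _ _ _ (fun=> 0)); first by rewrite cint_cst ?mul0r//; have := p0; lra.
  move=> t /andP[l1 l2]; rewrite fE.
  suff -> : sect t = 0 by rewrite mul0r.
  rewrite /sect; move: l2; rewrite le_eqVlt => /predU1P[->|l2].
    by rewrite (@wind_eq _ 1) ?mulr1 ?addrK ?ltxx//; have := p0; lra.
  rewrite (@wind_eq _ 0) ?mulr0 ?subr0; last by have := p0; lra.
  by rewrite [t < _]ltNge l1 andbF.
have a2 : K (t1 + 2 * pi / 3) - K t1 = 2 * pi / 27.
  rewrite -(integral_derive _ cf dK); last by have := p0; lra.
  rewrite (@cint_eq _ _ _ _ k); last first.
    move=> t /andP[l1 l2]; rewrite fE; move: l1; rewrite le_eqVlt => /predU1P[<-|l1].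
      by rewrite /k subrr mulr0 sin0 expr0n/= !mulr0.
    move: l2; rewrite le_eqVlt => /predU1P[->|l2].
      have e : 3 * (t1 + 2 * pi / 3 - t1) = 2 * pi by field.
      by rewrite /k e mulr_natl sin2pi expr0n/= !mulr0.
    rewrite /sect (@wind_eq _ 0) ?mulr0 ?subr0; last by have := p0; lra.
    by rewrite l1 l2 mul1r.
  have ck : continuous k by rewrite /k; cont.
  rewrite (@integral_derive _ (fun t => 9^-1 * (t -
    sin (3 * (t - t1)) * cos (3 * (t - t1)) / 3))) //.
  - have e : 3 * (t1 + 2 * pi / 3 - t1) = 2 * pi by field.
    by rewrite e mulr_natl sin2pi subrr mulr0 sin0 !mul0r; field.
  - by have := p0; lra.
  - move=> t; rewrite /k; der; have := cos2Dsin2 (3 * (t - t1)).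
    move: (cos _) (sin _) => c s cs; have {cs} sE : s ^+ 2 = 1 - c ^+ 2 by lra.
    transitivity (9^-1 * (1 - c ^+ 2 + s ^+ 2)); first by field.
    by rewrite sE; field.
by rewrite a1 a2; field.
Qed.

End sector.

Lemma sector_weiss {R : realType} (h : R * R -> R) : sector_solutions h ->
  weissM_C1 h = pi / 81.
Proof. by move=> [t1 _ hE]; exact: sector_weissM hE. Qed.

(** * Monotonicity of the Weiss energy *)

Section weiss_derivative.
Context {R : realType}.
Implicit Types (F f u v psi w : R * R -> R) (r s rho : R).

Lemma der_ball_int F r : 0 < r < 1 -> continuous F ->
  deriv_at (fun s => ball_int s F) r (circ_int r F).
Proof.
move=> r01 cF; have cc := circ_cont cF.
have [K dK] := primitive_exists cc.
have near_r : \near r, K r - K 0 = ball_int r F.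
  near=> s.
  have s01 : 0 < s < 1.
    apply/andP; split; near: s; [exact: lt_nbhsr (andP r01).1|exact: lt_nbhsl (andP r01).2].
  rewrite polar; [|by lra|exact: cF].
  by rewrite (integral_derive _ cc dK)//; lra.
apply: (near_eq_is_derive near_r).
by have := derB (dK r) (der_cst r (K 0)) => /deriv_at_eq; apply; rewrite subr0.
Unshelve. all: end_near. Qed.

Definition tangential v r t : R :=
  cos t * partial true v (r * cos t, r * sin t) -
  sin t * partial false v (r * cos t, r * sin t).

Definition circle_norm2 v r : R := cint 0 (2 * pi) (fun t => v (r * cos t, r * sin t) ^+ 2).

(** [circle_norm2] integrates over the angle and not over arc length, hence the common power
    [r ^- 6] where [Phi] has [r ^- 7] in front of the circle integral. *)
Definition weiss v r : R := r ^- 6 * (ball_int r (dens v) - 3 * circle_norm2 v r).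

(* The value of M at the 3-homogeneous extension of [v] from the circle of radius
   [r]. *)
Definition homog_energy v r : R := 6^-1 * cint 0 (2 * pi) (fun t =>
  (tangential v r t / r ^+ 2) ^+ 2 + 2 * (v (r * cos t, r * sin t) / r ^+ 3) -
  9 * (v (r * cos t, r * sin t) / r ^+ 3) ^+ 2).

(* The deviation from Euler's identity for 3-homogeneous functions. *)
Definition defect v r : R := cint 0 (2 * pi) (fun t =>
  (radial v r t / r ^+ 2 - 3 * (v (r * cos t, r * sin t) / r ^+ 3)) ^+ 2).

Lemma tangential_cont v r : C1 v -> continuous (tangential v r).
Proof. by move=> [_ c1 c2]; rewrite /tangential; cont. Qed.

Lemma der_radial v r t : C1 v ->
  deriv_at (fun s => v (s * cos t, s * sin t)) r (radial v r t).
Proof.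
move=> [dv _ _].
have d := @der_path _ v (fun s => s * cos t) (fun s => s * sin t) r _ _ (dv _)
  (derM (der_id r) (der_cst r (cos t))) (derM (der_id r) (der_cst r (sin t))).
by apply: (deriv_at_eq d); rewrite /radial; gen_partial; ring.
Qed.

Lemma der_tangential v r t : C1 v ->
  deriv_at (fun t => v (r * cos t, r * sin t)) t (r * tangential v r t).
Proof.
move=> [dv _ _].
have d := @der_path _ v (fun t => r * cos t) (fun t => r * sin t) t _ _ (dv _)
  (derM (der_cst t r) (der_cos (der_id t))) (derM (der_cst t r) (der_sin (der_id t))).
by apply: (deriv_at_eq d); rewrite /tangential; gen_partial; ring.
Qed.

Lemma radial_cont2 v : C1 v -> continuous (fun z : R * R => radial v z.1 z.2).
Proof. by move=> [_ c1 c2]; rewrite /radial; cont. Qed.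

Lemma der_circle_norm2 v r : C1 v -> deriv_at (circle_norm2 v) r
  (2 * cint 0 (2 * pi) (fun t => v (r * cos t, r * sin t) * radial v r t)).
Proof.
move=> Cv; have cv := C1_continuous Cv; have cr2 := radial_cont2 Cv.
have cr := radial_cont (r := r) Cv.
pose K (z : R * R) := v (z.1 * cos z.2, z.1 * sin z.2) ^+ 2.
pose K' (z : R * R) := 2 * (v (z.1 * cos z.2, z.1 * sin z.2) * radial v z.1 z.2).
have cK : continuous K by rewrite /K; cont.
have cK' : continuous K'.
  rewrite /K' => z; apply: contM; first exact: cont_cst.
  by apply: contM; [move: z; cont|exact: cr2].
have dK s t : deriv_at (fun s => K (s, t)) s (K' (s, t)).
  have := derX 1 (der_radial s t Cv) => /deriv_at_eq; apply.
  by rewrite /K' /= expr1; move: (v _) (radial _ _ _) => *; ring.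
apply: (deriv_at_eq (der_param 0 (2 * pi) cK cK' dK r)).
by rewrite -cintZ//; cont.
Qed.

Lemma dens_polar v r t : 0 < r -> 0 <= v (r * cos t, r * sin t) ->
  dens v (r * cos t, r * sin t) = radial v r t ^+ 2 + tangential v r t ^+ 2 +
    2 * r * v (r * cos t, r * sin t).
Proof.
move=> r0 v0; rewrite /dens /gdot enorm_circ ?ltW//.
have -> : Num.max (v (r * cos t, r * sin t)) 0 = v (r * cos t, r * sin t) by apply/max_idPl.
rewrite /radial /tangential; have := cos2Dsin2 t.
move: (partial false v _) => a; move: (partial true v _) => b.
move: (v _) => x; move: (cos t) (sin t) => c s cs.
congr (_ + _); transitivity ((c ^+ 2 + s ^+ 2) * (a ^+ 2 + b ^+ 2)); last by ring.
by rewrite cs mul1r -!expr2.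
Qed.

(** The radial part of the energy density on the circle and the derivative of the boundary term
    complete to the square in [defect]; the tangential part and the volume term give [homog_energy].
    The terms in 9 v^2 cancel between the two. *)
Lemma der_weiss v rho r : local_solution v rho -> 0 < r < rho ->
  deriv_at (weiss v) r (6 / r * (homog_energy v r - weiss v r) + defect v r / r).
Proof.
move=> [rho01 Cv v0 _] rr; have r0 : 0 < r by case/andP: rr.
have rn0 : r != 0 by rewrite gt_eqF.
have r01 : 0 < r < 1 by move: rr rho01; lra.
have cv := C1_continuous Cv; have cr := radial_cont (r := r) Cv.
have ct := tangential_cont (r := r) Cv.
pose a := cint 0 (2 * pi) (fun t => radial v r t ^+ 2).
pose b := cint 0 (2 * pi) (fun t => tangential v r t ^+ 2).
pose m := cint 0 (2 * pi) (fun t => v (r * cos t, r * sin t)).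
pose q := cint 0 (2 * pi) (fun t => v (r * cos t, r * sin t) * radial v r t).
have dB := der_ball_int r01 (dens_cont Cv).
have dN := der_circle_norm2 r Cv.
have dV : deriv_at (fun s => s ^- 6) r (- (6 * r ^+ 5 * 1) / (r ^+ 6) ^+ 2).
  by apply: derV; [rewrite expf_neq0|exact: derX (der_id r)].
have d := derM dV (derB dB (derM (der_cst r 3) dN)).
apply: (deriv_at_eq d).
have -> : circ_int r (dens v) = r * (a + b + 2 * r * m).
  rewrite /circ_int; congr (r * _).
  rewrite /a /b /m -cintZ; last by cont.
  rewrite -cintD; [|by cont|by cont].
  rewrite -cintD; [|by cont|by cont].
  apply: cint_eq => t _; rewrite dens_polar// v0// enorm_circ ?ltW//.
  by case/andP: rr.
have -> : homog_energy v r = 6^-1 * (r ^- 4 * b + 2 * r ^- 3 * m - 9 * r ^- 6 * circle_norm2 v r).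
  rewrite /homog_energy; congr (_ * _); rewrite /b /m /circle_norm2.
  rewrite -!cintZ; try by cont.
  rewrite -cintD; [|by cont|by cont].
  rewrite -cintB; [|by cont|by cont].
  apply: cint_eq => t _; move: (tangential _ _ _) (v _) => x y; by field.
have -> : defect v r = r ^- 4 * a - 6 * r ^- 5 * q + 9 * r ^- 6 * circle_norm2 v r.
  rewrite /defect /a /q /circle_norm2 -!cintZ; try by cont.
  rewrite -cintB; [|by cont|by cont].
  rewrite -cintD; [|by cont|by cont].
  apply: cint_eq => t _; move: (radial _ _ _) (v _) => x y; by field.
rewrite -/q /weiss.
move: (ball_int _ _) (circle_norm2 _ _) a b m q => *.
by field.
Qed.

End weiss_derivative.

Section homogeneous_competitor.
Context {R : realType}.
Implicit Types (F f u v psi w c : R * R -> R) (r s rho : R).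

Lemma local_solution_ge0 v rho r t : local_solution v rho -> 0 < r < rho ->
  0 <= v (r * cos t, r * sin t).
Proof.
by move=> [_ _ v0 _] /andP[r0 rr]; apply: v0; rewrite enorm_circ// ltW.
Qed.

Section competitor.
Variables (v : R * R -> R) (rho r : R) (c : R * R -> R).
Hypotheses (sv : local_solution v rho) (rr : 0 < r < rho)
  (cE : forall s t, 0 <= s ->
    c (s * cos t, s * sin t) = s ^+ 3 * (v (r * cos t, r * sin t) / r ^+ 3)).

Let r0 : 0 < r. Proof. by case/andP: rr. Qed.
Let Cv : C1 v. Proof. by case: sv. Qed.
Let G t := v (r * cos t, r * sin t) / r ^+ 3.
Let G' t := r * tangential v r t / r ^+ 3.

Let dG t : deriv_at G t (G' t).
Proof.
have := derM (der_tangential r t Cv) (der_cst t (r ^- 3)).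
by move=> /deriv_at_eq; apply; rewrite mulr0 addr0.
Qed.

Let cG' : continuous G'.
Proof. by have ct := tangential_cont (r := r) Cv; rewrite /G'; cont. Qed.

Lemma competitor_C1 : C1 c.
Proof. exact: (homog_C1 dG cG' cE). Qed.

Lemma competitor_energy : weissM_C1 c = homog_energy v r.
Proof.
rewrite (homog_weissM dG cG' cE) /homog_energy; congr (_ * _).
apply: cint_eq => t _; congr (_ + _ - _).
  by rewrite /G'; move: (tangential _ _ _) => x; field; rewrite gt_eqF.
congr (_ * _); apply/max_idPl; have v0 := local_solution_ge0 t sv rr.
by apply: divr_ge0; rewrite ?v0// exprn_ge0// ltW.
Qed.

Lemma competitor_circle : circ_int 1 (fun x => c x ^+ 2) = r ^- 6 * circle_norm2 v r.
Proof.
have cv := C1_continuous Cv.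
rewrite /circ_int /circle_norm2 mul1r -cintZ; last by cont.
apply: cint_eq => t _; rewrite cE ?ler01// expr1n mul1r.
by move: (v _) => x; field; rewrite gt_eqF.
Qed.

(** The homogeneous extension has the boundary values of the rescaled [v], so that the boundary term
    of [min_C1] vanishes. *)
Lemma weiss_le_homog : weiss v r <= homog_energy v r.
Proof.
rewrite -competitor_energy /weissM_C1 /weissM competitor_circle /weiss mulrBr mulrCA.
rewrite lerD2r.
have -> : ball_int 1 (fun x => enorm (grad c x) ^+ 2 + 2 * enorm x * Num.max (c x) 0) =
    ball_int 1 (dens c).
  by apply: ball_int_eq => x _; rewrite /dens /gdot sqr_enorm /grad /= !expr2.
have := min_C1 sv rr competitor_C1.
rewrite (@cint_eq _ _ _ _ (fun=> 0)).
  by rewrite cint_cst ?mul0r ?mulr0 ?subr0//; have := @pi_ge0 R; lra.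
move=> t _; have := cE t ler01; rewrite !mul1r expr1n mul1r => ->.
by rewrite subrr mul0r.
Qed.

(** The competitor has trace [c], so that its circle term is that of [v]; the volume terms are
    compared by [min_trace]. *)
Lemma weiss_le_epi kappa : epiperimetric kappa c ->
  weiss v r <= (1 - kappa) * homog_energy v r + kappa * (pi / 81).
Proof.
move=> [w [dw [W12w tr [h /sector_weiss hE]]]].
rewrite competitor_energy hE => le_epi; apply: le_trans le_epi => {hE}.
rewrite /weissM competitor_circle /weiss mulrBr mulrCA lerD2r.
apply: min_trace sv rr W12w tr _ => t.
by have := cE t ler01; rewrite !mul1r expr1n mul1r.
Qed.

End competitor.

Lemma hom_ext_polar u v rho r s t : (forall x, enorm x < rho -> v x = u x) ->
  0 < r < rho -> 0 <= s ->
  hom_ext u r (s * cos t, s * sin t) = s ^+ 3 * (v (r * cos t, r * sin t) / r ^+ 3).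
Proof.
move=> vu /andP[r0 rr]; rewrite le_eqVlt => /predU1P[<-|s0].
  by rewrite /hom_ext enorm_circ// expr0n/= !mul0r.
rewrite /hom_ext enorm_circ ?ltW//= /rescale /= !(mulrC s) !mulfK ?gt_eqF//.
by rewrite vu// enorm_circ ?ltW.
Qed.

Lemma Phi_weiss u v rho r : (forall x, enorm x < rho -> v x = u x) -> 0 < r < rho ->
  Phi u r = weiss v r.
Proof.
move=> vu /andP[r0 rr]; rewrite /Phi /weiss mulrBr; congr (_ - _).
  congr (_ * _); apply: ball_int_eq => x xr.
  have xrho : enorm x < rho by exact: lt_trans rr.
  have pE i : partial i u x = partial i v x.
    apply: partial_near; have := near_enorm_lt xrho.
    by apply: filterS => y /vu.
  by rewrite /dens /gdot sqr_enorm /grad /= !pE vu// !expr2.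
have -> : circle_norm2 v r = cint 0 (2 * pi) (fun t => u (r * cos t, r * sin t) ^+ 2).
  by apply: cint_eq => t _; rewrite vu// enorm_circ ?ltW.
by rewrite /circ_int; move: (\int[_]_(_ in _) _) => I; field; rewrite gt_eqF.
Qed.

End homogeneous_competitor.

(** * Decay of the energy and of the rescalings *)

Section decay.
Context {R : realType}.
Implicit Types (F f u v psi w c : R * R -> R) (r s rho : R).

Lemma deriv_at_nondecreasing (F f : R -> R) a b : a <= b ->
  (forall x, a <= x <= b -> deriv_at F x (f x)) ->
  (forall x, a <= x <= b -> 0 <= f x) -> F a <= F b.
Proof.
rewrite le_eqVlt => /predU1P[<-//|ab] dF f0.
have [c /andP[ac cb] E] := deriv_at_mvt ab dF.
by rewrite -subr_ge0 E mulr_ge0 ?f0 ?subr_ge0 ?ltW//= ltW.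
Qed.

(** The power r^b of a positive [r], in a form that is differentiated by the chain rule. *)
Definition pw (b r : R) : R := expR (b * ln r).

Lemma pw_gt0 b r : 0 < pw b r. Proof. exact: expR_gt0. Qed.

Lemma der_pw b r : 0 < r -> deriv_at (pw b) r (b / r * pw b r).
Proof.
move=> r0; have d := der_exp (derM (der_cst r b) (der_ln r0 (der_id r))).
by apply: (deriv_at_eq d); rewrite /pw; move: (expR _) => z; field; rewrite gt_eqF.
Qed.

Variables (v : R * R -> R) (rho r0 beta E0 : R).
Hypotheses (sv : local_solution v rho) (r0rho : 0 < r0 < rho) (beta0 : 0 < beta)
  (lim0 : weiss v s @[s --> 0^'+] --> E0)
  (mono : forall r, 0 < r < rho -> weiss v r <= homog_energy v r)
  (epi : forall r, 0 < r <= r0 ->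
    beta * (weiss v r - E0) <= 6 * (homog_energy v r - weiss v r)).

Let e r := weiss v r - E0.
Let e' r := 6 / r * (homog_energy v r - weiss v r) + defect v r / r.

Let de r : 0 < r < rho -> deriv_at e r (e' r).
Proof.
move=> rr; have := derB (der_weiss sv rr) (der_cst r E0).
by move=> /deriv_at_eq; apply; rewrite subr0.
Qed.

Lemma defect_ge0 r : 0 <= defect v r.
Proof. by apply: cint_ge0 => t _; exact: sqr_ge0. Qed.

Let e'_ge0 r : 0 < r < rho -> 0 <= e' r.
Proof.
move=> rr; have rp : 0 < r by case/andP: rr.
apply: addr_ge0; last by rewrite divr_ge0 ?defect_ge0// ltW.
by apply: mulr_ge0; [rewrite divr_ge0// ltW|rewrite subr_ge0 mono].
Qed.

Let e'_epi r : 0 < r <= r0 -> (beta * e r + defect v r) / r <= e' r.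
Proof.
move=> rr; have rp : 0 < r by case/andP: rr.
rewrite /e' mulrDl lerD2r [leRHS]mulrAC ler_wpM2r ?invr_ge0 ?(ltW rp)//.
exact: epi.
Qed.

Lemma weiss_nondecreasing s r : 0 < s <= r -> r < rho -> weiss v s <= weiss v r.
Proof.
move=> /andP[s0 sr] rr.
suff : e s <= e r by rewrite /e lerD2r.
apply: (@deriv_at_nondecreasing e e' _ _ sr) => x /andP[sx xr].
- by apply: de; rewrite (lt_le_trans s0 sx) (le_lt_trans xr rr).
- by apply: e'_ge0; rewrite (lt_le_trans s0 sx) (le_lt_trans xr rr).
Qed.

Lemma weiss_ge_lim r : 0 < r < rho -> E0 <= weiss v r.
Proof.
move=> /andP[rp rr]; rewrite leNgt; apply/negP => lt_.
have h := @cvgr_gt _ _ _ _ _ _ lim0 _ lt_.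
have h2 : \forall s \near 0^'+, 0 < s <= r.
  near=> s; apply/andP; split; first by near: s; exact: nbhs_right_gt.
  by apply: ltW; near: s; exact: nbhs_right_lt.
near (0 : R)^'+ => s.
have sr : 0 < s <= r by near: s; exact: h2.
have := weiss_nondecreasing sr rr.
rewrite leNgt => /negP; apply.
by near: s; exact: h.
Unshelve. all: end_near. Qed.

(** The differential inequality for the excess says that its product with [x^(- beta)] is
    nondecreasing. *)
Lemma excess_decay s r : 0 < s <= r -> r <= r0 ->
  weiss v s - E0 <= (weiss v r - E0) * (s / r) `^ beta.
Proof.
move=> /andP[sp sr] rr; have rp := lt_le_trans sp sr.
have : e s * pw (- beta) s <= e r * pw (- beta) r.
  apply: (@deriv_at_nondecreasing (fun x => e x * pw (- beta) x)
    (fun x => e' x * pw (- beta) x + e x * (- beta / x * pw (- beta) x))) => //.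
    move=> x /andP[sx xr]; have xp := lt_le_trans sp sx.
    apply: derM; last exact: der_pw.
    apply: de; rewrite xp/=; exact: le_lt_trans (le_trans xr rr) (andP r0rho).2.
  move=> x /andP[sx xr]; have xp := lt_le_trans sp sx.
  rewrite mulrA -mulrDl mulr_ge0 ?(ltW (pw_gt0 _ _))//.
  have xr0 : 0 < x <= r0 by rewrite xp (le_trans xr rr).
  have h := e'_epi xr0.
  have hd : 0 <= defect v x / x by rewrite divr_ge0 ?defect_ge0 ?ltW.
  by move: h; rewrite mulrDl mulNr mulrN -[beta * _ / _]mulrAC [beta / x * _]mulrC; lra.
have n0 : s / r != 0 by rewrite mulf_neq0 ?invr_neq0 ?gt_eqF.
rewrite /powR (negbTE n0) ln_div ?posrE// mulrBr expRD.
rewrite /pw !mulNr !expRN -/(e s) -/(e r) => h.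
by move: h; rewrite ler_pdivrMr ?expR_gt0// mulrA [X in _ -> _ <= X]mulrAC.
Qed.

Definition circ_rescale r t : R := v (r * cos t, r * sin t) / r ^+ 3.

Lemma circ_rescale_cont r : continuous (circ_rescale r).
Proof.
have cv : continuous v by apply: C1_continuous; case: sv.
by rewrite /circ_rescale; cont.
Qed.

(* With [f] the difference of the two rescalings and [N] its squared norm, the
   derivative of the pairing [W] of the rescalings with [f] is at most
   [sqrt (defect * N) / x], which by AM-GM and the differential inequality for the
   excess is at most the derivative of [sqrt (N / beta) * sqrt q]. The term
   [d * pw beta] in [q] keeps the square root differentiable. *)
Lemma circ_rescale_L2 s r : 0 < s < r -> r <= r0 ->
  beta * cint 0 (2 * pi) (fun t => (circ_rescale r t - circ_rescale s t) ^+ 2) <= weiss v r - E0.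
Proof.
move=> /andP[sp sr] rr; have rp := lt_trans sp sr.
have Cv : C1 v by case: sv.
have cv := C1_continuous Cv.
pose f t := circ_rescale r t - circ_rescale s t.
have cr1 := @circ_rescale_cont r; have cr2 := @circ_rescale_cont s.
have cf : continuous f by rewrite /f; cont.
pose N := cint 0 (2 * pi) (fun t => f t ^+ 2).
change (beta * N <= weiss v r - E0).
have N0 : 0 <= N by apply: cint_ge0 => t _; exact: sqr_ge0.
have [e0|NN] : N = 0 \/ 0 < N.
  by move: N0; rewrite le_eqVlt => /predU1P[<-|]; [left|right].
  by rewrite e0 mulr0 subr_ge0 weiss_ge_lim// rp (le_lt_trans rr (andP r0rho).2).
pose V x := cint 0 (2 * pi) (fun t => v (x * cos t, x * sin t) * f t).
pose V' x := cint 0 (2 * pi) (fun t => radial v x t * f t).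
have dV x : deriv_at V x (V' x).
  apply: (@der_param _ (fun z => v (z.1 * cos z.2, z.1 * sin z.2) * f z.2)
    (fun z => radial v z.1 z.2 * f z.2)).
  - by cont.
  - have cr := radial_cont2 Cv.
    by move=> z; apply: contM; [exact: cr|move: z; cont].
  - move=> y t /=; have := derM (der_radial y t Cv) (der_cst y (f t)).
    by move=> /deriv_at_eq; apply; rewrite mulr0 addr0.
pose W x := x ^- 3 * V x.
pose W' x := x ^- 3 * V' x - 3 * x ^- 4 * V x.
have dW x : 0 < x -> deriv_at W x (W' x).
  move=> x0; have xn0 : x != 0 by rewrite gt_eqF.
  have d3 : deriv_at (fun s => s ^- 3) x (- (3 * x ^+ 2 * 1) / (x ^+ 3) ^+ 2).
    by apply: derV; [rewrite expf_neq0|exact: derX (der_id x)].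
  apply: (deriv_at_eq (derM d3 (dV x))).
  by rewrite /W'; move: (V _) (V' _) => *; field.
have W'E x : 0 < x -> W' x = x^-1 * cint 0 (2 * pi) (fun t =>
    (radial v x t / x ^+ 2 - 3 * (v (x * cos t, x * sin t) / x ^+ 3)) * f t).
  move=> x0; have cr := radial_cont (r := x) Cv.
  rewrite /W' /V' /V -!cintZ; try by cont.
  rewrite -cintB; try by cont.
  by apply: cint_eq => t _; move: (radial _ _ _) (v _) (f t) => *; field; rewrite gt_eqF.
have W'CS x : 0 < x -> (x * W' x) ^+ 2 <= defect v x * N.
  move=> x0; have cr := radial_cont (r := x) Cv.
  rewrite W'E// mulVKf ?gt_eqF//; apply: cint_CS => //.
  by cont.
have WN : W r - W s = N.
  rewrite /W /V -!cintZ; try by cont.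
  rewrite -cintB; try by cont.
  apply: cint_eq => t _; rewrite expr2 {3}/f /circ_rescale; move: (v _) (v _) (f t) => a b c.
  by field; rewrite !gt_eqF.
pose k := Num.sqrt (N / beta).
have k0 : 0 < k by rewrite sqrtr_gt0 divr_gt0.
have k2 : k ^+ 2 = N / beta by rewrite sqr_sqrtr// divr_ge0// ltW.
(* The regularising term can be made as small as desired, here by dividing [d] by the power at
   [r]. *)
suff key d : 0 < d -> beta * N <= e r + d * pw beta r.
  rewrite -/(e r); apply/ler_addgt0Pr => d d0.
  have := key (d / pw beta r) (divr_gt0 d0 (pw_gt0 _ _)).
  by rewrite divfK// gt_eqF// pw_gt0.
move=> d0.
pose q x := e x + d * pw beta x.
pose q' x := e' x + d * (beta / x * pw beta x).
have inr x : s <= x <= r -> 0 < x <= r0 /\ 0 < x < rho.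
  move=> /andP[sx xr]; rewrite (lt_le_trans sp sx) (le_trans xr rr)/=.
  by rewrite (le_lt_trans (le_trans xr rr) (andP r0rho).2).
have q0 x : 0 < x < rho -> 0 < q x.
  move=> xr; rewrite /q ltr_wpDl ?mulr_gt0 ?pw_gt0//.
  by rewrite /e subr_ge0 weiss_ge_lim.
have dq x : 0 < x < rho -> deriv_at q x (q' x).
  move=> xr; apply: derD; first exact: de.
  have := derM (der_cst x d) (der_pw beta (andP xr).1).
  by move=> /deriv_at_eq; apply; rewrite mul0r add0r.
have q'_ge x : 0 < x <= r0 -> beta * q x + defect v x <= x * q' x.
  move=> xr; have xp := (andP xr).1; have := e'_epi xr.
  rewrite ler_pdivrMr// => h; rewrite /q /q' [X in _ <= X]mulrDr [X in _ <= X + _]mulrC.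
  have -> : x * (d * (beta / x * pw beta x)) = beta * (d * pw beta x).
    by field; rewrite gt_eqF.
  by move: h; lra.
have h : k * Num.sqrt (q s) - W s <= k * Num.sqrt (q r) - W r.
  apply: (@deriv_at_nondecreasing (fun x => k * Num.sqrt (q x) - W x)
    (fun x => k * (q' x / (2 * Num.sqrt (q x))) - W' x)); first exact: ltW.
    move=> x /inr[xr0 xrho]; apply: derB; last by apply: dW; case/andP: xrho.
    have := derM (der_cst x k) (der_sqrt (q0 x xrho) (dq x xrho)).
    by move=> /deriv_at_eq; apply; rewrite mul0r add0r.
  move=> x /inr[xr0 xrho]; have xp := (andP xrho).1.
  have h1 := q'_ge x xr0; have h2 := W'CS x xp.
  have z0 : 0 < Num.sqrt (q x) by rewrite sqrtr_gt0 q0.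
  have zE : q x = Num.sqrt (q x) ^+ 2 by rewrite sqr_sqrtr// ltW// q0.
  move: h1 h2 z0; rewrite [in X in X -> _]zE; move: (Num.sqrt _) => z.
  have A0 := defect_ge0 x.
  have -> : N = k ^+ 2 * beta by rewrite k2 divfK// gt_eqF.
  move: (defect v x) A0 (q' x) (W' x) => A A0 y w h1 h2 z0.
  rewrite subr_ge0 -(ler_pM2l xp).
  have -> : x * (k * (y / (2 * z))) = k * (x * y) / (2 * z) by field; rewrite gt_eqF.
  rewrite ler_pdivlMr ?mulr_gt0//.
  apply: (@le_trans _ _ (k * (beta * z ^+ 2 + A))); last by rewrite ler_pM2l.
  apply: ler_normlW.
  rewrite -ler_sqr ?nnegrE ?normr_ge0//; last first.
    by rewrite mulr_ge0 ?(ltW k0)// addr_ge0// mulr_ge0 ?sqr_ge0 ?ltW.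
  rewrite real_normK ?num_real// exprMn.
  apply: (@le_trans _ _ (A * (k ^+ 2 * beta) * (2 * z) ^+ 2)).
    by rewrite ler_wpM2r// sqr_ge0.
  rewrite -subr_ge0.
  have -> : (k * (beta * z ^+ 2 + A)) ^+ 2 - A * (k ^+ 2 * beta) * (2 * z) ^+ 2 =
    (k * (beta * z ^+ 2 - A)) ^+ 2 by ring.
  exact: sqr_ge0.
have h3 : N <= k * Num.sqrt (q r).
  have : 0 <= k * Num.sqrt (q s) by rewrite mulr_ge0 ?sqrtr_ge0 ?ltW.
  by move: h WN; lra.
have rrho : 0 < r < rho by rewrite rp (le_lt_trans rr (andP r0rho).2).
(* As [k ^+ 2 = N / beta], squaring and dividing by [N] leaves [beta * N <= q r]. *)
have : N ^+ 2 <= (k * Num.sqrt (q r)) ^+ 2.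
  by rewrite ler_sqr ?nnegrE// mulr_ge0 ?sqrtr_ge0 ?ltW.
rewrite exprMn k2 sqr_sqrtr; last by rewrite ltW// q0.
rewrite expr2 -mulrA ler_pM2l// -(ler_pM2l beta0) mulrA divff ?gt_eqF// mul1r.
by [].
Qed.

End decay.

(** * A bound on the energy independent of the solution *)

Section energy_bound.
Context {R : realType}.
Implicit Types (r s t : R).
Variables (v : R * R -> R) (rho : R).
Hypotheses (sv : local_solution v rho) (v00 : v (0, 0) = 0).

Let Cv : C1 v. Proof. by case: sv. Qed.
Let cv : continuous v. Proof. exact: C1_continuous. Qed.
Let rho01 : 0 < rho < 1. Proof. by case: sv. Qed.
Let p0 : 0 < pi :> R := pi_gt0 R.
Let p4 : pi < 4 :> R. Proof. by have := pihalf_lt2 R; lra. Qed.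

Let m r : R := cint 0 (2 * pi) (fun t => v (r * cos t, r * sin t)).
Let a r : R := cint 0 (2 * pi) (fun t => radial v r t ^+ 2).
Let b r : R := cint 0 (2 * pi) (fun t => tangential v r t ^+ 2).
Let L r : R := cint 0 (2 * pi) (fun t => `|r * tangential v r t|).
Let q r : R := cint 0 (2 * pi) (fun t => v (r * cos t, r * sin t) * radial v r t).
Let G r : R := ball_int r (gdot v v).

Let U_ge0 r t : 0 < r < rho -> 0 <= v (r * cos t, r * sin t).
Proof. exact: local_solution_ge0. Qed.

Lemma circle_mean r : 0 < r < rho -> 0 <= m r <= pi.
Proof.
move=> rr; have rp := (andP rr).1; apply/andP; split.
  by apply: cint_ge0 => t _; exact: U_ge0.
pose m' x := cint 0 (2 * pi) (fun t => radial v x t).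
have dm x : deriv_at m x (m' x).
  apply: (@der_param _ (fun z => v (z.1 * cos z.2, z.1 * sin z.2))
    (fun z => radial v z.1 z.2)); [by cont|exact: radial_cont2|].
  by move=> y t; exact: der_radial.
have [x /andP[x0 xr]] := deriv_at_mvt rp (fun x _ => dm x).
have -> : m 0 = 0.
  rewrite /m (@cint_eq _ _ _ _ (fun=> 0)) ?cint_cst ?mul0r//; last first.
    by move=> t _; rewrite !mul0r v00.
  by rewrite mulr_ge0// ltW.
rewrite !subr0 => ->.
have xr1 : 0 < x <= 1 by move: rr rho01; lra.
have [_ _ _ gr] := sv.
have := gr (fun=> 1) x (C1_cst 1) (introT andP (conj x0 (lt_trans xr (andP rr).2))).
have -> : flux v (fun=> 1) x = x * m' x.
  by rewrite fluxE; congr (_ * _); apply: cint_eq => t _; rewrite mul1r.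
move=> xm.
have : x * m' x <= pi * x ^+ 2.
  rewrite -xm -disc_area//; apply: ball_int_le.
  - by case/andP: xr1.
  - apply: bmeasD; first by apply: bmeas_cont; apply: gdot_cont => //; exact: C1_cst.
    by apply: bmeasM; [exact: bmeas_ssupp|exact: bmeas_cst].
  - exact: bmeas_cst.
  - move=> y yx; rewrite /gdot !partial_cst !mulr0 !add0r mulr1 /ssupp.
    have y1 : enorm y <= 1 by apply: ltW; apply: lt_le_trans yx _; case/andP: xr1.
    apply: (le_trans _ y1); rewrite indicE.
    by case: (_ \in _); rewrite ?mulr1// mulr0 enorm_ge0.
rewrite expr2 mulrCA ler_pM2l// => mx.
apply: (@le_trans _ _ (pi * x * r)); first by rewrite ler_pM2r.
rewrite -mulrA; apply: ler_piMr; first exact: ltW.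
by apply: mulr_ile1; move: rr rho01; lra.
Qed.

(** Since [m r <= pi < 2 pi], [v] is at most 1 somewhere on the circle; from there it can grow by at
    most its total variation [L r]. *)
Lemma circle_sup r t : 0 < r < rho -> 0 <= t <= 2 * pi ->
  v (r * cos t, r * sin t) <= 1 + L r.
Proof.
move=> rr t2; have /andP[_ mr] := circle_mean rr.
have ct := tangential_cont (r := r) Cv.
pose U t := v (r * cos t, r * sin t).
have cU : continuous U by rewrite /U; cont.
have [t0 t02 U1] : exists2 t0, 0 <= t0 <= 2 * pi & U t0 <= 1.
  apply/not_exists2P => h.
  have : 1 * (2 * pi - 0) <= m r.
    rewrite -cint_cst; last by rewrite mulr_ge0// ltW.
    apply: cint_le; [by cont|exact: cU|] => x x2.
    by have [//|/negP] := h x; rewrite -ltNge => /ltW.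
  by move: mr p0; lra.
have cL : continuous (fun t => `|r * tangential v r t|) by cont.
have [P dP] := primitive_exists cL.
have PL : L r = P (2 * pi) - P 0.
  by rewrite /L (integral_derive _ cL dP)// mulr_ge0// ltW.
have dU x : deriv_at U x (r * tangential v r x) by exact: der_tangential.
have mP x y : x <= y -> P x <= P y.
  by move=> xy; apply: (deriv_at_nondecreasing xy (fun z _ => dP z)) => z _; exact: normr_ge0.
have m1 x y : x <= y -> U x + P x <= U y + P y.
  move=> xy; apply: (deriv_at_nondecreasing (F := fun x => U x + P x) xy (fun z _ => derD (dU z) (dP z))).
  by move=> z _ /=; rewrite -lerBlDl sub0r -normrN ler_norm.
have m2 x y : x <= y -> P x - U x <= P y - U y.
  move=> xy; apply: (deriv_at_nondecreasing (F := fun x => P x - U x) xy (fun z _ => derB (dP z) (dU z))).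
  by move=> z _ /=; rewrite subr_ge0 ler_norm.
rewrite -/(U t) PL.
have h1 : P 0 <= P t by apply: mP; lra.
have h2 : P t <= P (2 * pi) by apply: mP; lra.
have h3 : P 0 <= P t0 by apply: mP; lra.
have h4 : P t0 <= P (2 * pi) by apply: mP; lra.
have [/m1|/ltW/m2] := leP t t0; lra.
Qed.

(** Green's formula with [v] itself as test function bounds [G] by [r q], the source term being
    nonnegative. By Cauchy-Schwarz and v^2 <= (1 + L) v the circle integral of [v] comes in, which
    is less than 4. *)
Lemma dirichlet_sqr r : 0 < r < rho -> G r ^+ 2 <= 4 * (1 + L r) * a r.
Proof.
move=> rr; have rp := (andP rr).1.
have r1 : r <= 1 by move: rr rho01; lra.
have cr := radial_cont (r := r) Cv.
have L0 : 0 <= L r by apply: cint_ge0 => t _; exact: normr_ge0.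
have a0 : 0 <= a r by apply: cint_ge0 => t _; exact: sqr_ge0.
have G0 : 0 <= G r.
  apply: Rintegral_ge0.
  by move=> x _; rewrite /gdot; gen_partial; rewrite addr_ge0// -expr2 sqr_ge0.
have Gq : G r <= r * q r.
  have [_ _ v0 gr] := sv; have := gr v r Cv rr.
  have -> : flux v v r = r * q r by rewrite fluxE.
  move=> <-; apply: ball_int_le => //.
  - by apply: bmeas_cont; exact: gdot_cont.
  - apply: bmeasD; first by apply: bmeas_cont; exact: gdot_cont.
    by apply: bmeasM; [exact: bmeas_ssupp|exact: bmeas_cont].
  - move=> y yr; rewrite lerDl mulr_ge0//; last by apply: v0; apply: lt_trans yr _; case/andP: rr.
    by rewrite /ssupp mulr_ge0 ?enorm_ge0.
have U2 : cint 0 (2 * pi) (fun t => v (r * cos t, r * sin t) ^+ 2) <= (1 + L r) * m r.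
  rewrite -cintZ; last by cont.
  apply: cint_le; [by cont|by cont|] => t t2.
  by rewrite expr2 ler_wpM2r ?U_ge0// circle_sup.
have qCS : q r ^+ 2 <= (1 + L r) * m r * a r.
  apply: (le_trans (cint_CS 0 (2 * pi) _ _)); [by cont|exact: cr|].
  by apply: ler_wpM2r.
have q0 : 0 <= q r by have := le_trans G0 Gq; rewrite pmulr_rge0.
apply: (@le_trans _ _ (q r ^+ 2)).
  rewrite ler_sqr ?nnegrE//; apply: (le_trans Gq); exact: ler_piMl.
apply: (le_trans qCS); rewrite ler_wpM2r// mulrC ler_wpM2r ?addr_ge0//.
by have /andP[_] := circle_mean rr; move: p4; lra.
Qed.

(** Cauchy-Schwarz on the circle, with [2 pi < 8] and [r <= 1]. *)
Lemma variation_sqr r : 0 < r < rho -> L r ^+ 2 <= 8 * b r.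
Proof.
move=> rr; have rp := (andP rr).1.
have r1 : r <= 1 by move: rr rho01; lra.
have ct := tangential_cont (r := r) Cv.
have b0 : 0 <= b r by apply: cint_ge0 => t _; exact: sqr_ge0.
have := @cint_CS _ 0 (2 * pi) (fun t => `|r * tangential v r t|) (fun=> 1) ltac:(cont) ltac:(cont).
rewrite (@cint_eq _ _ _ (fun t => `|r * tangential v r t| * 1) (fun t => `|r * tangential v r t|)); last first.
  by move=> t _; rewrite mulr1.
move/le_trans; apply.
rewrite (@cint_eq _ _ _ (fun=> 1 ^+ 2) (fun=> 1)); last by move=> t _; rewrite expr1n.
rewrite cint_cst; last by rewrite mulr_ge0// ltW.
rewrite mul1r subr0.
rewrite (@cint_eq _ _ _ _ (fun t => r ^+ 2 * tangential v r t ^+ 2)); last first.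
  by move=> t _; rewrite real_normK ?num_real// exprMn.
rewrite cintZ; last by cont.
rewrite -/(b r) mulrAC ler_wpM2r//.
have : r ^+ 2 <= 1 by rewrite expr_le1// ltW.
have : 0 <= r ^+ 2 by exact: sqr_ge0.
move: p4 p0; move: (r ^+ 2) => z *; nra.
Qed.

Let E r := a r + b r.

Let dG r : 0 < r < rho -> deriv_at G r (r * E r).
Proof.
move=> rr; have r01 : 0 < r < 1 by move: rr rho01; lra.
have ct := tangential_cont (r := r) Cv; have cr := radial_cont (r := r) Cv.
apply: (deriv_at_eq (der_ball_int r01 (gdot_cont Cv Cv))).
rewrite /circ_int /E /a /b -cintD; [|by cont|by cont].
congr (_ * _); apply: cint_eq => t _; rewrite /gdot /radial /tangential.
have := cos2Dsin2 t.
move: (partial false v _) => x; move: (partial true v _) => y.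
move: (cos t) (sin t) => c s cs.
transitivity ((c ^+ 2 + s ^+ 2) * (x ^+ 2 + y ^+ 2)); last by ring.
by rewrite cs mul1r -!expr2.
Qed.

(* As [G' = r E], this is the differential inequality [G' >= c r G^(4/3)]; its
   solutions blow up in finite time, which bounds [G (r0 / 2)] independently of
   [v]. *)
Let E_ge r : 0 < r < rho -> 4 <= G r -> G r ^+ 4 <= 343 * E r ^+ 3.
Proof.
move=> rr G4; have h1 := dirichlet_sqr rr; have h2 := variation_sqr rr.
have L0 : 0 <= L r by apply: cint_ge0 => t _; exact: normr_ge0.
have a0 : 0 <= a r by apply: cint_ge0 => t _; exact: sqr_ge0.
have b0 : 0 <= b r by apply: cint_ge0 => t _; exact: sqr_ge0.
rewrite /E; move: G4 h1 h2 L0 a0 b0; move: (G r) (L r) (a r) (b r) => g l x y.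
move=> G4 h1 h2 L0 a0 b0.
have {}h1 : g ^+ 2 <= 4 * (1 + l) * (x + y) by nra.
have {}h2 : l ^+ 2 <= 8 * (x + y) by lra.
have : 0 <= x + y by lra.
move: (x + y) h1 h2 => e h1 h2 e0.
have g2 : 16 <= g ^+ 2 by nra.
(* This is the purpose of the threshold 4: for [e < 1] one would have [l <= 3] and hence
   [g ^+ 2 < 16]. *)
have e1 : 1 <= e.
  rewrite leNgt; apply/negP => e1.
  have l3 : l <= 3 by rewrite leNgt; apply/negP => l3; nra.
  nra.
have -> : g ^+ 4 = (g ^+ 2) ^+ 2 by ring.
apply: (@le_trans _ _ ((4 * (1 + l) * e) ^+ 2)).
  by rewrite ler_sqr ?nnegrE; nra.
(* As [1 <= e], this is at most [288 * e ^+ 3]; the constant is rounded up to 343, the cube of 7,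
   for the cube root taken in [dirichlet_bound]. *)
apply: (@le_trans _ _ (32 * (1 + 8 * e) * e ^+ 2)); last by nra.
have -> : (4 * (1 + l) * e) ^+ 2 = 16 * (1 + l) ^+ 2 * e ^+ 2 by ring.
rewrite ler_wpM2r ?sqr_ge0//; nra.
Qed.

Lemma dirichlet_bound r0 : 0 < r0 < rho -> G (r0 / 2) <= 4 + (84 / r0 ^+ 2) ^+ 3.
Proof.
move=> rr; have r0p := (andP rr).1.
have [h|h] := leP (G (r0 / 2)) 4; first by rewrite (le_trans h)// lerDl exprn_ge0// divr_ge0// sqr_ge0.
have E0 x : 0 <= E x by apply: addr_ge0; apply: cint_ge0 => t _; exact: sqr_ge0.
have inr x : r0 / 2 <= x <= r0 -> 0 < x < rho by move: rr; lra.
have Gx x : r0 / 2 <= x <= r0 -> 4 < G x.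
  move=> /[dup] /inr xr /andP[x1 x2]; apply: (lt_le_trans h).
  apply: (deriv_at_nondecreasing (F := G) (f := fun x => x * E x) x1).
    by move=> y yx; apply: dG; apply: inr; lra.
  by move=> y yx; apply: mulr_ge0 => //; lra.
(* [G^(-1/3)] linearises the differential inequality: its derivative at [x] is at most [- x / 21],
   hence at most [- r0 / 42] on [r0 / 2, r0]. Being positive at [r0], it is at least [r0^2 / 84] at
   [r0 / 2]. *)
pose y x := pw (- 3^-1) (G x).
have y3 x : r0 / 2 <= x <= r0 -> y x ^+ 3 = (G x)^-1.
  move=> /Gx g4; rewrite /y /pw -expRM_natl.
  have -> : 3 * (- 3^-1 * ln (G x)) = - ln (G x) by field.
  by rewrite expRN lnK// posrE; lra.
have y0 x : 0 < y x by exact: pw_gt0.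
pose y' x := - 3^-1 / G x * y x * (x * E x).
have dy x : r0 / 2 <= x <= r0 -> deriv_at y x (y' x).
  move=> xr; have g4 := Gx x xr; apply: der_comp; last by apply: dG; exact: inr.
  by apply: der_pw; lra.
have y'le x : r0 / 2 <= x <= r0 -> y' x <= - (r0 / 42).
  move=> xr; have g4 := Gx x xr; have h3 := y3 x xr; have yp := y0 x.
  have hE := E_ge (inr x xr) (ltW g4).
  have e1 : 1 / 7 <= y x ^+ 4 * E x.
    rewrite leNgt; apply/negP => e7.
    have yE : 0 <= y x ^+ 4 * E x by rewrite mulr_ge0// exprn_ge0// ltW.
    have : (y x ^+ 4 * E x) ^+ 3 < (1 / 7) ^+ 3 by rewrite ltr_pXn2r// ?nnegrE//; lra.
    have -> : (y x ^+ 4 * E x) ^+ 3 = (y x ^+ 3) ^+ 4 * E x ^+ 3 by ring.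
    rewrite h3 exprVn mulrC ltr_pdivrMr; last by rewrite exprn_gt0//; lra.
    by move: hE; lra.
  have -> : y' x = - (3^-1 * (y x ^+ 4 * E x) * x).
    rewrite /y' -[_ / G x]/(- 3^-1 * (G x)^-1) -h3; ring.
  rewrite lerN2; move: e1 xr; move: (y x ^+ 4 * E x) => z; nra.
have [c /andP[c1 c2]] := deriv_at_mvt (F := y) (f := y') (a := r0 / 2) (b := r0) ltac:(lra) dy.
have cr : r0 / 2 <= c <= r0 by rewrite !ltW.
have r20 : 0 <= r0 - r0 / 2 by case/andP: cr => h1 h2; rewrite subr_ge0 (le_trans h1 h2).
move=> Ey; have := ler_wpM2r r20 (y'le c cr); rewrite -Ey => w1.
have yr : r0 ^+ 2 / 84 <= y (r0 / 2).
  by move: (y0 r0) w1 {Ey}; move: (y r0) (y (r0 / 2)) => z1 z2; lra.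
have r2 : 0 < r0 ^+ 2 by rewrite exprn_gt0.
have r84 : 0 < r0 ^+ 2 / 84 by rewrite divr_gt0.
have h3 := y3 (r0 / 2) ltac:(rewrite lexx/= -subr_ge0; exact: r20).
have -> : G (r0 / 2) = (y (r0 / 2) ^+ 3)^-1 by rewrite h3 invrK.
apply: (@le_trans _ _ ((84 / r0 ^+ 2) ^+ 3)); last by rewrite lerDr.
have le_y : (y (r0 / 2))^-1 <= 84 / r0 ^+ 2 by rewrite -(invf_div (r0 ^+ 2)) lef_pV2 ?posrE.
have y_ge0 : 0 <= (y (r0 / 2))^-1 by rewrite invr_ge0 ltW.
by rewrite -exprVn lerXn2r ?nnegrE// (le_trans y_ge0 le_y).
Qed.

(** In polar coordinates the integral is made of circle integrals of [v], which [circle_mean] bounds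
    by pi; the constant comes from [2 pi < 8]. *)
Lemma volume_bound r : 0 < r < rho ->
  ball_int r (fun x => 2 * enorm x * Num.max (v x) 0) <= 8.
Proof.
move=> rr; have rp := (andP rr).1.
have r1 : 0 < r <= 1 by move: rr rho01; lra.
have cF : continuous (fun x => 2 * enorm x * Num.max (v x) 0) by cont.
rewrite polar//.
apply: (@le_trans _ _ (cint 0 r (fun=> 8))); last first.
  by rewrite cint_cst ?(ltW rp)// subr0; move: r1; lra.
apply: cint_le; [exact: circ_cont|by cont|] => s /andP[s0 sr].
rewrite /circ_int; move: s0; rewrite le_eqVlt => /predU1P[<-|s0]; first by rewrite mul0r.
have srho : 0 < s < rho by rewrite s0 (le_lt_trans sr)//; case/andP: rr.
rewrite (@cint_eq _ _ _ _ (fun t => 2 * s * v (s * cos t, s * sin t))); last first.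
  by move=> t _; rewrite enorm_circ ?ltW//; congr (_ * _); apply/max_idPl; exact: U_ge0.
rewrite cintZ; last by cont.
rewrite -/(m s); have /andP[m0 m1] := circle_mean srho.
have s1 : s < 1 by move: srho rho01; lra.
have -> : s * (2 * s * m s) = 2 * (s ^+ 2 * m s) by ring.
have : s ^+ 2 * m s <= m s by apply: ler_piMl => //; rewrite expr_le1// ltW.
by move: m1 p4; lra.
Qed.

Lemma weiss_bound r0 : 0 < r0 < rho ->
  weiss v (r0 / 2) <= (2 / r0) ^+ 6 * (12 + (84 / r0 ^+ 2) ^+ 3).
Proof.
move=> rr; have r0p := (andP rr).1.
have hr : 0 < r0 / 2 < rho by move: rr; lra.
have h1 := dirichlet_bound rr; have h2 := volume_bound hr.
have r1 : r0 / 2 <= 1 by move: hr rho01; lra.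
rewrite /weiss -exprVn invf_div; apply: ler_wpM2l; first by rewrite exprn_ge0// divr_ge0// ltW.
have N0 : 0 <= circle_norm2 v (r0 / 2) by apply: cint_ge0 => t _; exact: sqr_ge0.
have -> : ball_int (r0 / 2) (dens v) = G (r0 / 2) +
    ball_int (r0 / 2) (fun x => 2 * enorm x * Num.max (v x) 0).
  by apply: ball_intD => //; apply: bmeas_cont; [exact: gdot_cont|cont].
by move: h1 h2 N0; lra.
Qed.

End energy_bound.

(** * Uniqueness of the blowup limit *)

Section blowup.
Context {R : realType}.
Implicit Types (u v : R * R -> R) (g : R -> R) (r s t : R).

Lemma cint_eq0 (f : R -> R) (a b : R) : a < b -> continuous f ->
  (forall t, 0 <= f t) -> cint a b f <= 0 -> forall t, a <= t <= b -> f t = 0.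
Proof.
move=> ab cf f0 I0 x /andP[ax xb].
have [P dP] := primitive_exists cf.
have mP y z : y <= z -> P y <= P z.
  by move=> yz; apply: (deriv_at_nondecreasing yz (fun z _ => dP z)) => w _; exact: f0.
have Pab : P b <= P a.
  by rewrite -subr_le0 -(integral_derive (ltW ab) cf dP).
have zero y z : a <= y -> y < z -> z <= b -> exists2 c, y < c < z & f c = 0.
  move=> ay yz zb; have [c yc E] := deriv_at_mvt yz (fun w _ => dP w).
  exists c => //; apply/eqP; move: E.
  have -> : P z = P y.
    apply/eqP; rewrite eq_le (mP _ _ (ltW yz)) andbT.
    by rewrite (le_trans (mP _ _ zb))// (le_trans Pab)// mP.
  move/esym/eqP; rewrite subrr mulf_eq0 => /orP[//|].
  by rewrite subr_eq0 gt_eqF.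
apply/eqP; rewrite eq_le f0 andbT leNgt; apply/negP => fx.
have near_f : \forall y \near x, 0 < f y by exact: (cvgr_gt _ (cf x)).
have [d /= d0 hd] := (nbhs_ballP _ _).1 near_f.
have [xlb|bx] := ltP x b.
  have [c /andP[c1 c2] c0] := zero x (Num.min b (x + d)) ax
    ltac:(by rewrite lt_min xlb ltrDl) ltac:(by rewrite ge_min lexx).
  suff : 0 < f c by rewrite c0 ltxx.
  apply: hd; rewrite /ball/= ltr_distl.
  by move: c2; rewrite lt_min => /andP[? ?]; lra.
have [c /andP[c1 c2] c0] := zero (Num.max a (x - d)) x
  ltac:(by rewrite le_max lexx) ltac:(by rewrite gt_max (lt_le_trans ab bx)/= ltrBlDr ltrDl) xb.
suff : 0 < f c by rewrite c0 ltxx.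
apply: hd; rewrite /ball/= ltr_distl.
by move: c1; rewrite gt_max => /andP[? ?]; lra.
Qed.

Lemma polar_angle_ge0 (x : R * R) : exists2 t, 0 <= t <= 2 * pi &
  x = (enorm x * cos t, enorm x * sin t).
Proof.
have p0 := pi_gt0 R; have [t tp xE] := polar_angle x.
have [t0|t0] := leP 0 t; first by exists t => //; lra.
exists (t + pi *+ 2); first by rewrite mulr2n; lra.
by rewrite cosD2pi sinD2pi.
Qed.

(* [g] is an accumulation point of the rescalings on the unit circle. *)
Definition circ_limit v g := forall eps r, 0 < eps -> 0 < r ->
  exists2 s, 0 < s < r & forall t, `|circ_rescale v s t - g t| <= eps.

Section convergence.
Variables (v : R * R -> R) (rho r0 beta E0 : R).
Hypotheses (sv : local_solution v rho) (r0rho : 0 < r0 < rho) (beta0 : 0 < beta)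
  (lim0 : weiss v s @[s --> 0^'+] --> E0)
  (mono : forall r, 0 < r < rho -> weiss v r <= homog_energy v r)
  (epi : forall r, 0 < r <= r0 ->
    beta * (weiss v r - E0) <= 6 * (homog_energy v r - weiss v r)).

Let p0 : 0 < pi :> R := pi_gt0 R.

(** The bound of [circ_rescale_L2] does not involve the smaller radius and so passes to the limit;
    Cauchy-Schwarz on a circle of length [2 pi] turns the L^2 bound into an L^1 bound. *)
Lemma circ_limit_L1 g r : continuous g -> circ_limit v g -> 0 < r <= r0 ->
  cint 0 (2 * pi) (fun t => `|circ_rescale v r t - g t|) <=
    Num.sqrt (2 * pi * (weiss v r - E0) / beta).
Proof.
move=> cg vg /andP[rp rr]; apply/ler_addgt0Pr => d d0.
have [s sr hs] := vg (d / (2 * pi)) r (divr_gt0 d0 (mulr_gt0 (ltr0n _ 2) p0)) rp.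
have cr := circ_rescale_cont sv (r := r); have cs := circ_rescale_cont sv (r := s).
apply: (@le_trans _ _ (cint 0 (2 * pi) (fun t => `|circ_rescale v r t - circ_rescale v s t|) +
    cint 0 (2 * pi) (fun=> d / (2 * pi)))).
  rewrite -cintD; [|by cont|by cont].
  apply: cint_le; [by cont|by cont|] => t _.
  rewrite -(subrK (circ_rescale v s t) (circ_rescale v r t)) -addrA.
  by apply: (le_trans (ler_normD _ _)); rewrite addrK lerD2l.
have p20 : 0 < 2 * pi :> R by rewrite mulr_gt0.
rewrite cint_cst ?(ltW p20)// subr0 divfK ?gt_eqF// lerD2r.
have h := @cint_CS _ 0 (2 * pi) (fun t => `|circ_rescale v r t - circ_rescale v s t|) (fun=> 1)
  ltac:(cont) ltac:(cont).
have e0 : 0 <= weiss v r - E0.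
  by rewrite subr_ge0 (weiss_ge_lim sv lim0 mono)// rp (le_lt_trans rr)//; case/andP: r0rho.
rewrite -ler_sqr ?nnegrE ?sqrtr_ge0//; last by apply: cint_ge0 => t _; exact: normr_ge0.
rewrite sqr_sqrtr; last by rewrite divr_ge0 ?mulr_ge0// ltW.
move: h; rewrite (@cint_eq _ _ _ (fun t => _ * 1) (fun t => `|circ_rescale v r t - circ_rescale v s t|)); last first.
  by move=> t _; rewrite mulr1.
rewrite (@cint_eq _ _ _ (fun=> 1 ^+ 2) (fun=> 1)); last by move=> t _; rewrite expr1n.
rewrite cint_cst ?(ltW p20)// mul1r subr0 => /le_trans; apply.
rewrite mulrC -mulrA ler_pM2l// ler_pdivlMr// mulrC.
rewrite (@cint_eq _ _ _ _ (fun t => (circ_rescale v r t - circ_rescale v s t) ^+ 2)); last first.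
  by move=> t _; rewrite real_normK ?num_real.
exact: (circ_rescale_L2 sv r0rho beta0 lim0 mono epi sr rr).
Qed.

Lemma circ_limit_unique g1 g2 t : continuous g1 -> continuous g2 ->
  circ_limit v g1 -> circ_limit v g2 -> 0 <= t <= 2 * pi -> g1 t = g2 t.
Proof.
move=> c1 c2 l1 l2 tp; have p20 : 0 < 2 * pi :> R by rewrite mulr_gt0.
have cd : continuous (fun t => `|g1 t - g2 t|) by cont.
apply/eqP; rewrite -subr_eq0 -normr_eq0; apply/eqP.
apply: (cint_eq0 p20 cd) tp => [x|]; first exact: normr_ge0.
pose I := cint 0 (2 * pi) (fun t => `|g1 t - g2 t|).
change (I <= 0); rewrite leNgt; apply/negP => I0.
(* Once the excess is below [d], both L^1 distances are below [I / 2], because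
   [2 pi d / beta = I^2 / 8 < (I / 2)^2]; the triangle inequality is then contradicted. *)
pose d := beta * I ^+ 2 / (16 * pi).
have d0 : 0 < d by rewrite divr_gt0// mulr_gt0// exprn_gt0.
have near_e : \forall r \near 0^'+, weiss v r < E0 + d.
  by apply: (@cvgr_lt _ _ _ _ _ _ lim0); rewrite ltrDl.
have near_r : \forall r \near 0^'+, 0 < r <= r0.
  near=> r; apply/andP; split; first by near: r; exact: nbhs_right_gt.
  by apply: ltW; near: r; apply: nbhs_right_lt; case/andP: r0rho.
near (0 : R)^'+ => r.
have er : weiss v r < E0 + d by near: r; exact: near_e.
have rr : 0 < r <= r0 by near: r; exact: near_r.
have h1 := circ_limit_L1 c1 l1 rr; have h2 := circ_limit_L1 c2 l2 rr.
have cr := circ_rescale_cont sv (r := r).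
have : I <= cint 0 (2 * pi) (fun t => `|circ_rescale v r t - g1 t|) +
    cint 0 (2 * pi) (fun t => `|circ_rescale v r t - g2 t|).
  rewrite /I -cintD; [|by cont|by cont].
  apply: cint_le; [by cont|by cont|] => x _.
  by rewrite (distrC (circ_rescale v r x)) ler_distD.
have : Num.sqrt (2 * pi * (weiss v r - E0) / beta) < I / 2.
  rewrite -ltr_sqr ?nnegrE ?sqrtr_ge0//; last by rewrite ltW// divr_gt0.
  rewrite sqr_sqrtr; last first.
    rewrite divr_ge0 ?(ltW beta0)// mulr_ge0 ?(ltW p20)// subr_ge0 (weiss_ge_lim sv lim0 mono)//.
    by move: rr r0rho; lra.
  rewrite ltr_pdivrMr//.
  apply: (@lt_le_trans _ _ (2 * pi * d)); first by rewrite (ltr_pM2l p20) ltrBlDl.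
  have -> : 2 * pi * d = beta * I ^+ 2 / 8.
    by rewrite /d; move: (I ^+ 2) (pi) p0 => z q q0; field; rewrite gt_eqF.
  have : 0 < beta * I ^+ 2 by rewrite mulr_gt0// exprn_gt0.
  have -> : (I / 2) ^+ 2 * beta = (beta * I ^+ 2) / 4 by field.
  by move: (beta * _) => z; lra.
by move: h1 h2; lra.
Unshelve. all: end_near. Qed.

End convergence.

(** The circle of radius [k] at scale [q] is the unit circle at scale [q * k]. So a blowup limit
    gives, on every circle, an accumulation point of one and the same family, which identifies it on
    the whole plane. *)
Lemma blowup_circ_limit u v rho u0 (k : R) : 0 < rho ->
  (forall x, enorm x < rho -> v x = u x) -> blowup_limits u u0 -> 0 < k ->
  circ_limit v (fun t => u0 (k * cos t, k * sin t) / k ^+ 3).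
Proof.
move=> rho0 vu [_ [rj [rj0 rjlim conv]]] k0 eps r e0 r0.
have ek : 0 < eps * k ^+ 3 by rewrite mulr_gt0// exprn_gt0.
(* Balls are open; that of radius [k + 1] contains the circle of radius [k]. *)
have c1 := conv (k + 1) _ (addr_gt0 k0 ltr01) ek.
have m0 : 0 < Num.min r rho / k by rewrite divr_gt0// lt_min r0.
have c2 := cvgr_lt _ rjlim _ m0.
near \oo => j.
have H1 : forall x, eball (k + 1) x -> `|rescale u (rj j) x - u0 x| < eps * k ^+ 3 /\
    enorm (grad (rescale u (rj j)) x - grad u0 x) < eps * k ^+ 3 by near: j; exact: c1.
have : rj j < Num.min r rho / k by near: j; exact: c2.
have rp := rj0 j; move: (rj j) H1 rp => q H1 rp.
rewrite ltr_pdivlMr// lt_min => /andP[qr qrho].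
exists (q * k); first by rewrite mulr_gt0.
move=> t; have kt : enorm (k * cos t, k * sin t) < k + 1 by rewrite enorm_circ ?ltrDl ?ltW.
have [h _] := H1 _ kt.
rewrite /circ_rescale vu; last by rewrite enorm_circ// mulr_ge0 ?ltW.
move: h; rewrite /rescale /= !(mulrA q); move: (u _) (u0 _) => x y h.
have kn0 : k != 0 by rewrite gt_eqF.
have -> : x / (q * k) ^+ 3 - y / k ^+ 3 = (x / q ^+ 3 - y) / k ^+ 3.
  by field; rewrite kn0 gt_eqF.
rewrite normrM [`|_^-1|]gtr0_norm ?invr_gt0 ?exprn_gt0//.
by rewrite ler_pdivrMr ?exprn_gt0// ltW.
Unshelve. all: end_near. Qed.

(** The origin lies on no circle of positive radius and is treated apart. *)
Lemma blowup_at0 u u0 : u (0, 0) = 0 -> blowup_limits u u0 -> u0 (0, 0) = 0.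
Proof.
move=> u00 [_ [rj [rj0 rjlim conv]]].
apply/eqP; rewrite -normr_eq0 eq_le normr_ge0 andbT; apply/ler_addgt0Pr => e e0.
near \oo => j.
have H1 : forall x, eball 1 x -> `|rescale u (rj j) x - u0 x| < e /\
    enorm (grad (rescale u (rj j)) x - grad u0 x) < e.
  by near: j; exact: (conv 1 _ ltr01 e0).
have z : eball 1 (0, 0 : R) by rewrite /eball/= /enorm/= expr0n addr0 sqrtr0.
have [h _] := H1 _ z; move: h.
by rewrite /rescale /= !mulr0 u00 mul0r sub0r normrN add0r => /ltW.
Unshelve. all: end_near. Qed.

Lemma regular_zero u v rho : 0 < rho -> continuous v ->
  (forall x, enorm x < rho -> v x = u x) -> regular_point0 u -> v (0, 0) = 0.
Proof.
move=> rho0 cv vu [[cl _] _]; apply: contrapT => /eqP v0.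
have z : enorm (0, 0 : R) < rho by rewrite /enorm/= expr0n addr0 sqrtr0.
have n1 := near_enorm_lt z.
have n2 : \forall x \near (0, 0 : R), v x != 0 by exact: (cvgr_neq0 _ (cv (0, 0))).
have [x [[_ ux] [xr /eqP vx]]] := cl _ (filterI n1 n2); apply: vx.
by rewrite vu.
Qed.

End blowup.

Theorem theorem1p5 (R : realType) (kappa r0 : R)
    (hkappa : 0 < kappa < 1) (hr0 : 0 < r0 < 1) :
  exists2 C : R, 0 < C &
  forall u : R * R -> R,
    obstacle_solution u -> regular_point0 u ->
    (forall r : R, 0 < r <= r0 -> epiperimetric kappa (hom_ext u r)) ->
    (forall r : R, 0 < r < r0 ->
       `|Phi u r - Phi0 u| <=
       `|Phi u r0 - Phi0 u| * (r / r0) `^ (6 * kappa / (1 - kappa))) /\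
    (forall u0 : R * R -> R, blowup_limits u u0 ->
       (forall r : R, 0 < r < r0 / 2 ->
          circ_int 1 (fun x => `|rescale u r x - u0 x|) <=
          C * r `^ (3 * kappa / (1 - kappa))) /\
       blowup_limits u = [set u0]).
Proof.
pose beta := 6 * kappa / (1 - kappa).
pose K := (2 / r0) ^+ 6 * (12 + (84 / r0 ^+ 2) ^+ 3).
have [/andP[k0 k1] /andP[r00 r01]] := (hkappa, hr0).
have beta0 : 0 < beta by rewrite divr_gt0 ?mulr_gt0 ?subr_gt0.
(* [K] is the bound of [weiss_bound], so the constant is fixed by [kappa] and [r0] before [u] is
   given. The root is that of [circ_limit_L1] for an excess [K * (2 r / r0)^beta], without the power
   of [r]; adding 1 makes the constant positive. *)
exists (Num.sqrt (2 * pi * K / beta * (2 / r0) `^ beta) + 1).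
  by rewrite ltr_wpDl ?sqrtr_ge0.
move=> u su reg epi.
(* A radius strictly between [r0] and 1, so that [v] agrees with [u] on a neighbourhood of the
   closed ball of radius [r0]. *)
pose rho := (r0 + 1) / 2.
have rho01 : 0 < rho < 1 by rewrite /rho; lra.
have r0rho : 0 < r0 < rho by rewrite /rho; lra.
have rho0 : 0 < rho by case/andP: rho01.
have [v sv vu] := local_solution_exists rho01 su.
have Cv : C1 v by case: sv.
have cv := C1_continuous Cv.
have v00 := regular_zero rho0 cv vu reg.
have u00 : u (0, 0) = 0 by rewrite -vu// /enorm/= expr0n addr0 sqrtr0.
have PW r : 0 < r < rho -> Phi u r = weiss v r by exact: Phi_weiss.
have cE r : 0 < r < rho -> forall s t, 0 <= s ->
    hom_ext u r (s * cos t, s * sin t) = s ^+ 3 * (v (r * cos t, r * sin t) / r ^+ 3).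
  by move=> rr s t; exact: (hom_ext_polar t vu rr).
have lim0 : weiss v s @[s --> 0^'+] --> (pi / 81 : R).
  apply: cvg_trans reg.2; apply: near_eq_cvg; near=> s; apply: PW.
  by apply/andP; split; near: s; [exact: nbhs_right_gt|exact: nbhs_right_lt].
have mono r : 0 < r < rho -> weiss v r <= homog_energy v r.
  by move=> rr; exact: weiss_le_homog sv rr (cE r rr).
(* With pi / 81 subtracted, [weiss_le_epi] bounds the excess of [w] by [1 - kappa] times that of
   [h]; solved for [h - w], this yields the factor [kappa / (1 - kappa)]. *)
have epi' r : 0 < r <= r0 ->
    beta * (weiss v r - pi / 81) <= 6 * (homog_energy v r - weiss v r).
  move=> rr; have rr' : 0 < r < rho by move: rr r0rho; lra.
  have := weiss_le_epi sv rr' (cE r rr') (epi r rr).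
  move: (weiss v r) (homog_energy v r) => w h wh.
  by rewrite /beta mulrAC ler_pdivrMr ?subr_gt0//; lra.
have Phi0E : Phi0 u = pi / 81 by apply: cvg_lim; [exact: Rhausdorff|exact: reg.2].
have e0 r : 0 < r < rho -> 0 <= weiss v r - pi / 81.
  by move=> rr; rewrite subr_ge0 (weiss_ge_lim sv lim0 mono).
split=> [r /andP[r1 r2]|u0 bl].
  have rr : 0 < r < rho by move: r0rho; lra.
  rewrite Phi0E !PW// !ger0_norm ?e0//.
  by apply: (excess_decay sv r0rho epi' _ (lexx r0)); rewrite r1 ltW.
have circE w : blowup_limits u w -> forall k : R, 0 < k ->
    continuous (fun t => w (k * cos t, k * sin t) / k ^+ 3) /\
    circ_limit v (fun t => w (k * cos t, k * sin t) / k ^+ 3).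
  move=> bw k kp; split; last exact: (blowup_circ_limit rho0 vu bw kp).
  have cw : continuous w by apply: C1_continuous; apply/C1P; case: bw.
  by cont.
split=> [r /andP[r1 r2]|].
  have [cg lg] := circE _ bl 1 ltr01.
  have rr0 : 0 < r <= r0 by lra.
  have h := circ_limit_L1 sv r0rho beta0 lim0 mono epi' cg lg rr0.
  have -> : circ_int 1 (fun x => `|rescale u r x - u0 x|) =
      cint 0 (2 * pi) (fun t => `|circ_rescale v r t - u0 (1 * cos t, 1 * sin t) / 1 ^+ 3|).
    rewrite /circ_int mul1r; apply: cint_eq => t _.
    rewrite /rescale /circ_rescale /= vu ?enorm_circ ?(ltW r1)//; last by lra.
    by rewrite !mul1r expr1n divr1.
  apply: (le_trans h).
  have hr : 0 < r <= r0 / 2 by lra.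
  have hr0' : r0 / 2 <= r0 by lra.
  have dec := excess_decay sv r0rho epi' hr hr0'.
  have bnd := weiss_bound sv v00 r0rho.
  (* The exponent is half of [beta] because the L^1 distance is bounded by the square root of the
     excess. *)
  have sq : r `^ beta = (r `^ (3 * kappa / (1 - kappa))) ^+ 2.
    rewrite -powR_mulrn ?powR_ge0// -powRrM; congr powR.
    by rewrite /beta; field; rewrite subr_eq0 gt_eqF.
  have e1 : weiss v r - pi / 81 <= K * ((2 / r0) `^ beta * r `^ beta).
    have -> : (2 / r0) `^ beta * r `^ beta = (r / (r0 / 2)) `^ beta.
      rewrite -powRM; [|by rewrite divr_ge0// ltW|exact: ltW].
      by congr powR; field; rewrite gt_eqF.
    apply: (le_trans dec); apply: ler_wpM2r; first exact: powR_ge0.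
    by have := pi_gt0 R; move: bnd; rewrite -/K; lra.
  have P0 : 0 <= r `^ (3 * kappa / (1 - kappa)) by exact: powR_ge0.
  have K0 : 0 <= K.
    apply: mulr_ge0; first by rewrite exprn_ge0// divr_ge0// ltW.
    by apply: addr_ge0 => //; rewrite exprn_ge0// divr_ge0// exprn_ge0// ltW.
  apply: (@le_trans _ _ (Num.sqrt (2 * pi * K / beta * (2 / r0) `^ beta) *
      r `^ (3 * kappa / (1 - kappa)))); last by rewrite ler_wpM2r// lerDl.
  have -> : Num.sqrt (2 * pi * K / beta * (2 / r0) `^ beta) * r `^ (3 * kappa / (1 - kappa)) =
      Num.sqrt (2 * pi * K / beta * (2 / r0) `^ beta * r `^ beta).
    rewrite [RHS]sqrtrM; last first.
      by rewrite mulr_ge0 ?powR_ge0// divr_ge0 ?(ltW beta0)// mulr_ge0// mulr_ge0// ltW// pi_gt0.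
    by rewrite sq sqrtr_sqr ger0_norm.
  rewrite ler_sqrt; last first.
    apply: mulr_ge0; last exact: powR_ge0.
    by rewrite mulr_ge0 ?powR_ge0// divr_ge0 ?(ltW beta0)// mulr_ge0// mulr_ge0// ltW// pi_gt0.
  have -> : 2 * pi * K / beta * (2 / r0) `^ beta * r `^ beta =
      2 * pi * (K * ((2 / r0) `^ beta * r `^ beta)) / beta by move: (_ `^ _) (_ `^ _) => *; field; rewrite gt_eqF.
  rewrite ler_pM2r ?invr_gt0// ler_pM2l// mulr_gt0// pi_gt0//.
(* A second blowup limit is compared with [u0] at each point [x] along the circle of radius
   [enorm x]. *)
apply/seteqP; split=> [w bw /=|w ->//].
apply/funext => x; have [t tp xE] := polar_angle_ge0 x.
have := enorm_ge0 x; rewrite le_eqVlt => /predU1P[x0|x0].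
  by move: xE; rewrite -x0 !mul0r => ->; rewrite (blowup_at0 u00 bw) (blowup_at0 u00 bl).
have [cg lg] := circE _ bl _ x0; have [cg' lg'] := circE _ bw _ x0.
have := circ_limit_unique sv r0rho beta0 lim0 mono epi' cg' cg lg' lg tp.
by rewrite -xE => /mulIf; apply; rewrite invr_neq0// expf_neq0// gt_eqF.
Unshelve. all: end_near. Qed.
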